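(* Let $\mathbb{K}$ be a field, $\mathcal{S}$ a linear subspace of $\mathrm{M}_{n,p}(\mathbb{K})$ with $\operatorname{codim}\mathcal{S}\leq d_n(\mathbb{K})$, and $q\geq 1$. Then the linear range-restricting maps $F:\mathcal{S}\to\mathrm{M}_{n,q}(\mathbb{K})$ are exactly the maps $M\mapsto MP$ with $P\in\mathrm{M}_{p,q}(\mathbb{K})$. If moreover $\mathcal{S}$ has none of Types 1, 2, 3, these maps are also exactly the range-restricting group homomorphisms from $\mathcal{S}$ to $\mathrm{M}_{n,q}(\mathbb{K})$.
   Context: $d_n(\mathbb{K}):=2n-3$ if $\mathbb{K}$ has more than $2$ elements and $d_n(\mathbb{K}):=2n-4$ if $\mathbb{K}$ has $2$ elements. A map $F:\mathcal{S}\to\mathrm{M}_{n,q}(\mathbb{K})$ is range-restricting when $\operatorname{im}F(M)\subset\operatorname{im}M$ (column spaces) for all $M\in\mathcal{S}$. Types (for $\mathcal{S}\subset\mathrm{M}_{n,p}(\mathbb{K})$ seen as operators $\mathbb{K}^p\to\mathbb{K}^n$; $\mathcal{S}x=\{Mx:M\in\mathcal{S}\}$): Type 1 when $\dim\mathcal{S}x=1$ for some $x\in\mathbb{K}^p$; Type 2 when $\mathbb{K}$ has characteristic $2$ and $P\mathcal{S}Q^{-1}=\mathrm{S}_2(\mathbb{K})\vee\mathrm{M}_{n-2,p-2}(\mathbb{K})$ for some invertible $P,Q$, where this is the set of matrices $\begin{bmatrix}A&C\\0&B\end{bmatrix}$ with $A$ a $2\times 2$ symmetric matrix, $B\in\mathrm{M}_{n-2,p-2}(\mathbb{K})$,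 $C\in\mathrm{M}_{2,p-2}(\mathbb{K})$ arbitrary; Type 3 when $\mathbb{K}$ has characteristic $2$, $n=3$ and $P\mathcal{S}Q^{-1}$ is the set of matrices $\begin{bmatrix}A&B\end{bmatrix}$ with $A$ a $3\times 3$ symmetric matrix and $B\in\mathrm{M}_{3,p-3}(\mathbb{K})$ arbitrary, for some invertible $P,Q$. *)

(* Defs.v *)
From HB Require Import structures.
From mathcomp Require Import all_boot all_order all_algebra.
Set Implicit Arguments. Unset Strict Implicit. Unset Printing Implicit Defensive.
Import Order.TTheory GRing.Theory Num.Theory.
Local Open Scope ring_scope.

Definition two_elements (K : fieldType) : Prop := forall x : K, x = 0 \/ x = 1.

(* codim S <= d_n(K), with d_n(K) = 2n-3 (|K|>2) or 2n-4 (|K|=2),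
   stated without truncated subtraction. *)
Definition codim_le_dn (K : fieldType) (n : nat) (c : nat) : Prop :=
  (two_elements K -> (c + 4 <= 2 * n)%N) /\
  (~ two_elements K -> (c + 3 <= 2 * n)%N).

Definition codim (K : fieldType) (n p : nat) (S : {vspace 'M[K]_(n, p)}) : nat :=
  (n * p - \dim S)%N.

(* im (F M) subset im M, column spaces (= row spaces of transposes). *)
Definition range_restricting (K : fieldType) (n p q : nat)
  (S : {vspace 'M[K]_(n, p)}) (F : 'M[K]_(n, p) -> 'M[K]_(n, q)) : Prop :=
  forall M, M \in S -> ((F M)^T <= M^T)%MS.

Definition linear_on (K : fieldType) (n p q : nat)
  (S : {vspace 'M[K]_(n, p)}) (F : 'M[K]_(n, p) -> 'M[K]_(n, q)) : Prop :=
  forall (a : K) M N, M \in S -> N \in S -> F (a *: M + N) = a *: F M + F N.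

Definition additive_on (K : fieldType) (n p q : nat)
  (S : {vspace 'M[K]_(n, p)}) (F : 'M[K]_(n, p) -> 'M[K]_(n, q)) : Prop :=
  forall M N, M \in S -> N \in S -> F (M + N) = F M + F N.

Definition Sx (K : fieldType) (n p : nat) (S : {vspace 'M[K]_(n, p)})
  (x : 'cV[K]_p) : {vspace 'cV[K]_n} :=
  (linfun (mulmxr x) @: S)%VS.

Definition type1 (K : fieldType) (n p : nat) (S : {vspace 'M[K]_(n, p)}) : Prop :=
  exists x : 'cV[K]_p, \dim (Sx S x) = 1%N.

Definition S2_vee (K : fieldType) (n p : nat) (M : 'M[K]_(n, p)) : Prop :=
  (2 <= n)%N /\ (2 <= p)%N /\
  (forall (i : 'I_n) (j : 'I_p), (i < 2)%N -> (j < 2)%N ->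
       forall (i' : 'I_n) (j' : 'I_p), val i' = val j -> val j' = val i ->
       M i j = M i' j') /\
  (forall (i : 'I_n) (j : 'I_p), (2 <= i)%N -> (j < 2)%N -> M i j = 0).

Definition type2 (K : fieldType) (n p : nat) (S : {vspace 'M[K]_(n, p)}) : Prop :=
  (2 \in [pchar K])%N /\
  exists (P : 'M[K]_n) (Q : 'M[K]_p), P \in unitmx /\ Q \in unitmx /\
    forall M : 'M[K]_(n, p), M \in S <-> S2_vee (P *m M *m invmx Q).

(* [A B] with A a 3x3 symmetric matrix *)
Definition sym3_row (K : fieldType) (n p : nat) (M : 'M[K]_(n, p)) : Prop :=
  (3 <= p)%N /\
  (forall (i : 'I_n) (j : 'I_p), (j < 3)%N ->
       forall (i' : 'I_n) (j' : 'I_p), val i' = val j -> val j' = val i ->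
       M i j = M i' j').

Definition type3 (K : fieldType) (n p : nat) (S : {vspace 'M[K]_(n, p)}) : Prop :=
  (2 \in [pchar K])%N /\ n = 3%N /\
  exists (P : 'M[K]_n) (Q : 'M[K]_p), P \in unitmx /\ Q \in unitmx /\
    forall M : 'M[K]_(n, p), M \in S <-> sym3_row (P *m M *m invmx Q).

(* Main.v *)
Require Import Defs.
From HB Require Import structures.
From mathcomp Require Import all_boot all_order all_algebra.
From mathcomp Require Import zify ring.
From Stdlib Require Import Classical.
Set Implicit Arguments. Unset Strict Implicit. Unset Printing Implicit Defensive.
Import GRing.Theory.
Local Open Scope ring_scope.

(** It suffices to treat maps [F] into column vectors: [F s] lies in the image of [s] for
    every [s] in [S], and one wants [F s = s x] for one fixed [x] ("[F] is local").
    Let [T] be the annihilator of [S] for the trace pairing, so that [dim T = codim S].  For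
    a nonzero vector [y] of the target, [F] induces a map on the quotient of [S] by [y], whose
    codimension is [dim T - dim T y]; this allows an induction on [n] whenever [dim T y >= 2],
    and two independent such [y] with local quotients confine [S z] to a plane for some
    nonzero [z].  For [z] in the source, [dim S z + dim {f | z f in T} = n], and [F] can be
    restricted to the matrices of [S] vanishing at [z]; when [S z] is small this is again an
    induction.  If [dim T y <= 1] for a spanning set of suitably generic vectors [y], then
    [T] has dimension at most one or consists of rank one matrices sharing a column, and such
    an elimination applies.
    When [codim S = 2n - 3], what resists has, for [n >= 4], two independent [z] with
    [dim S z = 2]: then [S] is defined by conditions on two columns only, which lead to
    locality or to Type 2.  For [n = 3] there are two more possibilities: either
    [s z2 = A s z1] on [S] for two independent vectors [z1], [z2] and a matrix [A], and
    testing [F] on the Krylov basis of a cyclic vector of [A] gives locality, or [T] is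
    equivalent to the space of alternating matrices, which is Type 3.  Three elements of [K]
    suffice for the linear case and four for the non-homogeneous one; over a field with two
    or three elements additive maps are homogeneous. *)

(** The bound drops by two for each unit of [n], which is why the quotient by [y] enters the
    induction exactly when [dim T y >= 2]. Elimination at [z] assumes [F] already zero on the
    matrices of [S] vanishing at [z]. A value [F s] off the line of [s z] would then produce [n - 1]
    independent rank one matrices in the annihilator of the restricted space, whose dimension is
    [dim T - dim {f | z f in T}]. So elimination needs [dim T + dim S z <= 2n - 2]. For
    [dim T = 2n - 4] this admits planes [S z], which is what two local quotients deliver; for
    [dim T = 2n - 3] it admits only lines, and this gap of one causes all the work on planes.
    Characteristic 2 enters through symmetric matrices: if [alpha] is additive with
    [alpha (t u^2) = u alpha t], then applying [alpha] to the diagonal entries is range-compatible,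
    because [y^T s y] reduces to its diagonal terms. Nonzero maps of this kind are the obstruction
    behind Types 2 and 3. *)

Lemma compl_mx (K : fieldType) (n k : nat) (X : 'M[K]_(n, k)) (f : 'M[K]_(k, n)) :
  f *m X = 1%:M ->
  exists m (B : 'M[K]_(n, m)) (C : 'M[K]_(m, n)),
   (m + k)%N = n /\
   [/\ C *m X = 0, f *m B = 0, C *m B = 1%:M & X *m f + B *m C = 1%:M].
Proof.
move=> fX; pose N : 'M[K]_n := 1%:M - X *m f.
have NN : N *m N = N.
  rewrite /N mulmxBl mul1mx mulmxBr mulmx1 -mulmxA [f *m _]mulmxA fX mul1mx.
  by rewrite subrr subr0.
(* [N] is a projector whose kernel is the column space of [X]; a full-rank factorisation of it gives
   a complement together with its coordinates. *)
have [m [B [C [BC [L HL] [R HR]]]]] : exists m (B : 'M[K]_(n, m)) (C : 'M[K]_(m, n)),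
    [/\ B *m C = N, exists L, L *m B = 1%:M & exists R, C *m R = 1%:M].
  exists (\rank N), (col_base N), (row_base N); split; first exact: mulmx_base.
    by apply/row_fullP; apply: col_base_full.
  by apply/row_freeP; apply: row_base_free.
have CB : C *m B = 1%:M.
  have e : L *m (B *m C *m (B *m C)) *m R = L *m (B *m C) *m R by rewrite BC NN.
  move: e; rewrite !mulmxA HL !mul1mx HR => <-.
  by rewrite -[RHS]mulmxA HR mulmx1.
have fB : f *m B = 0.
  have : f *m N *m R = 0.
    by rewrite /N mulmxBr mulmx1 mulmxA fX mul1mx subrr mul0mx.
  by rewrite -BC -!mulmxA HR mulmx1.
have CX : C *m X = 0.
  have : L *m (N *m X) = 0.
    by rewrite /N mulmxBl mul1mx -mulmxA fX mulmx1 subrr mulmx0.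
  by rewrite -BC !mulmxA HL mul1mx.
have sum1 : X *m f + B *m C = 1%:M by rewrite BC addrC subrK.
exists m, B, C; split=> //.
pose A' := col_mx f C; pose B' := row_mx X B.
have AB : A' *m B' = 1%:M.
  by rewrite /A' /B' mul_col_row fX fB CX CB -scalar_mx_block.
have BA : B' *m A' = 1%:M by rewrite /A' /B' mul_row_col sum1.
have r1 : (\rank (A' *m B') <= n)%N.
  by apply: leq_trans (mxrankM_maxr _ _) _; apply: rank_leq_row.
have r2 : (\rank (B' *m A') <= k + m)%N.
  by apply: leq_trans (mxrankM_maxr _ _) _; apply: rank_leq_row.
rewrite AB mxrank1 in r1; rewrite BA mxrank1 in r2; lia.
Qed.

(** * Annihilators, quotients and restrictions of operator spaces *)

Section Vec.
Variable K : fieldType.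
Implicit Types n m p : nat.

Lemma leftinv_free n k (X : 'M[K]_(n, k)) :
  (forall v : 'cV[K]_k, X *m v = 0 -> v = 0) -> exists f, f *m X = 1%:M.
Proof.
move=> H; have : row_free X^T.
  apply: inj_row_free => v hv; apply: trmx_inj; rewrite trmx0; apply: H.
  by apply: trmx_inj; rewrite trmx_mul trmxK trmx0.
case/row_freeP => B hB; exists B^T; apply: trmx_inj.
by rewrite trmx_mul trmxK hB trmx1.
Qed.

Lemma mul_cV1 n (z : 'cV[K]_n) (a : 'M[K]_1) : z *m a = a 0 0 *: z.
Proof. by rewrite {1}[a]mx11_scalar mul_mx_scalar. Qed.

Lemma mul_1rV n (a : 'M[K]_1) (z : 'rV[K]_n) : a *m z = a 0 0 *: z.
Proof. by rewrite {1}[a]mx11_scalar mul_scalar_mx. Qed.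

Lemma mx11_eq (a b : 'M[K]_1) : a 0 0 = b 0 0 -> a = b.
Proof. by move=> e; rewrite [a]mx11_scalar [b]mx11_scalar e. Qed.

(** The standard frame: [f] is a coordinate equal to 1 at [z], [C] is the projection modulo [z] and
    [B] a section of it. Leaving [m] existential avoids casts along [m + 1 = n]. *)
Lemma compl_vec n (z : 'cV[K]_n) : z != 0 ->
  exists m (f : 'rV[K]_n) (B : 'M[K]_(n, m)) (C : 'M[K]_(m, n)),
   (m + 1)%N = n /\
   [/\ f *m z = 1%:M, C *m z = 0, f *m B = 0, C *m B = 1%:M & z *m f + B *m C = 1%:M].
Proof.
move=> z0.
have [|f fz] := @leftinv_free n 1 z.
  move=> v; rewrite mul_cV1 => /eqP; rewrite scaler_eq0 (negPf z0) orbF => /eqP v0.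
  by apply: mx11_eq; rewrite v0 mxE.
have [m [B [C [e [h1 h2 h3 h4]]]]] := compl_mx fz.
by exists m, f, B, C.
Qed.

Definition lindep2 (V : lmodType K) (y z : V) := forall a b : K, a *: y + b *: z = 0 -> a = 0 /\ b = 0.

Lemma compl_vec2 n (y z : 'cV[K]_n) : lindep2 y z ->
  exists m (f g : 'rV[K]_n) (B : 'M[K]_(n, m)) (C : 'M[K]_(m, n)),
   (m + 2)%N = n /\
   [/\ f *m y = 1%:M, f *m z = 0, g *m y = 0 & g *m z = 1%:M] /\
   [/\ C *m y = 0, C *m z = 0, f *m B = 0 & g *m B = 0] /\
   C *m B = 1%:M /\ y *m f + z *m g + B *m C = 1%:M.
Proof.
move=> yz.
have y0 : y != 0.
  by apply/eqP => y0; case: (yz 1 0); rewrite ?y0 ?scaler0 ?scale0r ?addr0 // => /eqP; rewrite oner_eq0.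
have [m1 [f1 [B1 [C1 [e1 [h1 h2 h3 h4 h5]]]]]] := compl_vec y0.
have Cz0 : C1 *m z != 0.
  apply/eqP => Cz.
  have ez : z = (f1 *m z) 0 0 *: y.
    by rewrite -mul_cV1 -[LHS]mul1mx -h5 mulmxDl -!mulmxA Cz mulmx0 addr0.
  case: (yz (- (f1 *m z) 0 0) 1); first by rewrite {2}ez scale1r scaleNr addNr.
  by move=> _ /eqP; rewrite oner_eq0.
have [m [g [B [C [e [k1 k2 k3 k4 k5]]]]]] := compl_vec Cz0.
have ez : z = (f1 *m z) 0 0 *: y + B1 *m (C1 *m z).
  by rewrite -mul_cV1 -[LHS]mul1mx -h5 mulmxDl -!mulmxA.
(* [f1] need not vanish at [z]; subtracting [f1 z] times the new coordinate [g *m C1] repairs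
   this. *)
exists m, (f1 - (f1 *m z) 0 0 *: (g *m C1)), (g *m C1), (B1 *m B), (C *m C1).
split; first lia.
split; first (split; rewrite ?(mulmxBl, =^~scalemxAl, =^~mulmxA) ?h1 ?h2 ?h3 ?h4 ?k1 ?k2 ?k3 ?k4 ?mulmx0 ?scaler0 ?subr0 ?scalemx1 -?mx11_scalar ?subrr //).
split; first (split; rewrite -?mulmxA).
- by rewrite h2 mulmx0.
- by rewrite k2.
- by rewrite mulmxBl -scalemxAl -!mulmxA (mulmxA f1) h3 (mulmxA C1) h4 mul0mx mul1mx k3 scaler0 subrr.
- by rewrite (mulmxA C1) h4 mul1mx k3.
split; first by rewrite -mulmxA (mulmxA C1) h4 mul1mx k4.
have e2 : B1 *m (C1 *m z *m g + B *m C) *m C1 = B1 *m C1 by rewrite k5 mulmx1.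
rewrite -[RHS]h5 -e2 mulmxBr -scalemxAr [X in _ + X *m (g *m C1)]ez mulmxDl -scalemxAl.
by rewrite addrA subrK mulmxDr mulmxDl !mulmxA addrA.
Qed.

(** The functional [s |-> tr (t s)] written on a basis of [S], so that the annihilator is a kernel
    and rank-nullity applies. *)
Definition tr_row n p (S : {vspace 'M[K]_(n, p)}) (t : 'M[K]_(p, n)) : 'rV[K]_(\dim S) :=
  \row_(i < \dim S) \tr (t *m (vbasis S)`_i).

Fact tr_row_is_linear n p (S : {vspace 'M[K]_(n, p)}) : linear (tr_row S).
Proof.
move=> a u v; apply/rowP => i.
by rewrite !mxE mulmxDl -scalemxAl mxtraceD mxtraceZ.
Qed.

HB.instance Definition _ n p (S : {vspace 'M[K]_(n, p)}) :=
  GRing.isLinear.Build K _ _ _ (tr_row S) (@tr_row_is_linear n p S).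

Lemma dim_mx m n : dim 'M[K]_(m, n) = (m * n)%N.
Proof. exact: dim_matrix. Qed.

(* [\dim] at matrix spaces, with the carrier structure determined by the sizes only: [\dim]
   terms that carry different paths to it are convertible but neither [rewrite] nor [lia]
   identifies them. *)
Definition dm n p (S : {vspace 'M[K]_(n, p)}) : nat := \dim S.

Lemma dmS n p (U V : {vspace 'M[K]_(n, p)}) : (U <= V)%VS -> (dm U <= dm V)%N.
Proof. exact: dimvS. Qed.

Lemma dmf n p : dm (fullv : {vspace 'M[K]_(n, p)}) = (n * p)%N.
Proof. by rewrite /dm dimvf dim_mx. Qed.

Lemma dm_img n p n' p' (h : 'Hom('M[K]_(n, p), 'M[K]_(n', p'))) (U : {vspace 'M[K]_(n, p)}) :
  (dm (U :&: lker h) + dm (h @: U))%N = dm U.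
Proof. exact: limg_ker_dim. Qed.

(* Annihilator for the trace pairing [(t, s) |-> tr (t s)]. *)
Definition orth n p (S : {vspace 'M[K]_(n, p)}) : {vspace 'M[K]_(p, n)} :=
  lker (linfun (tr_row S)).

Lemma orthP n p (S : {vspace 'M[K]_(n, p)}) t :
  reflect (forall s, s \in S -> \tr (t *m s) = 0) (t \in orth S).
Proof.
rewrite /orth memv_ker lfunE; apply: (iffP eqP) => [/rowP h s|h].
  move=> /coord_vbasis ->; rewrite mulmx_sumr raddf_sum big1 //= => i _.
  by rewrite -scalemxAr mxtraceZ; have := h i; rewrite !mxE => ->; rewrite mulr0.
apply/rowP => i; rewrite !mxE; apply: h; apply: vbasis_mem; apply: mem_nth.
by rewrite size_tuple.
Qed.

Lemma dim_orth_ge n p (S : {vspace 'M[K]_(n, p)}) : (n * p <= dm (orth S) + dm S)%N.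
Proof.
have := dm_img (linfun (tr_row S)) fullv; rewrite capfv -/(orth S) dmf.
have := dmS (subvf (limg (linfun (tr_row S)))); rewrite dmf mul1n -/(dm S).
by rewrite mulnC; move: (dm (limg _)) => d; lia.
Qed.

Lemma orth_full n p : orth (fullv : {vspace 'M[K]_(n, p)}) = 0%VS.
Proof.
apply/eqP; rewrite -subv0; apply/subvP => t /orthP h; rewrite memv0.
apply/eqP/matrixP => i j; rewrite mxE.
have := h (delta_mx j i) (memvf _); rewrite mxtrace_mulC /mxtrace (bigD1 j) //= big1 => [|k kj].
  rewrite mxE (bigD1 i) //= big1 => [|l li].
    by rewrite !mxE !eqxx mul1r !addr0.
  by rewrite !mxE eqxx (negPf li) mul0r.
by rewrite mxE big1 // => l _; rewrite !mxE (negPf kj) mul0r.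
Qed.

(** Rank-nullity gives one inequality. Applied to a complement of [S] as well, it gives the other,
    since the two annihilators meet in [orth fullv = 0]. *)
Lemma dim_orth n p (S : {vspace 'M[K]_(n, p)}) : (dm (orth S) + dm S)%N = (n * p)%N.
Proof.
apply/eqP; rewrite eqn_leq dim_orth_ge andbT.
have h1 := dim_orth_ge (S^C)%VS.
have h2 : (orth S :&: orth S^C)%VS = 0%VS.
  apply/eqP; rewrite -subv0 -(orth_full n p); apply/subvP => t /memv_capP [/orthP a /orthP b].
  apply/orthP => s _; have : s \in (S + S^C)%VS by rewrite addv_complf memvf.
  by case/memv_addP => u /a hu [v /b hv ->]; rewrite mulmxDr mxtraceD hu hv addr0.
have h3 : dm (orth S + orth S^C)%VS = (dm (orth S) + dm (orth S^C))%N := dimv_disjoint_sum h2.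
have h4 := dmS (subvf (orth S + orth S^C)%VS).
have h5 := dmS (subvf S).
rewrite h3 dmf mulnC in h4; rewrite dmf in h5.
have h6 : dm (S^C)%VS = (n * p - dm S)%N by rewrite -dmf; apply: dimv_compl.
by rewrite h6 in h1; lia.
Qed.

Lemma orthK n p (S : {vspace 'M[K]_(n, p)}) : orth (orth S) = S.
Proof.
apply/esym/eqP; rewrite eqEdim; apply/andP; split.
  by apply/subvP => s hs; apply/orthP => t /orthP /(_ _ hs); rewrite mxtrace_mulC.
have h1 := dim_orth S; have h2 := dim_orth (orth S); rewrite mulnC in h2.
by change (dm (orth (orth S)) <= dm S)%N; lia.
Qed.

Lemma orth_sep n p (S : {vspace 'M[K]_(n, p)}) s : s \notin S ->
  exists2 t, t \in orth S & \tr (t *m s) != 0.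
Proof.
move=> hs; apply: NNPP => h; case/negP: hs; rewrite -(orthK S); apply/orthP => t ht.
by rewrite mxtrace_mulC; apply/eqP; apply: contraT => h'; case: h; exists t.
Qed.

Lemma tr_rank1 n p (z : 'cV[K]_p) (f : 'rV[K]_n) s : \tr (z *m f *m s) = (f *m s *m z) 0 0.
Proof. by rewrite -mulmxA mxtrace_mulC trace_mx11. Qed.

Lemma orth_rank1P n p (S : {vspace 'M[K]_(n, p)}) (z : 'cV[K]_p) (f : 'rV[K]_n) :
  reflect (forall s, s \in S -> f *m s *m z = 0) (z *m f \in orth S).
Proof.
apply: (iffP (orthP _ _)) => h s /h.
  by rewrite tr_rank1 => e; apply: mx11_eq; rewrite e mxE.
by rewrite tr_rank1 => ->; rewrite mxE.
Qed.

(* For [T = orth S], this is the annihilator of [S z]. *)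
Definition Lam n p (T : {vspace 'M[K]_(p, n)}) (z : 'cV[K]_p) : {vspace 'rV[K]_n} :=
  (linfun (mulmx z) @^-1: T)%VS.

Lemma mem_Lam n p (T : {vspace 'M[K]_(p, n)}) z f : (f \in Lam T z) = (z *m f \in T).
Proof. by rewrite -memv_preim lfunE. Qed.

Lemma SxP n p (S : {vspace 'M[K]_(n, p)}) z v :
  reflect (exists2 s, s \in S & v = s *m z) (v \in Sx S z).
Proof.
by apply: (iffP memv_imgP) => -[s hs ->]; exists s => //; rewrite lfunE.
Qed.

Lemma mem_Sx n p (S : {vspace 'M[K]_(n, p)}) z s : s \in S -> s *m z \in Sx S z.
Proof. by move=> hs; apply/SxP; exists s. Qed.

Lemma dim_Sx_Lam n p (S : {vspace 'M[K]_(n, p)}) z :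
  (dm (Sx S z) + dm (Lam (orth S) z))%N = n.
Proof.
have -> : Lam (orth S) z = orth (Sx S z).
  apply/vspaceP => f; rewrite mem_Lam; apply/orth_rank1P/orthP => h.
    by move=> _ /SxP [s hs ->]; rewrite mulmxA h // mxtrace0.
  by move=> s hs; apply: mx11_eq; rewrite -trace_mx11 -mulmxA h ?mem_Sx // mxE.
by rewrite addnC dim_orth muln1.
Qed.

(** For [C] the projection modulo [y], these are the operators of [S] followed by the quotient of
    the target by [y]. *)
Definition quot n m p (C : 'M[K]_(m, n)) (S : {vspace 'M[K]_(n, p)}) : {vspace 'M[K]_(m, p)} :=
  (linfun (mulmx C) @: S)%VS.

Lemma in_quotP n m p (C : 'M[K]_(m, n)) (S : {vspace 'M[K]_(n, p)}) s' :
  reflect (exists2 s, s \in S & s' = C *m s) (s' \in quot C S).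
Proof. by apply: (iffP memv_imgP) => -[s hs ->]; exists s => //; rewrite lfunE. Qed.

Lemma mem_quot n m p (C : 'M[K]_(m, n)) (S : {vspace 'M[K]_(n, p)}) s :
  s \in S -> C *m s \in quot C S.
Proof. by move=> hs; apply/in_quotP; exists s. Qed.

Lemma orth_quot n m p (C : 'M[K]_(m, n)) (S : {vspace 'M[K]_(n, p)}) t :
  (t \in orth (quot C S)) = (t *m C \in orth S).
Proof.
apply/orthP/orthP => h.
  by move=> s hs; rewrite -mulmxA h ?mem_quot.
by move=> _ /in_quotP [s hs ->]; rewrite mulmxA h.
Qed.

Lemma Lam_quot n m p (C : 'M[K]_(m, n)) (S : {vspace 'M[K]_(n, p)}) z f :
  (f \in Lam (orth (quot C S)) z) = (f *m C \in Lam (orth S) z).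
Proof. by rewrite !mem_Lam orth_quot mulmxA. Qed.

Lemma dim_img_inj n p n' p' (h : 'Hom('M[K]_(n, p), 'M[K]_(n', p'))) (U : {vspace 'M[K]_(n, p)}) :
  (forall u, u \in U -> h u = 0 -> u = 0) -> dm (h @: U) = dm U.
Proof.
move=> H; apply: limg_dim_eq; apply/eqP; rewrite -subv0; apply/subvP => u.
by case/memv_capP => uU; rewrite memv_ker memv0 => /eqP /(H _ uU) ->.
Qed.

(** Right multiplication by [C] identifies the annihilator of the quotient with the elements of
    [orth S] that kill [y]. *)
Lemma dim_orth_quot n m p (S : {vspace 'M[K]_(n, p)}) (y : 'cV[K]_n) (f : 'rV[K]_n)
    (B : 'M[K]_(n, m)) (C : 'M[K]_(m, n)) :
  C *m y = 0 -> C *m B = 1%:M -> y *m f + B *m C = 1%:M ->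
  (dm (orth (quot C S)) + dm (Sx (orth S) y))%N = dm (orth S).
Proof.
move=> Cy CB sum1; rewrite -(dm_img (linfun (mulmxr y)) (orth S)) -/(Sx _ _).
congr addn; rewrite -(@dim_img_inj _ _ _ _ (linfun (mulmxr C))); last first.
  by move=> t _; rewrite lfunE /= => tC; rewrite -[t]mulmx1 -CB mulmxA tC mul0mx.
congr (dm _); apply/vspaceP => t; apply/memv_imgP/memv_capP.
  case=> t' ht' ->; rewrite lfunE /= -orth_quot; split=> //.
  by rewrite memv_ker lfunE /= -mulmxA Cy mulmx0.
case=> tT; rewrite memv_ker lfunE /= => /eqP ty.
have e : t = t *m B *m C.
  by rewrite -[LHS]mulmx1 -sum1 mulmxDr (mulmxA t y) ty mul0mx add0r mulmxA.
by exists (t *m B); rewrite ?lfunE //= orth_quot -e.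
Qed.

(** For [D] the projection modulo [z], these are the operators of [S] vanishing at [z], read on the
    quotient of the source; [orth] exchanges this construction with [quot]. *)
Definition res n m p (D : 'M[K]_(m, p)) (S : {vspace 'M[K]_(n, p)}) : {vspace 'M[K]_(n, m)} :=
  (linfun (mulmxr D) @^-1: S)%VS.

Lemma mem_res n m p (D : 'M[K]_(m, p)) (S : {vspace 'M[K]_(n, p)}) s :
  (s \in res D S) = (s *m D \in S).
Proof. by rewrite -memv_preim lfunE. Qed.

Lemma orth_res n m p (D : 'M[K]_(m, p)) (S : {vspace 'M[K]_(n, p)}) :
  orth (res D S) = quot D (orth S).
Proof.
rewrite -[RHS]orthK; congr (orth _); apply/vspaceP => s.
by rewrite orth_quot orthK mem_res.
Qed.

Lemma dim_orth_res n m p (S : {vspace 'M[K]_(n, p)}) (z : 'cV[K]_p) (f : 'rV[K]_p)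
    (B : 'M[K]_(p, m)) (D : 'M[K]_(m, p)) :
  D *m z = 0 -> f *m z = 1%:M -> z *m f + B *m D = 1%:M ->
  (dm (orth (res D S)) + dm (Lam (orth S) z))%N = dm (orth S).
Proof.
move=> Dz fz sum1; rewrite orth_res -(dm_img (linfun (mulmx D)) (orth S)) addnC.
congr addn; rewrite -(@dim_img_inj _ _ _ _ (linfun (mulmx z))); last first.
  by move=> g _; rewrite lfunE /= => zg; rewrite -[g]mul1mx -fz -mulmxA zg mulmx0.
congr (dm _); apply/vspaceP => t; apply/memv_imgP/memv_capP.
  case=> g; rewrite mem_Lam => hg ->; rewrite lfunE; split=> //.
  by rewrite memv_ker lfunE /= mulmxA Dz mul0mx.
case=> tT; rewrite memv_ker lfunE /= => /eqP Dt.
have e : t = z *m (f *m t).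
  by rewrite mulmxA -[t in LHS]mul1mx -sum1 mulmxDl -[B *m D *m t]mulmxA Dt mulmx0 addr0.
by exists (f *m t); rewrite ?lfunE //= mem_Lam -e.
Qed.
End Vec.

Lemma not_all_in (T : Type) (A P : T -> Prop) :
  ~ (forall x, A x -> P x) -> exists2 x, A x & ~ P x.
Proof.
move=> h; apply: NNPP => h'; apply: h => x Ax; apply: NNPP => Px.
by apply: h'; exists x.
Qed.

(** * Independent pairs and subspaces of small dimension *)

Section Indep.
Variables (K : fieldType) (V : vectType K).
Implicit Types (u v w : V) (U : {vspace V}).

Lemma lindep2_notin w v : w != 0 -> v \notin <[w]>%VS -> lindep2 w v.
Proof.
move=> w0 hv a b; have [->|b0] := eqVneq b 0.
  rewrite scale0r addr0 => /eqP; rewrite scaler_eq0 (negPf w0) orbF => /eqP ->; by [].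
move=> e; case/negP: hv; apply/vlineP; exists (- (b^-1 * a)).
apply: (scalerI b0); rewrite scalerA mulrN mulrA mulfV // mul1r scaleNr.
by apply/eqP; rewrite -addr_eq0 addrC e.
Qed.

Lemma lindep2_neq0 u v : lindep2 u v -> u != 0.
Proof.
move=> uv; apply/eqP => u0; case: (uv 1 0); rewrite ?u0 ?scaler0 ?scale0r ?addr0 //.
by move/eqP; rewrite oner_eq0.
Qed.

Lemma lindep2_sym u v : lindep2 u v -> lindep2 v u.
Proof. by move=> h a b; rewrite addrC => /h []. Qed.

Lemma lindep2_notinP u v : lindep2 u v -> v \notin <[u]>%VS.
Proof.
move=> h; apply/negP => /vlineP [k e]; case: (h (- k) 1).
  by rewrite e scale1r scaleNr addNr.
by move=> _ /eqP; rewrite oner_eq0.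
Qed.

Lemma dim_gt1P U : (1 < \dim U)%N <-> exists u v, [/\ u \in U, v \in U & lindep2 u v].
Proof.
split=> [h|[u [v [uU vU h]]]].
  have /subvPn [u uU]: ~~ (U <= 0)%VS by apply/negP => /dimvS; rewrite dimv0; lia.
  rewrite memv0 => u0.
  have /subvPn [v vU hv]: ~~ (U <= <[u]>)%VS by apply/negP => /dimvS; rewrite dim_vline u0; lia.
  by exists u, v; split=> //; apply: lindep2_notin.
have u0 := lindep2_neq0 h.
have uU' : (<[u]> <= U)%VS by rewrite -memvE.
have /leqifP := dimv_leqif_sup uU'; case: ifP => [|_].
  by move=> /subvP /(_ _ vU) e; have := lindep2_notinP h; rewrite e.
by rewrite dim_vline u0.
Qed.

Lemma dim_le1 U : (\dim U <= 1)%N -> exists u, U = <[u]>%VS.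
Proof.
move=> h; have [->|/eqP U0] := eqVneq U 0%VS; first by exists 0.
exists (vpick U); apply/eqP; rewrite eq_sym eqEdim -memvE memv_pick /= dim_vline.
by rewrite vpick0; move/eqP: U0 => ->.
Qed.

End Indep.

(** * Range-compatible maps and elimination of a source vector *)

Section RC.
Variable K : fieldType.
Implicit Types n m p : nat.

(* Range compatible maps; [rca] adds additivity. *)
Definition rc n p (S : {vspace 'M[K]_(n, p)}) (F : 'M[K]_(n, p) -> 'cV[K]_n) :=
  forall s, s \in S -> exists x : 'cV[K]_p, F s = s *m x.
Definition islocal n p (S : {vspace 'M[K]_(n, p)}) (F : 'M[K]_(n, p) -> 'cV[K]_n) :=
  exists x : 'cV[K]_p, forall s, s \in S -> F s = s *m x.
Definition homog n p (S : {vspace 'M[K]_(n, p)}) (F : 'M[K]_(n, p) -> 'cV[K]_n) :=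
  forall (a : K) s, s \in S -> F (a *: s) = a *: F s.
Definition rca n p (S : {vspace 'M[K]_(n, p)}) (F : 'M[K]_(n, p) -> 'cV[K]_n) :=
  (forall s t, s \in S -> t \in S -> F (s + t) = F s + F t) /\ rc S F.

Section Basic.
Variables (n p : nat) (S : {vspace 'M[K]_(n, p)}) (F : 'M[K]_(n, p) -> 'cV[K]_n).

Lemma rcaD : rca S F -> forall s t, s \in S -> t \in S -> F (s + t) = F s + F t.
Proof. by case. Qed.

Lemma rca0 : rca S F -> F 0 = 0.
Proof. by case=> _ /(_ 0 (mem0v _)) [x ->]; rewrite mul0mx. Qed.

Lemma rcaB : rca S F -> forall s t, s \in S -> t \in S -> F (s - t) = F s - F t.
Proof.
move=> h s t hs ht; apply: (addIr (F t)).
by rewrite -rcaD ?subrK ?memvB.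
Qed.

Lemma rca_subl x : rca S F -> rca S (fun s => F s - s *m x).
Proof.
move=> [h1 h2]; split=> [s t hs ht|s hs].
  by rewrite h1 // mulmxDl opprD addrACA.
by have [y ->] := h2 s hs; exists (y - x); rewrite mulmxBr.
Qed.

Lemma homog_subl x : homog S (fun s => F s - s *m x) <-> homog S F.
Proof.
split=> h a s hs; last by rewrite h // -scalemxAl scalerBr.
by have := h a s hs; rewrite -scalemxAl scalerBr => /addIr.
Qed.

Lemma islocal_subl x : islocal S (fun s => F s - s *m x) -> islocal S F.
Proof.
move=> [y h]; exists (y + x) => s /h /eqP; rewrite subr_eq => /eqP ->.
by rewrite mulmxDr.
Qed.

Lemma islocal_homog : islocal S F -> homog S F.
Proof. by move=> [x h] a s hs; rewrite !h ?memvZ // -scalemxAl. Qed.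

(** If [C (s - t) = 0], then [C (F s - F t) = C (s - t) x = 0] for the [x] given by
    range-compatibility, so [C F s] depends only on [C s]. *)
Lemma quot_rca m (C : 'M[K]_(m, n)) : rca S F ->
  exists F', [/\ rca (quot C S) F', forall s, s \in S -> F' (C *m s) = C *m F s &
    homog S F -> homog (quot C S) F'].
Proof.
move=> h; pose g : 'Hom('M[K]_(n, p), 'M[K]_(m, p)) := (linfun (mulmx C) \o projv S)%VF.
pose sec s' := projv S (g^-1%VF s').
have secS s' : sec s' \in S by rewrite memv_proj.
have secK s : s \in S -> C *m sec (C *m s) = C *m s.
  move=> hs; have e : g s = C *m s by rewrite comp_lfunE lfunE /= projv_id.
  have : C *m s \in limg g by rewrite -e memv_img ?memvf.
  by move/limg_lfunVK; rewrite {1}comp_lfunE lfunE.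
have wd s t : s \in S -> t \in S -> C *m s = C *m t -> C *m F s = C *m F t.
  move=> hs ht e; apply/eqP; rewrite -subr_eq0 -mulmxBr -rcaB //.
  have [_ /(_ _ (memvB hs ht)) [x ->]] := h.
  by rewrite mulmxA mulmxBr e subrr mul0mx.
have E s : s \in S -> C *m F (sec (C *m s)) = C *m F s.
  by move=> hs; apply: wd => //; apply: secK.
exists (fun s' => C *m F (sec s')); split=> //.
  split=> [_ _ /in_quotP [s hs ->] /in_quotP [t ht ->]|_ /in_quotP [s hs ->]].
    by rewrite -mulmxDr !E ?memvD // rcaD // mulmxDr.
  by rewrite E //; have [_ /(_ s hs) [x ->]] := h; exists x; rewrite mulmxA.
by move=> hh a _ /in_quotP [s hs ->]; rewrite scalemxAr !E ?memvZ // hh // scalemxAr.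
Qed.

Lemma res_rca m (D : 'M[K]_(m, p)) : rca S F -> rca (res D S) (fun s => F (s *m D)).
Proof.
move=> [h1 h2]; split=> [s t|s]; rewrite !mem_res => hs.
  by move=> ht; rewrite mulmxDl h1.
by have [x ->] := h2 _ hs; exists (D *m x); rewrite mulmxA.
Qed.

Lemma res_local m (B : 'M[K]_(p, m)) (D : 'M[K]_(m, p)) : D *m B = 1%:M ->
  islocal (res D S) (fun s => F (s *m D)) ->
  exists x, forall s, s \in S -> s = s *m B *m D -> F s = s *m x.
Proof.
move=> DB [x h]; exists (B *m x) => s hs e.
by rewrite {1}e h ?mulmxA // mem_res -e.
Qed.
End Basic.

(** Rank one matrices on independent rows with nonzero columns are independent: a right inverse of
    [G] isolates each column. *)
Lemma outer_dim m n k (U : {vspace 'M[K]_(m, n)}) (G : 'M[K]_(k, n)) : row_free G ->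
  (forall i, exists u : 'cV[K]_m, u != 0 /\ u *m row i G \in U) -> (k <= dm U)%N.
Proof.
move=> /row_freeP [R GR] /fin_all_exists [u hu].
pose Um : 'M[K]_(m, k) := \matrix_(x, i) u i x 0.
pose h : 'Hom('rV[K]_k, 'M[K]_(m, n)) := linfun ((mulmxr G \o mulmx Um) \o diag_mx).
have hE a : h a = \sum_i a 0 i *: (u i *m row i G).
  rewrite lfunE /= mul_mx_diag; apply/matrixP => x y; rewrite mxE summxE.
  apply: eq_bigr => i _; rewrite !mxE big_ord1 !mxE.
  by rewrite mulrAC mulrC mulrA.
have inj a : a \in fullv -> h a = 0 -> a = 0.
  move=> _; rewrite lfunE /= => e.
  have {}e : Um *m diag_mx a = 0 by rewrite -[LHS]mulmx1 -GR mulmxA e mul0mx.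
  apply/rowP => i; rewrite mxE; have [ui _] := hu i.
  apply/eqP; apply: contraNT ui => ai; apply/eqP/colP => x.
  move/matrixP: e => /(_ x i); rewrite mul_mx_diag !mxE => /eqP.
  by rewrite mulf_eq0 (negPf ai) orbF => /eqP.
have := dim_img_inj inj; rewrite dmf mul1n => <-; apply: dmS.
apply/subvP => _ /memv_imgP [a _ ->]; rewrite hE; apply: memv_suml => i _.
by apply: memvZ; case: (hu i).
Qed.

(** As [g s1] vanishes at [z], it factors through [D]. If it were [g s' D] with [s'] in the
    restricted space, [g] would kill the range of [s1 - s' D], hence also [F (s1 - s' D) = F s1]. So
    [g] applied to the restricted space misses a row, and separation yields [u]. *)
Lemma rca_core n p m (S : {vspace 'M[K]_(n, p)}) F (z : 'cV[K]_p) (f : 'rV[K]_p)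
    (B : 'M[K]_(p, m)) (D : 'M[K]_(m, p)) (g : 'rV[K]_n) s1 :
  D *m z = 0 -> z *m f + B *m D = 1%:M ->
  rca S F -> (forall s, s \in S -> s *m z = 0 -> F s = 0) ->
  s1 \in S -> g *m (s1 *m z) = 0 -> g *m F s1 != 0 ->
  exists u : 'cV[K]_m, u != 0 /\ u *m g \in orth (res D S).
Proof.
move=> Dz sum1 hF F0 hs1 gz gF.
have e1 : g *m s1 = g *m s1 *m B *m D.
  by rewrite -[LHS]mulmx1 -sum1 mulmxDr !mulmxA -(mulmxA g) gz mul0mx add0r.
have hx : g *m s1 *m B \notin quot g (res D S).
  apply/negP => /in_quotP [s']; rewrite mem_res => hs' e.
  have [_ /(_ _ (memvB hs1 hs')) [x]] := hF.
  rewrite (rcaB hF) // (F0 _ hs') ?subr0 => [ex|]; last by rewrite -mulmxA Dz mulmx0.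
  by case/negP: gF; rewrite ex mulmxA mulmxBr e1 e mulmxA subrr mul0mx.
have [t ht tx] := orth_sep hx.
exists t; split; last by rewrite -orth_quot.
by apply: contraNneq tx => ->; rewrite mul0mx mxtrace0.
Qed.

Lemma rca_elim n p m (S : {vspace 'M[K]_(n, p)}) F (z : 'cV[K]_p) (f : 'rV[K]_p)
    (B : 'M[K]_(p, m)) (D : 'M[K]_(m, p)) :
  D *m z = 0 -> f *m z = 1%:M -> z *m f + B *m D = 1%:M ->
  rca S F -> (forall s, s \in S -> s *m z = 0 -> F s = 0) ->
  (dm (orth S) + 2 <= n + dm (Lam (orth S) z))%N ->
  forall s, s \in S -> exists a, F s = a *: (s *m z).
Proof.
move=> Dz fz sum1 hF F0 hd s1 hs1; apply: NNPP => hne.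
have w0 : s1 *m z != 0.
  by apply/eqP => w0; case: hne; exists 0; rewrite (F0 _ hs1 w0) scale0r.
have ind : lindep2 (s1 *m z) (F s1).
  apply: lindep2_notin => //; apply/negP => /vlineP [a e]; by apply: hne; exists a.
have [m' [g' [g [B' [C [e [[h1 h2 h3 h4] [[h5 h6 h7 h8] [h9 h10]]]]]]]]] := compl_vec2 ind.
(* The rows [g] and [C_i + g] form a basis of the functionals vanishing at [s1 z], and each takes
   the value 1 at [F s1], so [rca_core] applies to all [n - 1] of them. *)
pose G := col_mx g (C + const_mx 1 *m g).
have rowG i : row i G *m (s1 *m z) = 0 /\ row i G *m F s1 = 1%:M.
  rewrite -!row_mul /G !mul_col_mx !mulmxDl -!mulmxA h3 h4 h5 h6 !mulmx0 mulmx1 !add0r.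
  by split; apply/rowP => j; rewrite !mxE; case: splitP => k _; rewrite !mxE // !ord1 eqxx.
have freeG : row_free G.
  apply: inj_row_free => v; rewrite -[v]hsubmxK /G mul_row_col mulmxDr => e0.
  have eB : rsubmx v = 0.
    have := congr1 (mulmx^~ B') e0; rewrite mul0mx !mulmxDl -!mulmxA h8 h9 !mulmx0 mulmx1.
    by rewrite add0r addr0.
  have eg := congr1 (mulmx^~ (F s1)) e0.
  rewrite /= eB mul0mx mul0mx !addr0 mul0mx -mulmxA h4 mulmx1 in eg.
  by rewrite eB eg row_mx0.
have : (1 + m' <= dm (orth (res D S)))%N.
  apply: (outer_dim freeG) => i; have [r1 r2] := rowG i.
  have gF : row i G *m F s1 != 0 by rewrite r2; exact: matrix_nonzero1.
  exact: (rca_core Dz sum1 hF F0 hs1 r1 gF).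
have := dim_orth_res S Dz fz sum1; lia.
Qed.

(** By additivity, [s] and [t] have the same factor when [s z] and [t z] are independent; two
    independent values then fix the factor of every [s]. *)
Lemma eigen_scalar n p (S : {vspace 'M[K]_(n, p)}) F (z : 'cV[K]_p) :
  rca S F -> (forall s, s \in S -> exists a, F s = a *: (s *m z)) ->
  (1 < dm (Sx S z))%N -> islocal S F.
Proof.
move=> hF H /dim_gt1P [_ [_ [/SxP [s1 hs1 ->] /SxP [s2 hs2 ->] ind]]].
have [a1 e1] := H _ hs1; have [a2 e2] := H _ hs2.
have key s t a b : s \in S -> t \in S -> lindep2 (s *m z) (t *m z) ->
    F s = a *: (s *m z) -> F t = b *: (t *m z) -> a = b.
  move=> hs ht i ea eb; have [c ec] := H _ (memvD hs ht).
  have [] := i (a - c) (b - c).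
    by rewrite !scalerBl -ea -eb addrACA -(rcaD hF) // -opprD -scalerDr -mulmxDl ec subrr.
  by move=> /eqP; rewrite subr_eq0 => /eqP -> /eqP; rewrite subr_eq0 => /eqP ->.
have e12 := key _ _ _ _ hs1 hs2 ind e1 e2.
exists (a1 *: z) => s hs; rewrite -scalemxAr.
have [a e] := H _ hs; rewrite e.
have [sz|/eqP sz] := eqVneq (s *m z) 0; first by rewrite sz !scaler0.
congr (_ *: _); have [s1z|s1z] := boolP (s *m z \in <[s1 *m z]>%VS); last first.
  by apply/esym; apply: key e1 e => //; apply: lindep2_notin => //; apply: lindep2_neq0 ind.
rewrite e12; apply/esym; apply: key e2 e => //; apply: lindep2_notin.
  by apply: lindep2_neq0 (lindep2_sym ind).
apply/negP => s2z; case/vlineP: s1z => k1 k1e; case/vlineP: s2z => k2 k2e.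
case: (ind k1 (- k2)); first by rewrite -k1e scaleNr -k2e subrr.
by move=> k10; rewrite k1e k10 scale0r in sz.
Qed.

(** When [S z] is a line, only homogeneity relates the factors of collinear values; this is where
    Type 1 arises. *)
Lemma rca_line n p (S : {vspace 'M[K]_(n, p)}) F (z : 'cV[K]_p) :
  rca S F -> (forall s, s \in S -> exists a, F s = a *: (s *m z)) ->
  islocal S F \/ (dm (Sx S z) = 1%N /\ ~ homog S F).
Proof.
move=> hF H; have [d1|d1] := ltnP 1 (dm (Sx S z)); first by left; apply: eigen_scalar H d1.
have [u eu] := dim_le1 d1.
have [hom|] := classic (homog S F); last first.
  move=> nh; right; split=> //; apply/eqP; rewrite eqn_leq d1 lt0n /=.
  apply/negP => /eqP /eqP; rewrite dimv_eq0 => /eqP S0; apply: nh => a s hs.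
  have sz t : t \in S -> t *m z = 0.
    by move=> ht; apply/eqP; rewrite -memv0 -S0 mem_Sx.
  have [b ->] := H _ hs; have [c ->] := H _ (memvZ a hs).
  by rewrite !sz ?memvZ // !scaler0.
left; have [S0|] := classic (forall s, s \in S -> s *m z = 0).
  by exists 0 => s hs; have [b ->] := H _ hs; rewrite S0 // mulmx0 scaler0.
move=> /not_all_in [s1 hs1 /eqP s1z].
have [a1 e1] := H _ hs1; exists (a1 *: z) => s hs; rewrite -scalemxAr.
have : s *m z \in <[s1 *m z]>%VS.
  have : s1 *m z \in <[u]>%VS by rewrite -eu mem_Sx.
  have : s *m z \in <[u]>%VS by rewrite -eu mem_Sx.
  move=> /vlineP [k ->] /vlineP [k1 ek1]; rewrite ek1; apply/vlineP; exists (k / k1).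
  rewrite scalerA divfK //; apply: contraNneq s1z => k0; by rewrite ek1 k0 scale0r.
move=> /vlineP [k ek].
have hk : s - k *: s1 \in S by rewrite memvB ?memvZ.
have [b eb] := H _ hk.
have z0 : (s - k *: s1) *m z = 0 by rewrite mulmxBl -scalemxAl ek subrr.
move: eb; rewrite z0 scaler0 (rcaB hF) ?memvZ // hom // => /eqP; rewrite subr_eq0 => /eqP ->.
by rewrite e1 ek !scalerA mulrC.
Qed.

Lemma rca_elim_local n p m (S : {vspace 'M[K]_(n, p)}) F (z : 'cV[K]_p) (f : 'rV[K]_p)
    (B : 'M[K]_(p, m)) (D : 'M[K]_(m, p)) :
  D *m z = 0 -> f *m z = 1%:M -> D *m B = 1%:M -> z *m f + B *m D = 1%:M ->
  rca S F -> islocal (res D S) (fun s => F (s *m D)) ->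
  (dm (orth S) + 2 <= n + dm (Lam (orth S) z))%N ->
  islocal S F \/ (dm (Sx S z) = 1%N /\ ~ homog S F).
Proof.
move=> Dz fz DB sum1 hF /(res_local DB) [x hx] hd.
have hF' := rca_subl x hF.
have F0 s : s \in S -> s *m z = 0 -> F s - s *m x = 0.
  move=> hs sz; apply/eqP; rewrite subr_eq0; apply/eqP; apply: hx => //.
  by rewrite -[LHS]mulmx1 -sum1 mulmxDr !mulmxA sz mul0mx add0r.
have H := rca_elim Dz fz sum1 hF' F0 hd.
have [l|[d nh]] := rca_line hF' H; first by left; apply: islocal_subl l.
by right; split=> // h; apply: nh; apply/homog_subl.
Qed.

Lemma Lam_le n p (S : {vspace 'M[K]_(n, p)}) z :
  z != 0 -> (dm (Lam (orth S) z) <= dm (orth S))%N.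
Proof.
move=> /compl_vec [m [f [B [C [_ [fz Cz _ CB sum1]]]]]].
by have := dim_orth_res S Cz fz sum1; lia.
Qed.

(** Induction on the number of columns, eliminating one basis vector at a time. The exceptional
    outcome [dim S z = 1] would give [Lam] dimension [n - 1], more than [orth S] has. *)
Lemma rca_codim_small n p (S : {vspace 'M[K]_(n, p)}) F :
  (dm (orth S) + 2 <= n)%N -> rca S F -> islocal S F.
Proof.
elim: p S F => [|p IH] S F hd hF.
  by exists 0 => s hs; rewrite [s]thinmx0 (rca0 hF) mul0mx.
have z0 : (delta_mx 0 0 : 'cV[K]_p.+1) != 0.
  by apply/eqP => /matrixP /(_ 0 0) /eqP; rewrite !mxE !eqxx oner_eq0.
have [m [f [B [C [em [fz Cz _ CB sum1]]]]]] := compl_vec z0.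
have {em} em : m = p by lia.
subst m; have hd' := dim_orth_res S Cz fz sum1.
have [||//|[d _]] := rca_elim_local Cz fz CB sum1 hF.
- by apply: IH (res_rca _ hF); lia.
- lia.
have := dim_Sx_Lam S (delta_mx 0 0); have := Lam_le S z0; lia.
Qed.

Lemma rca_codim_elim n p (S : {vspace 'M[K]_(n, p)}) F z :
  z != 0 -> (dm (orth S) + 2 <= n + dm (Lam (orth S) z))%N -> rca S F ->
  islocal S F \/ (dm (Sx S z) = 1%N /\ ~ homog S F).
Proof.
move=> /compl_vec [m [f [B [C [_ [fz Cz _ CB sum1]]]]]] hd hF.
apply: (rca_elim_local Cz fz CB sum1 hF) => //.
apply: rca_codim_small (res_rca _ hF).
by have := dim_orth_res S Cz fz sum1; lia.
Qed.
End RC.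

(** * Quotients by a target vector and codimension at most 2n - 4 *)

Section Compat.
Variable K : fieldType.
Implicit Types n m p : nat.

Lemma mulmx_cV_eq0 m n (M : 'M[K]_(m, n)) : (forall y : 'cV[K]_n, M *m y = 0) -> M = 0.
Proof.
move=> h; apply/matrixP => i j; have /matrixP /(_ i 0) := h (delta_mx j 0).
rewrite !mxE (bigD1 j) //= big1 => [|k kj]; last by rewrite mxE (negPf kj) mulr0.
by rewrite mxE !eqxx mulr1 addr0.
Qed.

(** Spanning is phrased through subspaces so that a linear condition checked on [B] extends to all
    vectors without extracting a basis. *)
Definition spans n (B : 'cV[K]_n -> Prop) :=
  forall W : {vspace 'cV[K]_n}, (forall y, B y -> y \in W) -> W = fullv.

Lemma spans_mem n p (B : 'cV[K]_n -> Prop) (U : {vspace 'cV[K]_p}) (t : 'M[K]_(p, n)) :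
  spans B -> (forall y, B y -> t *m y \in U) -> forall y, t *m y \in U.
Proof.
move=> hB h y; have e : (linfun (mulmx t) @^-1: U)%VS = fullv.
  by apply: hB => x Bx; rewrite -memv_preim lfunE; apply: h.
have : y \in (linfun (mulmx t) @^-1: U)%VS by rewrite e memvf.
by rewrite -memv_preim lfunE.
Qed.

Lemma spans_eq0 n p (B : 'cV[K]_n -> Prop) (t : 'M[K]_(p, n)) :
  spans B -> (forall y, B y -> t *m y = 0) -> t = 0.
Proof.
move=> hB h; apply: mulmx_cV_eq0 => y; apply/eqP; rewrite -memv0.
by apply: (spans_mem hB) => x /h ->; rewrite mem0v.
Qed.

Lemma line_eq n (U V : {vspace 'cV[K]_n}) :
  (dm V <= 1)%N -> U != 0%VS -> (U <= V)%VS -> U = V.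
Proof.
move=> dV U0 UV; apply/eqP; rewrite eqEdim UV /=; apply: leq_trans dV _.
by rewrite lt0n dimv_eq0.
Qed.

Lemma col_rank1 n p (u : 'cV[K]_p) (t : 'M[K]_(p, n)) :
  (forall y, t *m y \in <[u]>%VS) -> exists f, t = u *m f.
Proof.
move=> h; have [e0|u0] := eqVneq u 0.
  exists 0; rewrite mulmx0; apply: mulmx_cV_eq0 => y.
  by apply/eqP; rewrite -memv0; move: (h y); rewrite e0.
have [m [f [B [C [_ [fu Cu _ _ sum1]]]]]] := compl_vec u0.
exists (f *m t); rewrite -[LHS]mul1mx -sum1 mulmxDl -[B *m C *m t]mulmxA (_ : C *m t = 0).
  by rewrite mulmx0 addr0 mulmxA.
apply: mulmx_cV_eq0 => y; rewrite -mulmxA.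
by have /vlineP [k ->] := h y; rewrite -scalemxAr Cu scaler0.
Qed.

(** Otherwise [t (y + c z)] is a nonzero multiple of [t z], while some [t' (y + c z)] lies outside
    [T z]: two independent values at [y + c z]. *)
Lemma bad_pair n p (T : {vspace 'M[K]_(p, n)}) y z c t : c != 0 ->
  ~~ (Sx T y <= Sx T z)%VS -> (dm (Sx T (y + c *: z)) <= 1)%N ->
  t \in T -> t *m y = 0 -> t *m z = 0.
Proof.
move=> c0 /subvPn [_ /SxP [t' ht' ->] t'y] d1 ht ty; apply/eqP; apply: contraTT d1 => tz.
rewrite -ltnNge; apply/dim_gt1P; exists (t *m (y + c *: z)), (t' *m (y + c *: z)).
split; try exact: mem_Sx.
rewrite !mulmxDr ty add0r -!scalemxAr => a b e.
have b0 : b = 0.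
  apply/eqP; apply: contraNT t'y => b0; rewrite -[_ *m y](scalerK b0) memvZ //.
  have -> : b *: (t' *m y) = - (a *: (c *: (t *m z)) + b *: (c *: (t' *m z))).
    by apply/eqP; rewrite -addr_eq0 addrCA -scalerDr e.
  by rewrite memvN memvD // !memvZ ?mem_Sx.
move: e; rewrite b0 scale0r addr0 scalerA => /eqP; rewrite scaler_eq0 (negPf tz) orbF.
by rewrite mulf_eq0 (negPf c0) orbF => /eqP ->.
Qed.

(** If all nonzero lines [T y] coincide, their direction is [u]. Otherwise let [T y0] and [T y1] be
    distinct lines: any further nonzero line differs from one of them, so [t y0 = 0] spreads to
    [t = 0], and evaluation at [y0] embeds [T] in a line. *)
Lemma compat n p (T : {vspace 'M[K]_(p, n)}) (B : 'cV[K]_n -> Prop) :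
  spans B -> (forall y, B y -> dm (Sx T y) <= 1)%N ->
  (forall y z t, B y -> B z -> ~~ (Sx T y <= Sx T z)%VS -> ~~ (Sx T z <= Sx T y)%VS ->
     t \in T -> t *m y = 0 -> t *m z = 0) ->
  (dm T <= 1)%N \/ exists u : 'cV[K]_p, forall t, t \in T -> exists f, t = u *m f.
Proof.
move=> hB h1 h3.
have [h0|] := classic (forall y, B y -> Sx T y = 0%VS).
  left; have -> : T = 0%VS; last by rewrite /dm dimv0.
  apply/eqP; rewrite -subv0; apply/subvP => t ht; rewrite memv0; apply/eqP.
  apply: (spans_eq0 hB) => y /h0 Ty; apply/eqP; by rewrite -memv0 -Ty mem_Sx.
move=> /not_all_in [y0 B0 /eqP Ty0].
have [ha|] := classic (forall y, B y -> (Sx T y <= Sx T y0)%VS).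
  right; have [u eu] := dim_le1 (h1 _ B0); exists u => t ht; apply: col_rank1.
  rewrite -eu; apply: (spans_mem hB) => y /ha /subvP; apply; exact: mem_Sx.
move=> /not_all_in [y1 B1 /negP n10].
have ne U V : B U -> B V -> Sx T U != 0%VS -> ~~ (Sx T V <= Sx T U)%VS -> ~~ (Sx T U <= Sx T V)%VS.
  move=> BU BV U0; apply: contra => UV; by rewrite (line_eq (h1 _ BV) U0 UV).
have n01 := ne _ _ B0 B1 Ty0 n10.
have Ty1 : Sx T y1 != 0%VS by apply: contraNneq n10 => ->; apply: sub0v.
left; have inj t : t \in T -> linfun (mulmxr y0) t = 0 -> t = 0.
  rewrite lfunE /= => ht ty0; apply: (spans_eq0 hB) => y By.
  have [Ty|Ty] := eqVneq (Sx T y) 0%VS; first by apply/eqP; rewrite -memv0 -Ty mem_Sx.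
  have [le|nle] := boolP (Sx T y <= Sx T y0)%VS; last first.
    exact: (h3 _ _ _ B0 By (ne _ _ B0 By Ty0 nle) nle ht ty0).
  have e := line_eq (h1 _ B0) Ty le.
  have ty1 := h3 _ _ _ B0 B1 n01 n10 ht ty0.
  by apply: (h3 _ _ _ B1 By _ _ ht ty1); rewrite e.
by rewrite -(dim_img_inj inj); apply: h1.
Qed.

Lemma spans_notin n (U : {vspace 'cV[K]_n}) : U != fullv -> spans (fun y => y \notin U).
Proof.
move=> Uf W hW; have /subvPn [v _ vU] : ~~ (fullv <= U)%VS.
  by apply: contra Uf => h; rewrite eqEsubv subvf.
apply/vspaceP => x; rewrite memvf.
have [xU|xU] := boolP (x \in U); last exact: hW.
by rewrite -(addrK v x) memvB ?hW // rpredDl.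
Qed.

Lemma exists_notin n (U : {vspace 'cV[K]_n}) : (dm U < n)%N -> exists v, v \notin U.
Proof.
move=> h; have /subvPn [v _ vU] : ~~ (fullv <= U)%VS; last by exists v.
by apply/negP => /dmS; rewrite dmf muln1; lia.
Qed.

Lemma spans_notin_dim n (U : {vspace 'cV[K]_n}) :
  (dm U < n)%N -> spans (fun y => y \notin U).
Proof.
move=> h; apply: spans_notin; apply/eqP => e; move: h.
by rewrite e dmf muln1 ltnn.
Qed.

Lemma dm_vline n p (v : 'M[K]_(n, p)) : (dm <[v]>%VS <= 1)%N.
Proof. by rewrite /dm dim_vline; case: (v != 0). Qed.

Lemma dm_add n (U V : {vspace 'cV[K]_n}) : (dm (U + V)%VS <= dm U + dm V)%N.
Proof. by rewrite /dm -(dimv_sum_cap U V) leq_addr. Qed.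

Lemma dm_plane n (v w : 'cV[K]_n) : (dm (<[v]> + <[w]>)%VS <= 2)%N.
Proof. exact: leq_trans (dm_add _ _) (leq_add (dm_vline v) (dm_vline w)). Qed.

(** This version also serves the field with two elements, where [c = 1] is the only choice in
    [bad_pair]. When [y + z] falls on the exceptional line, the comparison goes through a vector [w]
    outside the plane of [y] and [z]. *)
Lemma compat_line n p (T : {vspace 'M[K]_(p, n)}) (l : 'cV[K]_n) : (2 < n)%N ->
  (forall y, y \notin <[l]>%VS -> dm (Sx T y) <= 1)%N ->
  (dm T <= 1)%N \/ exists u : 'cV[K]_p, forall t, t \in T -> exists f, t = u *m f.
Proof.
move=> n2 bad; apply: (@compat _ _ _ (fun y => y \notin <[l]>%VS)) => //.
  by apply: spans_notin_dim; have := dm_vline l; lia.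
move=> y z t yl zl nyz nzy ht ty.
have [yzl|yzl] := boolP (y + z \in <[l]>%VS); last first.
  by apply: (@bad_pair _ _ T y z 1 t); rewrite ?oner_eq0 // scale1r; apply: bad.
pose Y := (<[y]> + <[z]>)%VS.
have yY : y \in Y by rewrite memvE addvSl.
have zY : z \in Y by rewrite memvE addvSr.
have yz0 : y + z != 0.
  apply: contraNneq nyz => e; have -> : y = - z by apply/eqP; rewrite -addr_eq0 e.
  apply/subvP => _ /SxP [s hs ->]; rewrite mulmxN memvN; exact: mem_Sx.
have lY : (<[l]> <= Y)%VS.
  case/vlineP: yzl => k ek; rewrite -memvE -[l](scalerK (a := k)); last first.
    by apply: contraNneq yz0 => k0; rewrite ek k0 scale0r.
  by rewrite -ek memvZ // memvD.
have badY x : x \notin Y -> (dm (Sx T x) <= 1)%N.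
  by move=> xY; apply: bad; apply: contra xY; move/subvP: lY; apply.
have P a b s : a + b \notin Y -> ~~ (Sx T a <= Sx T b)%VS -> s \in T -> s *m a = 0 -> s *m b = 0.
  by move=> ab nab; apply: (@bad_pair _ _ T a b 1); rewrite ?oner_eq0 // scale1r; apply: badY.
have [w wY [s hs sw]] : exists2 w, w \notin Y & exists2 s, s \in T & s *m w != 0.
  have [w wY] : exists w, w \notin Y by apply: exists_notin; have := dm_plane y z; rewrite -/Y; lia.
  have wyY : w + y \notin Y by rewrite rpredDr.
  apply: NNPP => hn; case/negP: nyz; apply/subvP => _ /SxP [s hs ->].
  have tw x : x \notin Y -> s *m x = 0.
    by move=> xY; apply/eqP; apply: contraT => sx; case: hn; exists x => //; exists s.
  by have := tw _ wyY; rewrite mulmxDr tw // add0r => ->; rewrite mem0v.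
have Tw0 : Sx T w != 0%VS.
  by apply: contraNneq sw => e; rewrite -memv0 -e mem_Sx.
have swap a b : (dm (Sx T b) <= 1)%N -> Sx T a != 0%VS -> ~~ (Sx T b <= Sx T a)%VS -> ~~ (Sx T a <= Sx T b)%VS.
  by move=> db a0; apply: contra => UV; rewrite (line_eq db a0 UV).
have yw : y + w \notin Y by rewrite rpredDl.
have zw : z + w \notin Y by rewrite rpredDl.
apply/eqP; apply: contraT => tz.
have Tz0 : Sx T z != 0%VS by apply: contraNneq tz => e; rewrite -memv0 -e mem_Sx.
have Ty0 : Sx T y != 0%VS by apply: contraNneq nyz => ->; apply: sub0v.
have [lwz|nwz] := boolP (Sx T w <= Sx T z)%VS.
  have ewz := line_eq (bad _ zl) Tw0 lwz.
  have tw : t *m w = 0 by apply: (P y) => //; rewrite ewz.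
  have tw' : t *m (z + w) = t *m z by rewrite mulmxDr tw addr0.
  have le' : (Sx T (z + w) <= Sx T z)%VS.
    apply/subvP => _ /SxP [r hr ->]; rewrite mulmxDr memvD ?mem_Sx // -ewz; exact: mem_Sx.
  have ne' : Sx T (z + w) != 0%VS.
    by apply: contraNneq tz => e; rewrite -tw' -memv0 -e mem_Sx.
  have e' := line_eq (bad _ zl) ne' le'.
  have : t *m (z + w) = 0.
    apply: (P y) => //; last by rewrite e'.
    by rewrite addrA rpredDl // memvD.
  by rewrite tw' => /eqP; rewrite (negPf tz).
have [lwy|nwy] := boolP (Sx T w <= Sx T y)%VS; last first.
  have nyw := swap _ _ (badY _ wY) Ty0 nwy.
  have tw : t *m w = 0 by apply: (P y).
  by case/eqP: tz; apply: (P w) => //; rewrite addrC.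
have ewy := line_eq (bad _ yl) Tw0 lwy.
have Pwz s' : s' \in T -> s' *m w = 0 -> s' *m z = 0.
  by apply: P; rewrite 1?addrC // ewy.
have tw : t *m w != 0 by apply: contra tz => /eqP tw; apply/eqP; apply: Pwz.
have tyw : t *m (y + w) = t *m w by rewrite mulmxDr ty add0r.
have le' : (Sx T (y + w) <= Sx T y)%VS.
  apply/subvP => _ /SxP [r hr ->]; rewrite mulmxDr memvD ?mem_Sx // -ewy; exact: mem_Sx.
have ne' : Sx T (y + w) != 0%VS.
  by apply: contraNneq tw => e; rewrite -tyw -memv0 -e mem_Sx.
have e' := line_eq (bad _ yl) ne' le'.
have zyw : z + (y + w) \notin Y by rewrite addrA rpredDl // memvD.
have Pz s' : s' \in T -> s' *m z = 0 -> s' *m (y + w) = 0.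
  by apply: P; rewrite // e'.
have [r hr ry] : exists2 r, r \in T & r *m y != 0.
  case/subvPn: nyz => _ /SxP [r hr ->] h; exists r => //.
  by apply: contraNneq h => ->; rewrite mem0v.
have [u eu] := dim_le1 (bad _ yl).
have uP x s' : s' \in T -> Sx T x = Sx T y -> exists k, s' *m x = k *: u.
  by move=> hs' ex; apply/vlineP; rewrite -eu -ex mem_Sx.
have [k1 ek1] := uP w t ht ewy; have [k2 ek2] := uP w r hr ewy.
have k10 : k1 != 0 by apply: contraNneq tw => k0; rewrite ek1 k0 scale0r.
(* [s'] kills [w], hence [z], hence [y + w], hence [y]; but [s' y = r y] is nonzero, as
   [t y = 0]. *)
pose s' := r - (k2 / k1) *: t.
have hs' : s' \in T by rewrite memvB ?memvZ.
have sw' : s' *m w = 0 by rewrite mulmxBl -scalemxAl ek1 ek2 scalerA divfK // subrr.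
have := Pz _ hs' (Pwz _ hs' sw'); rewrite mulmxDr sw' addr0.
by rewrite mulmxBl -scalemxAl ty scaler0 subr0 => /eqP; rewrite (negPf ry).
Qed.

Lemma quot_pack n p (S : {vspace 'M[K]_(n, p)}) F (y : 'cV[K]_n) : y != 0 -> rca S F ->
  exists m (C : 'M[K]_(m, n)) F', (m + 1)%N = n /\ [/\ rca (quot C S) F', forall s, s \in S -> F' (C *m s) = C *m F s,
     homog S F -> homog (quot C S) F', C *m y = 0 & forall v, C *m v = 0 -> exists a, v = a *: y] /\
   [/\ (dm (orth (quot C S)) + dm (Sx (orth S) y))%N = dm (orth S),
     forall k (f : 'M[K]_(k, m)), f *m C = 0 -> f = 0 &
     forall f : 'rV[K]_n, f *m y = 0 -> exists f', f = f' *m C].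
Proof.
move=> y0 hF; have [m [f [B [C [em [fy Cy fB CB sum1]]]]]] := compl_vec y0.
have [F' [h1 h2 h3]] := quot_rca C hF.
exists m, C, F'; split=> //; split; first split=> //.
  move=> v Cv; exists ((f *m v) 0 0).
  by rewrite -mul_cV1 -[LHS]mul1mx -sum1 mulmxDl -!mulmxA Cv mulmx0 addr0.
split; first exact: dim_orth_quot sum1.
  by move=> k g gC; rewrite -[g]mulmx1 -CB mulmxA gC mul0mx.
move=> g gy; exists (g *m B).
by rewrite -[LHS]mulmx1 -sum1 mulmxDr !mulmxA gy mul0mx add0r.
Qed.

Lemma Lam_quot_le n m p (S : {vspace 'M[K]_(n, p)}) (C : 'M[K]_(m, n)) z :
  (forall k (f : 'M[K]_(k, m)), f *m C = 0 -> f = 0) ->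
  (dm (Lam (orth (quot C S)) z) <= dm (Lam (orth S) z))%N.
Proof.
move=> inj; rewrite -(@dim_img_inj _ _ _ _ _ (linfun (mulmxr C))); last first.
  by move=> f _; rewrite lfunE /=; apply: inj.
by apply: dmS; apply/subvP => _ /memv_imgP [f hf ->]; rewrite lfunE /= -Lam_quot.
Qed.

Lemma islocal_quot n m p (S : {vspace 'M[K]_(n, p)}) F (C : 'M[K]_(m, n)) F' y :
  (forall s, s \in S -> F' (C *m s) = C *m F s) ->
  (forall v, C *m v = 0 -> exists a, v = a *: y) -> islocal (quot C S) F' ->
  exists x, forall s, s \in S -> exists a, F s - s *m x = a *: y.
Proof.
move=> h1 h2 [x hx]; exists x => s hs; apply: h2.
by rewrite mulmxBr -h1 // hx ?mem_quot // mulmxA subrr.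
Qed.

(** The difference of the two local descriptions of [F] is [s (x1 - x2)], a combination of the two
    error terms. *)
Lemma two_local n p (S : {vspace 'M[K]_(n, p)}) F y1 y2 x1 x2 :
  (forall s, s \in S -> exists a, F s - s *m x1 = a *: y1) ->
  (forall s, s \in S -> exists a, F s - s *m x2 = a *: y2) ->
  lindep2 y1 y2 -> islocal S F \/
  x1 - x2 != 0 /\ forall s, s \in S -> s *m (x1 - x2) \in (<[y1]> + <[y2]>)%VS.
Proof.
move=> h1 h2 ind; have [e|ne] := eqVneq x1 x2; [left|right].
  exists x1 => s hs; have [a ea] := h1 s hs; have [b] := h2 s hs; rewrite -e ea => eb.
  case: (ind a (- b)); first by rewrite scaleNr eb subrr.
  by move=> a0 _; apply/eqP; rewrite -subr_eq0 ea a0 scale0r.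
split; first by rewrite subr_eq0.
move=> s hs; have [a ea] := h1 s hs; have [b eb] := h2 s hs.
have -> : s *m (x1 - x2) = b *: y2 - a *: y1.
  by rewrite -ea -eb mulmxBr opprB addrCA addrAC subrr sub0r addrC.
by rewrite addrC memv_add // ?memvN memvZ ?memv_line.
Qed.

Lemma dm_Sx_plane n p (S : {vspace 'M[K]_(n, p)}) z (U : {vspace 'cV[K]_n}) :
  (forall s, s \in S -> s *m z \in U) -> (dm (Sx S z) <= dm U)%N.
Proof. by move=> h; apply: dmS; apply/subvP => _ /SxP [s hs ->]; apply: h. Qed.

Lemma Sx0 n p (S : {vspace 'M[K]_(n, p)}) : Sx S 0 = 0%VS.
Proof. by apply/eqP; rewrite -subv0; apply/subvP => _ /SxP [s _ ->]; rewrite mulmx0 mem0v. Qed.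

Lemma Sx1_neq0 n p (S : {vspace 'M[K]_(n, p)}) z : dm (Sx S z) = 1%N -> z != 0.
Proof.
by apply: contra_eqN => /eqP ->; rewrite Sx0 [dm _]dimv0.
Qed.

(** Here [dim Lam] at [u] is at least [dim orth S], so the elimination inequality at [u] reduces to
    [n >= 2]. *)
Lemma rca_rank1 n p (S : {vspace 'M[K]_(n, p)}) F (u : 'cV[K]_p) :
  (1 < n)%N -> (forall t, t \in orth S -> exists f, t = u *m f) -> rca S F ->
  islocal S F \/ ((exists z, dm (Sx S z) = 1%N) /\ ~ homog S F).
Proof.
move=> n1 hu hF; have [u0|u0] := eqVneq u 0.
  left; apply: rca_codim_small hF; rewrite (_ : orth S = 0%VS) ?[dm _]dimv0 //.
  by apply/eqP; rewrite -subv0; apply/subvP => t /hu [f ->]; rewrite u0 mul0mx mem0v.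
have hd : (dm (orth S) <= dm (Lam (orth S) u))%N.
  rewrite -(@dim_img_inj _ _ _ _ _ (linfun (mulmx u)) (Lam (orth S) u)).
    apply: dmS; apply/subvP => t ht; have [f ef] := hu t ht.
    by apply/memv_imgP; exists f; rewrite ?lfunE // mem_Lam -ef.
  move=> f _; rewrite lfunE /=; have [m [g [B [C [_ [gu _ _ _ _]]]]]] := compl_vec u0.
  by move=> uf; rewrite -[f]mul1mx -gu -mulmxA uf mulmx0.
have [||[d nh]] := rca_codim_elim u0 _ hF; [lia|by left|right].
by split=> //; exists u.
Qed.

(** Independent [y1], [y2] with local quotients give [dim S z <= 2], which elimination still accepts
    here. So the vectors with [dim T y >= 2] lie on one line, and [compat_line] concludes over any
    field. *)
Lemma rca_codim_2n4 n p (S : {vspace 'M[K]_(n, p)}) F :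
  (dm (orth S) + 4 <= 2 * n)%N -> rca S F ->
  islocal S F \/ ((exists z, dm (Sx S z) = 1%N) /\ ~ homog S F).
Proof.
elim/ltn_ind: n p S F => n IH p S F hd hF.
have [small|large] := leqP (dm (orth S) + 2) n; first by left; apply: rca_codim_small.
have n2 : (2 < n)%N by lia.
have elim z : z != 0 -> (dm (orth S) + 2 <= n + dm (Lam (orth S) z))%N ->
    islocal S F \/ ((exists z, dm (Sx S z) = 1%N) /\ ~ homog S F).
  move=> z0 hz; have [|[d nh]] := rca_codim_elim z0 hz hF; [by left|right].
  by split=> //; exists z.
apply: NNPP => nG.
have loc y : (1 < dm (Sx (orth S) y))%N ->
    exists x, forall s, s \in S -> exists a, F s - s *m x = a *: y.
  move=> gy; have y0 : y != 0.
    apply: contraTneq gy => ->; rewrite -leqNgt.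
    by rewrite Sx0 [dm _]dimv0.
  have [m [C [F' [em [[hF' hC _ Cy hk] [hdq hinj _]]]]]] := quot_pack y0 hF.
  have [||h|[[z dz] _]] := IH m _ p (quot C S) F' _ hF'; try lia.
    exact: islocal_quot h.
  (* A vector whose image in the quotient is a line has [dim Lam >= n - 2] in [S] itself, which
     suffices to eliminate it there. *)
  case: nG; apply: (elim z); first exact: Sx1_neq0 dz.
  have := Lam_quot_le S z hinj; have := dim_Sx_Lam (quot C S) z; lia.
have dep y1 y2 : (1 < dm (Sx (orth S) y1))%N -> (1 < dm (Sx (orth S) y2))%N -> ~ lindep2 y1 y2.
  move=> /loc [x1 h1] /loc [x2 h2] ind; have [|[z0 hz]] := two_local h1 h2 ind.
    by move=> h; apply: nG; left.
  apply: nG; apply: (elim _ z0).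
  have := dm_Sx_plane hz; have := dm_plane y1 y2; have := dim_Sx_Lam S (x1 - x2); lia.
have [l hl] : exists l, forall y, y \notin <[l]>%VS -> (dm (Sx (orth S) y) <= 1)%N.
  have [h|] := classic (forall y, (dm (Sx (orth S) y) <= 1)%N); first by exists 0.
  move=> /not_all_ex_not [l /negP]; rewrite -ltnNge => hl; exists l => y yl.
  rewrite leqNgt; apply/negP => hy; apply: (dep l y) => //; apply: lindep2_notin => //.
  apply: contraTneq hl => ->; rewrite -leqNgt.
  by rewrite Sx0 [dm _]dimv0.
have [|[u hu]] := compat_line n2 hl; first by lia.
by apply: nG; apply: rca_rank1 hu hF; lia.
Qed.
End Compat.

(** * Avoiding finitely many subspaces *)

Section Covering.
Variables (K : fieldType) (V : vectType K).

(** A subspace that does not contain both [u] and [v] meets the line [u + k v] in at most one point,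
    so it costs one scalar of the list. *)
Lemma line_avoid (As : seq {vspace V}) (u v : V) (ks : seq K) :
  uniq ks -> (size As < size ks)%N ->
  (forall A, A \in As -> ~~ ((u \in A) && (v \in A))) ->
  exists2 k, k \in ks & forall A, A \in As -> u + k *: v \notin A.
Proof.
elim: As ks => [|A As IH] ks uks hs hA.
  by case: ks hs {uks} => // k ks _; exists k; rewrite ?mem_head.
have hAs B : B \in As -> ~~ ((u \in B) && (v \in B)).
  by move=> hB; apply: hA; rewrite inE hB orbT.
have [|nbad] := classic (exists2 k, k \in ks & u + k *: v \in A); last first.
  have [|k hk h] := IH ks uks _ hAs; first by apply: ltnW.
  exists k => // B; rewrite inE => /orP [/eqP ->|]; last exact: h.
  by apply/negP => hb; apply: nbad; exists k.
case=> k0 hk0 bad0.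
have [|k hk h] := IH (rem k0 ks) (rem_uniq _ uks) _ hAs.
  by rewrite size_rem //; case: (ks) hk0 hs => //= a l _; rewrite ltnS.
exists k; first exact: mem_rem hk.
move=> B; rewrite inE => /orP [/eqP ->|]; last exact: h.
apply/negP => bad; have nk : k - k0 != 0.
  by rewrite subr_eq0; move: hk; rewrite mem_rem_uniq // inE => /andP [].
have vA : v \in A.
  have : (k - k0) *: v \in A.
    have -> : (k - k0) *: v = (u + k *: v) - (u + k0 *: v).
      by rewrite scalerBl opprD addrACA subrr add0r.
    by rewrite memvB.
  by move=> h'; rewrite -[v](scalerK nk) memvZ.
have := hA A (mem_head _ _); rewrite vA andbT.
by rewrite -[u](addrK (k0 *: v)) memvB ?memvZ.
Qed.

(** If the vector [v] found so far lies in the new subspace [A], take [u] outside [A]: every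
    [u + k v] is then outside [A], and [line_avoid] treats the earlier subspaces. This admits as
    many subspaces as scalars. *)
Lemma avoid_subspaces (W : {vspace V}) (As : seq {vspace V}) (ks : seq K) :
  uniq ks -> (size As <= size ks)%N -> (forall A, A \in As -> ~~ (W <= A)%VS) ->
  exists2 v, v \in W & forall A, A \in As -> v \notin A.
Proof.
move=> uks; elim: As => [|A As IH] hs hA; first by exists 0; rewrite ?mem0v.
have [||v vW hv] := IH _ _; first by apply: ltnW.
  by move=> B hB; apply: hA; rewrite inE hB orbT.
have [vA|vA] := boolP (v \in A); last first.
  by exists v => // B; rewrite inE => /orP [/eqP ->|]; last exact: hv.
have /subvPn [u uW uA] := hA A (mem_head _ _).
have [k _ hk] : exists2 k, k \in ks & forall A, A \in As -> u + k *: v \notin A.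
  apply: line_avoid => // B hB; by rewrite negb_and hv // orbT.
exists (u + k *: v); first by rewrite memvD // memvZ.
move=> B; rewrite inE => /orP [/eqP ->|]; last exact: hk.
by rewrite rpredDr // memvZ.
Qed.
End Covering.

(** * Coordinate-free forms of Types 2 and 3 *)

Section Types.
Variable K : fieldType.
Implicit Types n m p : nat.

Lemma unit_of_compl n k (X : 'M[K]_(k + n, k)) (f : 'M[K]_(k, k + n)) B (C : 'M[K]_(n, k + n)) :
  f *m X = 1%:M -> C *m X = 0 -> f *m B = 0 -> C *m B = 1%:M ->
  [/\ col_mx f C \in unitmx, row_mx X B \in unitmx & invmx (col_mx f C) = row_mx X B].
Proof.
move=> fX CX fB CB.
have e : col_mx f C *m row_mx X B = 1%:M.
  by rewrite mul_col_row fX CX fB CB -scalar_mx_block.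
have [u1 u2] := mulmx1_unit e; split=> //.
by rewrite -[LHS]mulmx1 -e mulmxA mulVmx // mul1mx.
Qed.

Lemma S2_vee_block m m' (M : 'M[K]_(2 + m, 2 + m')) :
  S2_vee M <-> (ulsubmx M)^T = ulsubmx M /\ dlsubmx M = 0.
Proof.
split=> [[_ [_ [h1 h2]]]|[h1 h2]].
  split; apply/matrixP => i j; rewrite !mxE; first by apply: h1; rewrite /= ?ltn_ord.
  by apply: h2; rewrite /= ?leq_addr ?ltn_ord.
split; first by []; split; first by []; split.
  move=> i j i2 j2 i' j' e1 e2.
  have i'2 : (i' < 2)%N by rewrite e1.
  have j'2 : (j' < 2)%N by rewrite e2.
  have ei : i = lshift m (Ordinal i2) by apply: val_inj.
  have ej : j = lshift m' (Ordinal j2) by apply: val_inj.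
  have ei' : i' = lshift m (Ordinal j2) by apply: val_inj.
  have ej' : j' = lshift m' (Ordinal i2) by apply: val_inj.
  by rewrite ei ej ei' ej'; have /matrixP /(_ (Ordinal j2) (Ordinal i2)) := h1; rewrite !mxE.
move=> i j i2 j2.
have i2' : (i - 2 < m)%N by have := ltn_ord i; lia.
have ei : i = rshift 2 (Ordinal i2') by apply: val_inj => /=; rewrite subnKC.
have ej : j = lshift m' (Ordinal j2) by apply: val_inj.
by rewrite ei ej; have /matrixP /(_ (Ordinal i2') (Ordinal j2)) := h2; rewrite !mxE.
Qed.

(** The columns of [Z] are sent into the plane of the columns of [X] by a symmetric matrix;
    complements of [X] and [Z] complete the change of bases. *)
Lemma type2_intro n p (S : {vspace 'M[K]_(n, p)}) (X : 'M[K]_(n, 2)) f (Z : 'M[K]_(p, 2)) z :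
  2%N \in [pchar K] -> f *m X = 1%:M -> z *m Z = 1%:M ->
  (forall M, M \in S <-> exists A : 'M[K]_2, A^T = A /\ M *m Z = X *m A) -> type2 S.
Proof.
move=> c2 fX zZ; have [m [B [C [em [CX fB CB sum1]]]]] := compl_mx fX.
have [m' [B' [C' [em' [CX' fB' CB' sum1']]]]] := compl_mx zZ.
rewrite addnC in em; rewrite addnC in em'; subst n p => HS; split=> //.
have [u1 u2 _] := unit_of_compl fX CX fB CB.
have [u3 u4 e4] := unit_of_compl zZ CX' fB' CB'.
exists (col_mx f C), (col_mx z C'); split=> //; split=> // M; rewrite e4.
have -> : S2_vee (col_mx f C *m M *m row_mx Z B') <-> (f *m M *m Z)^T = f *m M *m Z /\ C *m M *m Z = 0.
  rewrite S2_vee_block mul_col_mx mul_col_row.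
  by rewrite block_mxKul block_mxKdl.
rewrite HS; split=> [[A [sA e]]|[h1 h2]].
  by rewrite -!mulmxA e !mulmxA fX CX mul1mx mul0mx.
exists (f *m M *m Z); split=> //.
by rewrite -[LHS]mul1mx -sum1 mulmxDl -!mulmxA (mulmxA C) h2 mulmx0 addr0.
Qed.

(** [C] is a system of [n - 2] independent equations of a plane that contains the images of both
    columns of [Z]. *)
Lemma type2_elim n p (S : {vspace 'M[K]_(n, p)}) : type2 S ->
  2%N \in [pchar K] /\
  exists m (Z : 'M[K]_(p, 2)) z (C : 'M[K]_(m, n)) R,
  [/\ (m + 2)%N = n, z *m Z = 1%:M, C *m R = 1%:M & forall M, M \in S -> C *m M *m Z = 0].
Proof.
case=> c2 [P [Q [uP [uQ HS]]]]; split=> //.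
have [hn [hp _]] : (2 <= n)%N /\ (2 <= p)%N /\ True.
  by have /HS [? [? _]] := mem0v S.
have en : n = (2 + (n - 2))%N by lia.
have ep : p = (2 + (p - 2))%N by lia.
move: (n - 2)%N (p - 2)%N en ep => m m' en ep; subst n p.
exists m, (lsubmx (invmx Q)), (usubmx Q), (dsubmx P), (rsubmx (invmx P)).
split; first by rewrite addnC.
- have := mulmxV uQ; rewrite -{1}[Q]vsubmxK -{1}[invmx Q]hsubmxK mul_col_row scalar_mx_block.
  by case/eq_block_mx.
- have := mulmxV uP; rewrite -{1}[P]vsubmxK -{1}[invmx P]hsubmxK mul_col_row scalar_mx_block.
  by case/eq_block_mx.
move=> M /HS; rewrite S2_vee_block => -[_].
rewrite -{1}[P]vsubmxK -{1}[invmx Q]hsubmxK mul_col_mx mul_col_row.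
by rewrite block_mxKdl.
Qed.

Lemma sym3_row_block m (M : 'M[K]_(3, 3 + m)) :
  sym3_row M <-> (lsubmx M)^T = lsubmx M.
Proof.
split=> [[_ h1]|h1].
  by apply/matrixP => i j; rewrite !mxE; apply: h1; rewrite /= ?ltn_ord.
split=> // i j j2 i' j' e1 e2.
have ej : j = lshift m (Ordinal j2) by apply: val_inj; rewrite /= ?e1 ?e2.
have j'2 : (j' < 3)%N by rewrite e2 ltn_ord.
have ej' : j' = lshift m i by apply: val_inj; rewrite /= ?e1 ?e2.
have ei' : i' = Ordinal j2 by apply: val_inj; rewrite /= ?e1 ?e2.
by rewrite ej ei' ej'; have /matrixP /(_ (Ordinal j2) i) := h1; rewrite !mxE.
Qed.

Lemma type3_intro p (S : {vspace 'M[K]_(3, p)}) (f : 'M[K]_3) (Z : 'M[K]_(p, 3)) z :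
  2%N \in [pchar K] -> f \in unitmx -> z *m Z = 1%:M ->
  (forall M, M \in S <-> (f *m M *m Z)^T = f *m M *m Z) -> type3 S.
Proof.
move=> c2 uf zZ; have [m' [B' [C' [em' [CX' fB' CB' sum1']]]]] := compl_mx zZ.
rewrite addnC in em'; subst p => HS; split=> //; split=> //.
have [u3 u4 e4] := unit_of_compl zZ CX' fB' CB'.
exists f, (col_mx z C'); split=> //; split=> // M; rewrite e4 HS.
by rewrite sym3_row_block mul_mx_row row_mxKl.
Qed.

Lemma type3_elim n p (S : {vspace 'M[K]_(n, p)}) : type3 S ->
  [/\ 2%N \in [pchar K], n = 3%N & exists (f : 'M[K]_(3, n)) g (Z : 'M[K]_(p, 3)) z,
  [/\ g *m f = 1%:M, f *m g = 1%:M, z *m Z = 1%:M &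
   forall M, M \in S -> (f *m M *m Z)^T = f *m M *m Z]].
Proof.
case=> c2 [en [P [Q [uP [uQ HS]]]]]; subst n; split=> //.
have hp : (3 <= p)%N by have /HS [] := mem0v S.
have ep : p = (3 + (p - 3))%N by lia.
move: (p - 3)%N ep => m' ep; subst p.
exists P, (invmx P), (lsubmx (invmx Q)), (usubmx Q).
rewrite mulVmx // mulmxV //; split=> //.
  have := mulmxV uQ; rewrite -{1}[Q]vsubmxK -{1}[invmx Q]hsubmxK mul_col_row scalar_mx_block.
  by case/eq_block_mx.
move=> M /HS; rewrite sym3_row_block.
by rewrite -{1 2}[invmx Q]hsubmxK mul_mx_row row_mxKl.
Qed.
End Types.

Ltac cvring := apply/colP => ?; rewrite !mxE; ring.

(** * Annihilators supported on a plane of the source *)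

Section Planar.
Variable K : fieldType.
Implicit Types n m p : nat.

Definition lindep3 (V : lmodType K) (x y z : V) :=
  forall a b c : K, a *: x + b *: y + c *: z = 0 -> [/\ a = 0, b = 0 & c = 0].

Lemma lindep3_notin (V : vectType K) (x y z : V) :
  lindep2 x y -> z \notin (<[x]> + <[y]>)%VS -> lindep3 x y z.
Proof.
move=> xy hz a b c e; have c0 : c = 0.
  apply/eqP; apply: contraNT hz => c0; rewrite -[z](scalerK c0) memvZ //.
  have -> : c *: z = - (a *: x + b *: y) by apply/eqP; rewrite -addr_eq0 addrC e.
  by rewrite memvN memv_add // memvZ // memv_line.
by move: e; rewrite c0 scale0r addr0 => /xy [-> ->].
Qed.

(* On [S], the map [F] minus a local map only depends on [(s z1, s z2)]. *)
Lemma planar_model n p (S : {vspace 'M[K]_(n, p)}) F (z1 z2 : 'cV[K]_p) :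
  (1 < n)%N -> lindep2 z1 z2 -> (forall s, s *m z1 = 0 -> s *m z2 = 0 -> s \in S) -> rca S F ->
  exists x0 (mk : 'cV[K]_n -> 'cV[K]_n -> 'M[K]_(n, p)),
  [/\ forall c1 c2, mk c1 c2 *m z1 = c1 /\ mk c1 c2 *m z2 = c2,
   forall c1 c2 d1 d2, mk (c1 + d1) (c2 + d2) = mk c1 c2 + mk d1 d2,
   forall a c1 c2, mk (a *: c1) (a *: c2) = a *: mk c1 c2 &
   forall s, s \in S -> [/\ mk (s *m z1) (s *m z2) \in S,
     F s - s *m x0 = F (mk (s *m z1) (s *m z2)) - mk (s *m z1) (s *m z2) *m x0 &
     exists a b, F s - s *m x0 = a *: (s *m z1) + b *: (s *m z2)]].
Proof.
move=> n1 ind hS hF.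
have [m [f [g [B [D [em [[h1 h2 h3 h4] [[h5 h6 h7 h8] [h9 h10]]]]]]]]] := compl_vec2 ind.
have full : res D S = fullv.
  apply/vspaceP => s; rewrite mem_res memvf; apply: hS.
    by rewrite -mulmxA h5 mulmx0.
  by rewrite -mulmxA h6 mulmx0.
have [x0 hx0] : exists x, forall s, s \in S -> s = s *m B *m D -> F s = s *m x.
  apply: res_local h9 _; apply: rca_codim_small (res_rca _ hF).
  by rewrite full orth_full [dm _]dimv0.
have F0 s : s *m z1 = 0 -> s *m z2 = 0 -> F s = s *m x0.
  move=> e1 e2; apply: hx0; first exact: hS.
  by rewrite -[LHS]mulmx1 -h10 !mulmxDr !mulmxA e1 e2 !mul0mx !add0r.
pose mk (c1 c2 : 'cV[K]_n) := c1 *m f + c2 *m g.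
have mkz c1 c2 : mk c1 c2 *m z1 = c1 /\ mk c1 c2 *m z2 = c2.
  by rewrite /mk !mulmxDl -!mulmxA h1 h2 h3 h4 !mulmx1 !mulmx0 addr0 add0r.
exists x0, mk; split=> //.
- by move=> c1 c2 d1 d2; rewrite /mk !mulmxDl addrACA.
- by move=> a c1 c2; rewrite /mk scalerDr -!scalemxAl.
move=> s hs; set s' := mk _ _.
have [e1 e2] := mkz (s *m z1) (s *m z2); rewrite -/s' in e1 e2.
have d1 : (s - s') *m z1 = 0 by rewrite mulmxBl e1 subrr.
have d2 : (s - s') *m z2 = 0 by rewrite mulmxBl e2 subrr.
have hs' : s' \in S by rewrite -[s'](subKr s) memvB // hS.
have E : F s - s *m x0 = F s' - s' *m x0.
  apply/eqP; rewrite subr_eq -addrA [- _ + _]addrC -mulmxBl -(F0 _ d1 d2).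
  by rewrite (rcaB hF) // addrC subrK.
split=> //; rewrite E; have [_ /(_ s' hs') [x ex]] := rca_subl x0 hF.
exists ((f *m x) 0 0), ((g *m x) 0 0).
by rewrite ex /s' /mk mulmxDl -[_ *m f *m x]mulmxA -[_ *m g *m x]mulmxA !mul_cV1.
Qed.

(** The two columns share only the parameter [b]. Adding a [b] term to an [a] term or a [c] term and
    comparing coefficients on independent vectors shows that all terms carry the same two
    factors. *)
Lemma planar_indep n p (S : {vspace 'M[K]_(n, p)}) F (z1 z2 : 'cV[K]_p) (k1 l1 k2 l2 : 'cV[K]_n) :
  (1 < n)%N -> lindep2 z1 z2 -> lindep3 k1 l1 l2 -> lindep3 k2 l1 l2 ->
  (forall s, s \in S <-> exists a b c, s *m z1 = a *: k1 + b *: l1 /\ s *m z2 = c *: k2 + b *: l2) ->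
  rca S F -> islocal S F.
Proof.
move=> n1 ind i1 i2 HS hF.
have hS s : s *m z1 = 0 -> s *m z2 = 0 -> s \in S.
  by move=> e1 e2; apply/HS; exists 0, 0, 0; rewrite e1 e2 !scale0r addr0.
have [x0 [mk [mkz mkD mkZ hm]]] := planar_model n1 ind hS hF.
pose E a b c := mk (a *: k1 + b *: l1) (c *: k2 + b *: l2).
have Ez a b c : E a b c *m z1 = a *: k1 + b *: l1 /\ E a b c *m z2 = c *: k2 + b *: l2 by apply: mkz.
have ES a b c : E a b c \in S by apply/HS; exists a, b, c; apply: Ez.
have ED a b c a' b' c' : E (a + a') (b + b') (c + c') = E a b c + E a' b' c'.
  by rewrite /E -mkD !scalerDl; congr mk; rewrite addrACA.
pose G s := F s - s *m x0.
have GD a b c a' b' c' : G (E (a + a') (b + b') (c + c')) = G (E a b c) + G (E a' b' c').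
  by rewrite ED /G (rcaD (rca_subl x0 hF)).
have n10 : k1 != 0.
  by apply/eqP => e; case: (i1 1 0 0); rewrite ?e ?scaler0 ?scale0r ?addr0 // => /eqP; rewrite oner_eq0.
have n20 : k2 != 0.
  by apply/eqP => e; case: (i2 1 0 0); rewrite ?e ?scaler0 ?scale0r ?addr0 // => /eqP; rewrite oner_eq0.
have G0 a b c : exists x y, G (E a b c) = x *: (a *: k1 + b *: l1) + y *: (c *: k2 + b *: l2).
  have [_ _ [x [y e]]] := hm _ (ES a b c); exists x, y.
  by move: e; have [-> ->] := Ez a b c.
have [X [X_ eX]] := G0 1 0 0; have [Y_ [Y eY]] := G0 0 0 1.
rewrite !scale0r !scale1r !addr0 scaler0 addr0 in eX.
rewrite !scale0r !scale1r !addr0 scaler0 add0r in eY.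
have Gb b : b != 0 -> (forall a, G (E a 0 0) = (X * a) *: k1) /\
    (forall c, G (E 0 0 c) = (Y * c) *: k2) /\ G (E 0 b 0) = (X * b) *: l1 + (Y * b) *: l2.
  move=> b0; have [x [y exy]] := G0 0 b 0; rewrite !scale0r !add0r in exy.
  have P1 a : G (E a 0 0) = (x * a) *: k1.
    have [x1 [x1_ e1]] := G0 a 0 0; rewrite !scale0r !addr0 scaler0 addr0 in e1.
    have [x2 [y2 e2]] := G0 a b 0; rewrite !scale0r !add0r in e2.
    have := GD a 0 0 0 b 0; rewrite !addr0 add0r e1 e2 exy => e3.
    have [] := i1 ((x1 - x2) * a) ((x - x2) * b) ((y - y2) * b).
      have -> : ((x1 - x2) * a) *: k1 + ((x - x2) * b) *: l1 + ((y - y2) * b) *: l2 =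
        x1 *: (a *: k1) + (x *: (b *: l1) + y *: (b *: l2)) - (x2 *: (a *: k1 + b *: l1) + y2 *: (b *: l2)).
        by cvring.
      by rewrite e3 subrr.
    move=> /eqP; rewrite mulrBl subr_eq0 => /eqP r1 /eqP.
    rewrite mulf_eq0 (negPf b0) orbF subr_eq0 => /eqP r2 _.
    by rewrite scalerA r1 r2.
  have P2 c : G (E 0 0 c) = (y * c) *: k2.
    have [y1_ [y1 e1]] := G0 0 0 c; rewrite !scale0r !addr0 scaler0 add0r in e1.
    have [x2 [y2 e2]] := G0 0 b c; rewrite !scale0r !add0r in e2.
    have := GD 0 0 c 0 b 0; rewrite !addr0 add0r e1 e2 exy => e3.
    have [] := i2 ((y1 - y2) * c) ((x - x2) * b) ((y - y2) * b).
      have -> : ((y1 - y2) * c) *: k2 + ((x - x2) * b) *: l1 + ((y - y2) * b) *: l2 =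
        y1 *: (c *: k2) + (x *: (b *: l1) + y *: (b *: l2)) - (x2 *: (b *: l1) + y2 *: (c *: k2 + b *: l2)).
        by cvring.
      by rewrite e3 subrr.
    move=> /eqP; rewrite mulrBl subr_eq0 => /eqP r1 _ /eqP.
    rewrite mulf_eq0 (negPf b0) orbF subr_eq0 => /eqP r2.
    by rewrite scalerA r1 r2.
  have xX : x = X.
    by have := P1 1; rewrite mulr1 eX => /eqP; rewrite -subr_eq0 -scalerBl scaler_eq0 (negPf n10) orbF subr_eq0 => /eqP.
  have yY : y = Y.
    by have := P2 1; rewrite mulr1 eY => /eqP; rewrite -subr_eq0 -scalerBl scaler_eq0 (negPf n20) orbF subr_eq0 => /eqP.
  by rewrite -xX -yY; split=> //; split=> //; rewrite exy !scalerA.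
have one0 : (1 : K) != 0 by apply: oner_neq0.
have [Ga [Gc _]] := Gb 1 one0.
have Gb' b : G (E 0 b 0) = (X * b) *: l1 + (Y * b) *: l2.
  have [->|/Gb [_ [_ //]]] := eqVneq b 0.
  have := Ga 0; by rewrite !mulr0 !scale0r addr0.
exists (x0 + X *: z1 + Y *: z2) => s hs.
have [a [b [c [e1 e2]]]] := proj1 (HS s) hs.
have [_ eG _] := hm s hs; rewrite e1 e2 -/(E a b c) -/(G _) in eG.
have := GD a 0 0 0 b 0; rewrite !addr0 add0r => e3.
have := GD a b 0 0 0 c; rewrite !addr0 add0r e3 Ga Gb' Gc => e4.
apply/eqP; rewrite !mulmxDr -subr_eq0 !opprD !addrA eG e4 -!scalemxAr e1 e2; apply/eqP.
by cvring.
Qed.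

(** In the bases [z1], [z2] and [k1], [k2], the matrix [E a b c] is symmetric. Range-compatibility
    constrains only its singular values, which gives a functional equation with zero as its only
    homogeneous solution, and its only additive one outside characteristic 2. *)
Lemma planar_sym n p (S : {vspace 'M[K]_(n, p)}) F (z1 z2 : 'cV[K]_p) (k1 k2 : 'cV[K]_n) (x : K) :
  (1 < n)%N -> x != 0 -> x != 1 -> lindep2 z1 z2 -> lindep2 k1 k2 ->
  (forall s, s \in S <-> exists a b c, s *m z1 = a *: k1 + b *: k2 /\ s *m z2 = b *: k1 + c *: k2) ->
  rca S F -> islocal S F \/ (2%N \in [pchar K] /\ ~ homog S F).
Proof.
move=> n1 x0 x1 ind ik HS hF.
have hS s : s *m z1 = 0 -> s *m z2 = 0 -> s \in S.
  by move=> e1 e2; apply/HS; exists 0, 0, 0; rewrite e1 e2 !scale0r addr0.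
have [w0 [mk [mkz mkD mkZ hm]]] := planar_model n1 ind hS hF.
have [_ [f1 [f2 [_ [_ [_ [[h1 h2 h3 h4] _]]]]]]] := compl_vec2 ik.
pose E a b c := mk (a *: k1 + b *: k2) (b *: k1 + c *: k2).
have Ez a b c : E a b c *m z1 = a *: k1 + b *: k2 /\ E a b c *m z2 = b *: k1 + c *: k2 by apply: mkz.
have ES a b c : E a b c \in S by apply/HS; exists a, b, c; apply: Ez.
have ED a b c a' b' c' : E (a + a') (b + b') (c + c') = E a b c + E a' b' c'.
  by rewrite /E -mkD !scalerDl; congr mk; rewrite addrACA.
have EZ r a b c : E (r * a) (r * b) (r * c) = r *: E a b c.
  by rewrite /E -mkZ !scalerDr !scalerA.
have G0 a b c : exists u v, F (E a b c) - E a b c *m w0 = u *: (a *: k1 + b *: k2) + v *: (b *: k1 + c *: k2).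
  have [_ _ [u [v e]]] := hm _ (ES a b c); exists u, v.
  by move: e; have [-> ->] := Ez a b c.
have [X [X_ eX]] := G0 1 0 0; have [Y_ [Y eY]] := G0 0 0 1.
rewrite !scale0r !scale1r !addr0 scaler0 addr0 in eX.
rewrite !scale0r !scale1r !add0r scaler0 add0r in eY.
(* Removes the local part so that [H] vanishes at the two diagonal units. *)
pose y0 := w0 + X *: z1 + Y *: z2; pose H s := F s - s *m y0.
have hH : rca S H := rca_subl y0 hF.
have HE a b c : exists u v, H (E a b c) = u *: (a *: k1 + b *: k2) + v *: (b *: k1 + c *: k2).
  have [u [v e]] := G0 a b c; exists (u - X), (v - Y).
  have [e1 e2] := Ez a b c.
  rewrite /H /y0 !mulmxDr -!scalemxAr !opprD !addrA e e1 e2; by cvring.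
have HD a b c a' b' c' : H (E (a + a') (b + b') (c + c')) = H (E a b c) + H (E a' b' c').
  by rewrite ED (rcaD hH).
have H1 : H (E 1 0 0) = 0.
  have [e1 e2] := Ez 1 0 0.
  by rewrite /H /y0 !mulmxDr -!scalemxAr !opprD !addrA eX e1 e2; cvring.
have H2 : H (E 0 0 1) = 0.
  have [e1 e2] := Ez 0 0 1.
  by rewrite /H /y0 !mulmxDr -!scalemxAr !opprD !addrA eY e1 e2; cvring.
pose p1 (v : 'cV[K]_n) := (f1 *m v) 0 0; pose p2 (v : 'cV[K]_n) := (f2 *m v) 0 0.
have p1D u v : p1 (u + v) = p1 u + p1 v by rewrite /p1 mulmxDr mxE.
have p2D u v : p2 (u + v) = p2 u + p2 v by rewrite /p2 mulmxDr mxE.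
have p1E a b : p1 (a *: k1 + b *: k2) = a.
  by rewrite /p1 mulmxDr -!scalemxAr h1 h2 scaler0 addr0 !mxE eqxx mulr1.
have p2E a b : p2 (a *: k1 + b *: k2) = b.
  by rewrite /p2 mulmxDr -!scalemxAr h3 h4 scaler0 add0r !mxE eqxx mulr1.
pose A a := p1 (H (E a 0 0)); pose C c := p2 (H (E 0 0 c)).
pose G1 b := p1 (H (E 0 b 0)); pose G2 b := p2 (H (E 0 b 0)).
have HA a : H (E a 0 0) = A a *: k1.
  have [u [v]] := HE a 0 0; rewrite /A !scale0r !addr0 scaler0 addr0 => ->.
  by have := p1E (u * a) 0; rewrite scale0r addr0 -scalerA => ->; rewrite scalerA.
have HC c : H (E 0 0 c) = C c *: k2.
  have [u [v]] := HE 0 0 c; rewrite /C !scale0r !add0r scaler0 add0r => ->.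
  by have := p2E 0 (v * c); rewrite scale0r add0r -scalerA => ->; rewrite scalerA.
have HG b : H (E 0 b 0) = G1 b *: k1 + G2 b *: k2.
  have [u [v]] := HE 0 b 0; rewrite /G1 /G2 !scale0r addr0 add0r => ->.
  have -> : u *: (b *: k2) + v *: (b *: k1) = (v * b) *: k1 + (u * b) *: k2 by rewrite addrC !scalerA.
  by rewrite p1E p2E.
have HEE a b c : H (E a b c) = (A a + G1 b) *: k1 + (C c + G2 b) *: k2.
  have := HD a 0 0 0 b 0; rewrite !addr0 add0r => e3.
  have := HD a b 0 0 0 c; rewrite !addr0 add0r => ->; rewrite e3 HA HG HC; by cvring.
(* [E t (t u) (t u^2)] has rank at most one and range in the line of [k1 + u k2], so the second
   coordinate of its image is [u] times the first. *)
have key t u : C (t * u ^+ 2) + G2 (t * u) = u * (A t + G1 (t * u)).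
  have [r [v]] := HE t (t * u) (t * u ^+ 2); rewrite HEE.
  have -> : r *: (t *: k1 + (t * u) *: k2) + v *: ((t * u) *: k1 + (t * u ^+ 2) *: k2) =
    (r * t + v * t * u) *: k1 + (u * (r * t + v * t * u)) *: k2 by cvring.
  move=> e; have := congr1 p1 e; rewrite !p1E => ->.
  by have := congr1 p2 e; rewrite !p2E => ->.
have A1 : A 1 = 0 by rewrite /A H1 /p1 mulmx0 mxE.
have C1 : C 1 = 0 by rewrite /C H2 /p2 mulmx0 mxE.
have AD a b : A (a + b) = A a + A b by rewrite /A -p1D -HD !addr0.
have CD a b : C (a + b) = C a + C b by rewrite /C -p2D -HD !addr0.
have G1D a b : G1 (a + b) = G1 a + G1 b by rewrite /G1 -p1D -HD !addr0.
have G2D a b : G2 (a + b) = G2 a + G2 b by rewrite /G2 -p2D -HD !addr0.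
have fin : (forall a, [/\ A a = 0, C a = 0, G1 a = 0 & G2 a = 0]) -> islocal S F.
  move=> h; exists y0 => s hs; apply/eqP; rewrite -subr_eq0 -/(H s); apply/eqP.
  have [a [b [c [e1 e2]]]] := proj1 (HS s) hs.
  have [es e _] := hm s hs; rewrite e1 e2 -/(E a b c) in e.
  have [e1' e2'] := Ez a b c.
  have : H s = H (E a b c).
    by rewrite /H /y0 !mulmxDr !opprD !addrA e -!scalemxAr e1 e2 e1' e2'.
  move=> ->; rewrite HEE; have [-> _ _ _] := h a; have [_ _ -> ->] := h b; have [_ -> _ _] := h c.
  by rewrite !addr0 !scale0r addr0.
have [hom|nhom] := classic (homog S F); [left|].
  have hom' : homog S H by apply/homog_subl.
  have Ah a : A a = 0 by rewrite -[a]mulr1 /A -[X in E _ X]( mulr0 a) -[X in E _ _ X](mulr0 a) EZ hom' // H1 scaler0 /p1 mulmx0 mxE.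
  have Ch a : C a = 0 by rewrite -[a]mulr1 /C -[X in E X]( mulr0 a) -[X in E _ X](mulr0 a) EZ hom' // H2 scaler0 /p2 mulmx0 mxE.
  have HGh a : H (E 0 a 0) = a *: H (E 0 1 0) by rewrite -hom' // -EZ mulr0 mulr1.
  have G1h a : G1 a = a * G1 1 by rewrite /G1 HGh /p1 -scalemxAr mxE.
  have G2h a : G2 a = a * G2 1 by rewrite /G2 HGh /p2 -scalemxAr mxE.
  have k11 : G2 1 = G1 1 by have := key 1 1; rewrite !(Ah, Ch) !mulr1 !mul1r !add0r.
  have g0 : G1 1 = 0.
    have := key 1 x; rewrite !(Ah, Ch) !mul1r !add0r G2h G1h k11 => /eqP.
    rewrite -subr_eq0 -mulrBr mulf_eq0 (negPf x0) /= -{1}[G1 1]mul1r -mulrBl mulf_eq0.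
    by rewrite subr_eq0 eq_sym (negPf x1) => /eqP.
  by apply: fin => a; rewrite Ah Ch G1h G2h k11 g0 mulr0.
have [c2|c2] := boolP (2%N \in [pchar K]); [by right|left].
have two : (2%:R : K) != 0 by move: c2; rewrite inE.
have G2N a : G2 (- a) = - G2 a by apply/eqP; rewrite -addr_eq0 -G2D addNr; have := G2D 0 0; rewrite addr0 => /eqP; rewrite -subr_eq subrr eq_sym.
have G1N a : G1 (- a) = - G1 a by apply/eqP; rewrite -addr_eq0 -G1D addNr; have := G1D 0 0; rewrite addr0 => /eqP; rewrite -subr_eq subrr eq_sym.
(* The equations at [u] and [- u] separate even and odd parts; dividing by 2 is where characteristic
   2 is excluded. *)
have k1' t u : C (t * u ^+ 2) = u * G1 (t * u).
  have e := key t u; have := key t (- u); rewrite sqrrN mulrN G2N G1N => e'.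
  apply: (mulfI two); apply/eqP; rewrite -subr_eq0; apply/eqP.
  have -> : 2%:R * C (t * u ^+ 2) - 2%:R * (u * G1 (t * u)) =
    (C (t * u ^+ 2) + G2 (t * u)) + (C (t * u ^+ 2) - G2 (t * u)) - 2%:R * (u * G1 (t * u)) by ring.
  by rewrite e e'; ring.
have k2' t u : G2 (t * u) = u * A t.
  have e := key t u; rewrite k1' in e; have : G2 (t * u) = u * (A t + G1 (t * u)) - u * G1 (t * u).
    by rewrite -e; ring.
  by move=> ->; ring.
have G20 a : G2 a = 0 by have := k2' 1 a; rewrite mul1r A1 mulr0.
have A0 a : A a = 0 by have := k2' a 1; rewrite mulr1 G20 mul1r.
have C0' : C 0 = 0 by have := CD 0 0; rewrite addr0 => /eqP; rewrite -subr_eq subrr eq_sym => /eqP.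
have kk a u : C (a * u) = u * G1 a.
  have [->|u0] := eqVneq u 0; first by rewrite mulr0 mul0r.
  by have := k1' (a / u) u; rewrite divfK // expr2 mulrA divfK.
have G11 : G1 1 = 0 by have := kk 1 1; rewrite mulr1 C1 mul1r.
have C0 a : C a = 0 by have := kk 1 a; rewrite mul1r G11 mulr0.
apply: fin => a; split=> //.
by have := kk a 1; rewrite C0 mul1r.
Qed.
End Planar.

(** * Normal forms when the annihilator is supported on two columns *)

Section PlanarForm.
Variable K : fieldType.
Implicit Types n m p : nat.

Lemma planar_sat n p (S : {vspace 'M[K]_(n, p)}) (z1 z2 : 'cV[K]_p) :
  (forall t, t \in orth S -> exists g1 g2, t = z1 *m g1 + z2 *m g2) ->
  forall s s', s \in S -> s' *m z1 = s *m z1 -> s' *m z2 = s *m z2 -> s' \in S.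
Proof.
move=> hT s s' hs e1 e2; rewrite -(orthK S); apply/orthP => t ht; rewrite mxtrace_mulC.
have := ht; have [g1 [g2 ->]] := hT t ht => /orthP /(_ s hs).
by rewrite !mulmxDl !mxtraceD !tr_rank1 -!mulmxA e1 e2.
Qed.

(** Evaluate [S] at [z1], then the kernel at [z2]; what remains is the space of all matrices
    vanishing at both. *)
Lemma planar_ker_dim n p (S : {vspace 'M[K]_(n, p)}) (z1 z2 : 'cV[K]_p) :
  lindep2 z1 z2 -> (forall s, s *m z1 = 0 -> s *m z2 = 0 -> s \in S) ->
  (dm (orth S) + dm (Sx S z1) + dm (Sx (S :&: lker (linfun (mulmxr z1))) z2))%N = (2 * n)%N.
Proof.
move=> ind hS.
have [m [f [g [B [D [em [[h1 h2 h3 h4] [[h5 h6 h7 h8] [h9 h10]]]]]]]]] := compl_vec2 ind.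
pose R1 : {vspace 'M[K]_(n, p)} := (S :&: lker (linfun (mulmxr z1)))%VS; rewrite -/R1.
have R1P s : s \in R1 = (s \in S) && (s *m z1 == 0) by rewrite memv_cap memv_ker lfunE.
have e1 : (dm R1 + dm (Sx S z1))%N = dm S := dm_img (linfun (mulmxr z1)) S.
have e2 : (dm (R1 :&: lker (linfun (mulmxr z2)))%VS + dm (Sx R1 z2))%N = dm R1 :=
  dm_img (linfun (mulmxr z2)) R1.
have e3 : dm (R1 :&: lker (linfun (mulmxr z2)))%VS = (n * m)%N.
  rewrite -(dmf K n m) -(@dim_img_inj _ _ _ _ _ (linfun (mulmxr D))); last first.
    by move=> s _; rewrite lfunE /= => sD; rewrite -[s]mulmx1 -h9 mulmxA sD mul0mx.
  congr (dm _); apply/vspaceP => s; rewrite memv_cap R1P memv_ker lfunE /=.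
  apply/andP/memv_imgP.
    case=> /andP [sS /eqP sz1] /eqP sz2; exists (s *m B); first exact: memvf.
    by rewrite lfunE /= -[LHS]mulmx1 -h10 !mulmxDr !mulmxA sz1 sz2 !mul0mx !add0r.
  case=> s' _ ->; rewrite lfunE /= -!mulmxA h5 h6 mulmx0 eqxx !andbT; split=> //.
  by apply: hS; rewrite -mulmxA ?h5 ?h6 mulmx0.
have e4 := dim_orth S.
have e5 : (n * p)%N = (n * m + 2 * n)%N by rewrite -em mulnDr [(2 * n)%N]mulnC.
by lia.
Qed.

Lemma planar_ker n p (S : {vspace 'M[K]_(n, p)}) (z1 z2 : 'cV[K]_p) :
  lindep2 z1 z2 -> (forall s, s *m z1 = 0 -> s *m z2 = 0 -> s \in S) ->
  (dm (orth S) + 3)%N = (2 * n)%N -> dm (Sx S z1) = 2%N ->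
  exists k2, [/\ k2 != 0, forall s, s \in S -> s *m z1 = 0 -> exists c, s *m z2 = c *: k2 &
     exists2 r, r \in S & r *m z1 = 0 /\ r *m z2 = k2].
Proof.
move=> ind hS dT d1; have := planar_ker_dim ind hS.
set R1 := (S :&: _)%VS => e.
have R1P s : s \in R1 = (s \in S) && (s *m z1 == 0) by rewrite memv_cap memv_ker lfunE.
have d : dm (Sx R1 z2) = 1%N by lia.
have [k2 ek] := dim_le1 (eq_leq d).
have k20 : k2 != 0 by apply/eqP => k0; move: d; rewrite ek k0 [dm _]dimv0.
exists k2; split=> // [s hs sz1|].
  by apply/vlineP; rewrite -ek mem_Sx // R1P hs sz1 eqxx.
have : k2 \in Sx R1 z2 by rewrite ek memv_line.
by case/SxP => r; rewrite R1P => /andP [hr /eqP rz] er; exists r.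
Qed.

(** Of the three parameters, [a] and [c] each move one column while the other vanishes, and [b],
    carried by [sb], moves both. *)
Lemma planar_form n p (S : {vspace 'M[K]_(n, p)}) (z1 z2 : 'cV[K]_p) :
  lindep2 z1 z2 -> (forall t, t \in orth S -> exists g1 g2, t = z1 *m g1 + z2 *m g2) ->
  (dm (orth S) + 3)%N = (2 * n)%N -> dm (Sx S z1) = 2%N -> dm (Sx S z2) = 2%N ->
  exists k1 l1 k2 l2, [/\ lindep2 k1 l1, lindep2 k2 l2 &
    forall s, s \in S <-> exists a b c, s *m z1 = a *: k1 + b *: l1 /\ s *m z2 = c *: k2 + b *: l2].
Proof.
move=> ind hT dT d1 d2.
have sat := planar_sat hT.
have hS s : s *m z1 = 0 -> s *m z2 = 0 -> s \in S.
  by move=> e1 e2; apply: (sat 0); rewrite ?mem0v // mul0mx.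
have hS' s : s *m z2 = 0 -> s *m z1 = 0 -> s \in S by move=> e2 e1; apply: hS.
have [k2 [k20 hk2 [r2 hr2 [r2z1 r2z2]]]] := planar_ker ind hS dT d1.
have [k1 [k10 hk1 [r1 hr1 [r1z2 r1z1]]]] := planar_ker (lindep2_sym ind) hS' dT d2.
have [_ /SxP [sb hsb ->] nb] : exists2 l, l \in Sx S z1 & l \notin <[k1]>%VS.
  by apply/subvPn/negP => /dmS; rewrite d1 => h; have := dm_vline k1; rewrite leqNgt h.
have i1 : lindep2 k1 (sb *m z1) by apply: lindep2_notin.
have form s : s \in S -> exists a b c, s *m z1 = a *: k1 + b *: (sb *m z1) /\ s *m z2 = c *: k2 + b *: (sb *m z2).
  move=> hs; have : s *m z1 \in (<[k1]> + <[sb *m z1]>)%VS.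
    have le : ((<[k1]> + <[sb *m z1]>) <= Sx S z1)%VS.
      by rewrite subv_add -!memvE mem_Sx // andbT -r1z1 mem_Sx.
    have -> : (<[k1]> + <[sb *m z1]>)%VS = Sx S z1; last exact: mem_Sx.
    apply/eqP; rewrite eqEdim le -[\dim (Sx _ _)]/(dm _) d1; apply/dim_gt1P.
    exists k1, (sb *m z1); split=> //; first by rewrite memvE addvSl.
    by rewrite memvE addvSr.
  case/memv_addP => _ /vlineP [a ->] [_ /vlineP [b ->] e].
  pose s' := s - b *: sb - a *: r1.
  have hs' : s' \in S by rewrite !memvB ?memvZ.
  have e' : s' *m z1 = 0.
    by rewrite !mulmxBl -!scalemxAl e r1z1 addrK subrr.
  have [c ec] := hk2 s' hs' e'; exists a, b, c; split=> //.
  by rewrite -ec !mulmxBl -!scalemxAl r1z2 scaler0 subr0 subrK.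
exists k1, (sb *m z1), k2, (sb *m z2); split=> //.
  apply: lindep2_notin => //; apply/negP => /vlineP [x ex].
  have : (dm (Sx S z2) <= dm <[k2]>%VS)%N.
    apply: dmS; apply/subvP => _ /SxP [s hs ->]; have [a [b [c [_ ->]]]] := form s hs.
    by rewrite ex scalerA -scalerDl memvZ // memv_line.
  by rewrite d2 => h; have := dm_vline k2; rewrite leqNgt h.
move=> s; split=> [|[a [b [c [e1 e2]]]]]; first exact: form.
apply: (sat (a *: r1 + b *: sb + c *: r2)); first by rewrite !memvD ?memvZ.
  by rewrite e1 !mulmxDl -!scalemxAl r1z1 r2z1 scaler0 addr0.
by rewrite e2 !mulmxDl -!scalemxAl r1z2 r2z2 scaler0 add0r addrC.
Qed.

Definition col2 n (u v : 'cV[K]_n) : 'M[K]_(n, 2) :=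
  \matrix_(i, j) if j == 0 then u i 0 else v i 0.

Lemma ord2P (j : 'I_2) : j = 0 \/ j = 1.
Proof. by case: j => [[|[|//]] h]; [left|right]; apply: val_inj. Qed.

Lemma mul_col2 m n (M : 'M[K]_(m, n)) u v : M *m col2 u v = col2 (M *m u) (M *m v).
Proof.
apply/matrixP => i j; rewrite /col2 !mxE; case: (ord2P j) => -> /=;
   by apply: eq_bigr => k _; rewrite mxE.
Qed.

Lemma col2_mul n (u v : 'cV[K]_n) (A : 'M[K]_2) :
  col2 u v *m A = col2 (A 0 0 *: u + A 1 0 *: v) (A 0 1 *: u + A 1 1 *: v).
Proof.
apply/matrixP => i j; rewrite !mxE !big_ord_recl big_ord0 addr0 !mxE /=.
have -> : lift ord0 ord0 = 1 :> 'I_2 by apply: val_inj.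
by case: (ord2P j) => -> /=; ring.
Qed.

Lemma col2_inj n (u v u' v' : 'cV[K]_n) : col2 u v = col2 u' v' -> u = u' /\ v = v'.
Proof.
move=> /matrixP e; split; apply/colP => i.
  by have := e i 0; rewrite !mxE.
by have := e i 1; rewrite !mxE.
Qed.

Lemma leftinv_col2 n (u v : 'cV[K]_n) : lindep2 u v -> exists f, f *m col2 u v = 1%:M.
Proof.
move=> uv; apply: leftinv_free => x e; have [|h0 h1] := uv (x 0 0) (x 1 0).
  rewrite -e; apply/colP => i; rewrite !mxE !big_ord_recl big_ord0 addr0 !mxE /=.
  have -> : lift ord0 ord0 = 1 :> 'I_2 by apply: val_inj.
  by ring.
by apply/colP => i; rewrite mxE; case: (ord2P i) => ->.
Qed.

(** The parameters [a] and [c] of [planar_form] absorb shifts of [l1] along [k1] and of [l2] along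
    [k2], so independence is wanted only up to such shifts. *)
Lemma off_plane_shift n (k1 l1 k2 l2 : 'cV[K]_n) :
  lindep2 k1 l1 -> ~~ (<[k2]> + <[l2]> <= <[k1]> + <[l1]>)%VS ->
  exists x, l2 + x *: k2 \notin (<[k1]> + <[l1]>)%VS.
Proof.
move=> i1 h; have [lin|lout] := boolP (l2 \in (<[k1]> + <[l1]>)%VS); last first.
  by exists 0; rewrite scale0r addr0.
exists 1; rewrite scale1r rpredDl //; apply: contra h => kin.
by rewrite subv_add -!memvE kin.
Qed.

(** Compare the planes [S z1] and [S z2]. Distinct planes lead to [planar_indep] after shifts; equal
    ones lead to [planar_sym] after scaling [z2], which is the Type 2 configuration. *)
Lemma rca_planar n p (S : {vspace 'M[K]_(n, p)}) F (z1 z2 : 'cV[K]_p) (x : K) :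
  (1 < n)%N -> x != 0 -> x != 1 ->
  lindep2 z1 z2 -> (forall t, t \in orth S -> exists g1 g2, t = z1 *m g1 + z2 *m g2) ->
  (dm (orth S) + 3)%N = (2 * n)%N -> (dm (Sx S z1) <= 2)%N -> (dm (Sx S z2) <= 2)%N ->
  (forall z, z != 0 -> (1 < dm (Sx S z))%N) -> rca S F ->
  islocal S F \/ (type2 S /\ ~ homog S F).
Proof.
move=> n1 x0 x1 ind hT dT d1 d2 hz hF.
have {}d1 : dm (Sx S z1) = 2%N.
  by apply/eqP; rewrite eqn_leq d1 hz // (lindep2_neq0 ind).
have {}d2 : dm (Sx S z2) = 2%N.
  by apply/eqP; rewrite eqn_leq d2 hz // (lindep2_neq0 (lindep2_sym ind)).
have [k1 [l1 [k2 [l2 [i1 i2 HS]]]]] := planar_form ind hT dT d1 d2.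
have dP u v : lindep2 u v -> dm (<[u]> + <[v]> : {vspace 'cV[K]_n})%VS = 2%N.
  move=> i; apply/eqP; rewrite eqn_leq dm_plane; apply/dim_gt1P; exists u, v.
  by split=> //; [rewrite memvE addvSl | rewrite memvE addvSr].
have [le|nle] := boolP (<[k2]> + <[l2]> <= <[k1]> + <[l1]>)%VS; last first.
  left; have nle' : ~~ (<[k1]> + <[l1]> <= <[k2]> + <[l2]>)%VS.
    apply: contra nle => le; suff -> : (<[k1]> + <[l1]>)%VS = (<[k2]> + <[l2]>)%VS by [].
    by apply/eqP; rewrite eqEdim le; have := dP _ _ i1; have := dP _ _ i2; rewrite /dm => -> ->.
  have [s hs] := off_plane_shift i1 nle; have [t ht] := off_plane_shift i2 nle'.
  have I1 : lindep3 k1 (l1 + t *: k1) (l2 + s *: k2).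
    apply: lindep3_notin.
      move=> a b e; have [] := i1 (a + b * t) b; last first.
        by move=> h b0; move: h; rewrite b0 mul0r addr0.
      by rewrite -e; cvring.
    apply: contra hs => /memv_addP [_ /vlineP [a ->] [_ /vlineP [b ->] ->]].
    have -> : a *: k1 + b *: (l1 + t *: k1) = (a + b * t) *: k1 + b *: l1 by cvring.
    by rewrite memv_add // memvZ // memv_line.
  have I2 : lindep3 k2 (l1 + t *: k1) (l2 + s *: k2).
    have I : lindep3 k2 (l2 + s *: k2) (l1 + t *: k1).
      apply: lindep3_notin.
        move=> a b e; have [] := i2 (a + b * s) b; last first.
          by move=> h b0; move: h; rewrite b0 mul0r addr0.
        by rewrite -e; cvring.
      apply: contra ht => /memv_addP [_ /vlineP [a ->] [_ /vlineP [b ->] ->]].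
      have -> : a *: k2 + b *: (l2 + s *: k2) = (a + b * s) *: k2 + b *: l2 by cvring.
      by rewrite memv_add // memvZ // memv_line.
    by move=> a b c e; have [] := I a c b; rewrite ?(addrAC _ (c *: _)).
  apply: (planar_indep n1 ind I1 I2) hF => s'; rewrite HS.
  split=> -[a [b [c [e1 e2]]]].
    by exists (a - b * t), b, (c - b * s); rewrite e1 e2; split; cvring.
  by exists (a + b * t), b, (c + b * s); rewrite e1 e2; split; cvring.
have inP v : v \in (<[k2]> + <[l2]>)%VS -> exists a b, v = a *: k1 + b *: l1.
  by move/subvP: le => h /h /memv_addP [_ /vlineP [a ->] [_ /vlineP [b ->] ->]]; exists a, b.
have [a2 [b2 ek2]] := inP k2 (subvP (addvSl _ _) _ (memv_line _)).
have [a3 [b3 el2]] := inP l2 (subvP (addvSr _ _) _ (memv_line _)).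
have [b20|b20] := eqVneq b2 0.
  (* [k2] is parallel to [k1]: a combination of [z1], [z2] has a line as image *)
  have zn0 : z2 - b3 *: z1 != 0.
    apply/eqP => e; case: (ind (- b3) 1); first by rewrite scale1r scaleNr addrC.
    by move=> _ /eqP; rewrite oner_eq0.
  have := hz _ zn0; rewrite ltnNge => /negP; case.
  apply: leq_trans (dm_vline k1); apply: dm_Sx_plane => s' /HS [a [b [c [e1 e2]]]].
  apply/vlineP; exists (c * a2 + b * a3 - b3 * a).
  by rewrite mulmxBr -scalemxAr e1 e2 ek2 el2 b20; cvring.
have kk : lindep2 k1 k2.
  move=> a b; rewrite ek2 => e; have [] := i1 (a + b * a2) (b * b2); first by rewrite -e; cvring.
  move=> h /eqP; rewrite mulf_eq0 (negPf b20) orbF => /eqP b0.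
  by move: h; rewrite b0 mul0r addr0.
(* express everything on the basis [k1], [k2] of the common plane *)
have [p1 el1] : exists p1 : K, l1 = p1 *: k1 + b2^-1 *: k2.
  exists (- (b2^-1 * a2)); rewrite ek2 scalerDr !scalerA mulVf // scale1r.
  by rewrite addrA -scalerDl addNr scale0r add0r.
have [q1 [q2 el2']] : exists q1 q2 : K, l2 = q1 *: k1 + q2 *: k2.
  exists (a3 + b3 * p1), (b3 * b2^-1); rewrite el2 {1}el1; cvring.
have q10 : q1 != 0.
  apply/eqP => q0; case: (i2 (- q2) 1); first by rewrite el2' q0; cvring.
  by move=> _ /eqP; rewrite oner_eq0.
(* Scaling [z2] by [w] makes the coefficient of [k1] in [s z2] equal to that of [k2] in [s z1]. *)
pose w := b2^-1 / q1; have b2i : b2^-1 != 0 by rewrite invr_eq0.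
have w0 : w != 0 by rewrite mulf_neq0 // invr_eq0.
have wq : w * q1 = b2^-1 by rewrite divfK.
have indw : lindep2 z1 (w *: z2).
  move=> a b; rewrite scalerA => /ind [-> /eqP]; rewrite mulf_eq0 (negPf w0) orbF => /eqP ->; by [].
have HS' s : s \in S <-> exists a b c, s *m z1 = a *: k1 + b *: k2 /\ s *m (w *: z2) = b *: k1 + c *: k2.
  rewrite HS; split=> -[a [b [c [e1 e2]]]].
    exists (a + b * p1), (b * b2^-1), (w * (c + b * q2)); split.
      by rewrite e1 {1}el1; cvring.
    by rewrite -scalemxAr e2 {1}el2' -wq; cvring.
  exists (a - b * b2 * p1), (b * b2), (w^-1 * c - b * b2 * q2); split.
    rewrite e1 {1}el1 scalerDr !scalerA mulfK // addrA -scalerDl; congr (_ + _).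
    by rewrite subrK.
  apply: (scalerI w0); rewrite scalemxAr e2 {1}el2'.
  move: w0 wq {indw e1 e2}; move: w => w w0 wq.
  have -> : w *: ((w^-1 * c - b * b2 * q2) *: k2 + (b * b2) *: (q1 *: k1 + q2 *: k2)) =
      (w * q1 * b2 * b) *: k1 + (w * w^-1 * c) *: k2 by cvring.
  by rewrite wq mulVf // mulfV // !mul1r.
have [|[c2 nh]] := planar_sym n1 x0 x1 indw kk HS' hF; [by left|right; split=> //].
have [f fX] := leftinv_col2 kk; have [z zZ] := leftinv_col2 indw.
apply: (type2_intro c2 fX zZ) => M; rewrite HS' mul_col2; split.
  move=> [a [b [c [e1 e2]]]]; exists (\matrix_(i, j) if i == 0 then if j == 0 then a else b
    else if j == 0 then b else c); split.
    by apply/matrixP => i j; rewrite !mxE; case: (i == 0); case: (j == 0).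
  by rewrite col2_mul e1 e2 !mxE.
move=> [A [sA]]; rewrite col2_mul => /col2_inj [e1 e2]; exists (A 0 0), (A 1 0), (A 1 1).
by rewrite e1 e2; split=> //; congr (_ *: _ + _); rewrite -[A in LHS]sA mxE.
Qed.
End PlanarForm.

(** * Two independent source vectors with planar images *)

Section TwoPlanes.
Variable K : fieldType.
Implicit Types n m p : nat.

Lemma hyperplane_split n p (U W : {vspace 'M[K]_(n, p)}) t0 :
  (U <= W)%VS -> (dm W <= dm U + 1)%N -> t0 \in W -> t0 \notin U ->
  forall t, t \in W -> exists2 u, u \in U & exists c, t = u + c *: t0.
Proof.
move=> UW dW t0W t0U t.
have -> : W = (U + <[t0]>)%VS; last first.
  by case/memv_addP => u uU [_ /vlineP [c ->] ->]; exists u => //; exists c.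
apply/esym/eqP; rewrite eqEdim subv_add UW -memvE t0W /=.
apply: leq_trans dW _; rewrite addn1.
have /leqifP := dimv_leqif_sup (addvSl U <[t0]>%VS); case: ifP => // /subvP h _.
by case/negP: t0U; apply: h; rewrite (subvP (addvSr _ _)) // memv_line.
Qed.

Lemma dm_kernel_row n (w : 'cV[K]_n) :
  (n <= dm (lker (linfun (mulmxr w)) : {vspace 'rV[K]_n}) + 1)%N.
Proof.
have := dm_img (linfun (mulmxr w) : 'Hom('rV[K]_n, 'M[K]_1)) fullv.
rewrite capfv dmf mul1n => e; rewrite -{1}e leq_add2l.
by apply: leq_trans (dmS (subvf _)) _; rewrite dmf.
Qed.

Lemma Lam_img n p (T : {vspace 'M[K]_(p, n)}) (z : 'cV[K]_p) : z != 0 ->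
  (linfun (mulmx z) @: Lam T z <= T)%VS /\
  dm (linfun (mulmx z) @: Lam T z : {vspace 'M[K]_(p, n)})%VS = dm (Lam T z).
Proof.
move=> z0; split.
  by apply/subvP => _ /memv_imgP [f hf ->]; rewrite lfunE /= -mem_Lam.
apply: dim_img_inj => f _; rewrite lfunE /=.
have [m [g [B [C [_ [gu _ _ _ _]]]]]] := compl_vec z0.
by move=> uf; rewrite -[f]mul1mx -gu -mulmxA uf mulmx0.
Qed.

(** If [orth S] is not supported on [z1] and [z2], the restriction to matrices vanishing at [z1] has
    an annihilator of dimension [n - 1], spanned by the [zb l] with [l] in [L2], of dimension
    [n - 2], and by [D t0]. This is one too many for [rca_elim], but a rank one element of it has
    its row in [L2] or on a single line, so [rca_core] fails for a generic [g]. *)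
Lemma rca_two_planes n p (S : {vspace 'M[K]_(n, p)}) F (z1 z2 : 'cV[K]_p) (x : K) :
  (2 < n)%N -> x != 0 -> x != 1 -> lindep2 z1 z2 ->
  (dm (orth S) + 3)%N = (2 * n)%N -> (dm (Sx S z1) <= 2)%N -> (dm (Sx S z2) <= 2)%N ->
  (forall z, z != 0 -> (1 < dm (Sx S z))%N) -> rca S F ->
  islocal S F \/ (type2 S /\ ~ homog S F).
Proof.
move=> n2 x0 x1 ind dT d1 d2 hz hF.
have z10 := lindep2_neq0 ind; have z20 := lindep2_neq0 (lindep2_sym ind).
have [hT|nT] := classic (forall t, t \in orth S -> exists g1 g2, t = z1 *m g1 + z2 *m g2).
  by apply: (rca_planar _ x0 x1 ind hT) => //; apply: ltnW.
have [t0 ht0 nt0] := not_all_in nT; left.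
have [m [f [B [D [em [fz Dz fB DB sum1]]]]]] := compl_vec z10.
have e1 := dim_orth_res S Dz fz sum1; have e2 := dim_Sx_Lam S z1; have e2' := dim_Sx_Lam S z2.
have d1' := hz _ z10; have d2' := hz _ z20.
pose zb := D *m z2; have zb0 : zb != 0.
  apply/eqP => zb0; case: (lindep2_notinP ind); apply/negP; rewrite negbK; apply/vlineP.
  exists ((f *m z2) 0 0).
  by rewrite -mul_cV1 -[LHS]mul1mx -sum1 mulmxDl -!mulmxA -/zb zb0 mulmx0 addr0.
pose DT := orth (res D S); pose L2 := Lam DT zb.
rewrite -/DT in e1.
have DTE t : t \in orth S -> D *m t \in DT by move=> ht; rewrite /DT orth_res mem_quot.
have le2 : (dm (Lam (orth S) z2) <= dm L2)%N.
  by apply: dmS; apply/subvP => g; rewrite !mem_Lam => /DTE; rewrite mulmxA.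
have [im1 im2] := Lam_img DT zb0; rewrite -/L2 in im1 im2.
set U := (linfun (mulmx zb) @: L2)%VS in im1 im2.
have DtU : D *m t0 \notin U.
  apply/negP => /memv_imgP [g _]; rewrite lfunE /= => e; apply: nt0.
  exists (f *m (t0 - z2 *m g)), g; rewrite mulmxA.
  have e' : D *m (t0 - z2 *m g) = 0 by rewrite mulmxBr mulmxA e subrr.
  have {1}-> : t0 = (t0 - z2 *m g) + z2 *m g by rewrite subrK.
  by congr (_ + _); rewrite -[LHS]mul1mx -sum1 mulmxDl -[B *m D *m _]mulmxA e' mulmx0 addr0.
have dU : (dm U < dm DT)%N.
  rewrite ltn_neqAle dmS // andbT; apply: contra DtU => /eqP e.
  suff -> : U = DT by apply: DTE.
  by apply/eqP; rewrite eqEdim im1 /= -[\dim DT]/(dm DT) -e.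
have dDT : (dm DT + 1 = n)%N by lia.
have dL : (dm L2 + 2 <= n)%N by rewrite -im2; lia.
have dL' : (n <= dm L2 + 2)%N by lia.
have dUT : (dm DT <= dm U + 1)%N by rewrite im2; lia.
have cond : (dm (orth (res D S)) + 2 <= n + dm (Lam (orth (res D S)) zb))%N.
  by rewrite -/DT -/L2; lia.
have [|[d _]] := rca_codim_elim zb0 cond (res_rca D hF).
  move=> /(res_local DB) [y0 hy0].
  have hG := rca_subl y0 hF; apply: (@islocal_subl _ _ _ _ _ y0).
  have G0 s : s \in S -> s *m z1 = 0 -> F s - s *m y0 = 0.
    move=> hs sz; apply/eqP; rewrite subr_eq0; apply/eqP; apply: hy0 => //.
    by rewrite -[LHS]mulmx1 -sum1 mulmxDr !mulmxA sz mul0mx add0r.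
  apply: (@eigen_scalar _ _ _ _ _ z1) => //.
  move=> s1 hs1; apply: NNPP => hne; set v := F s1 - s1 *m y0 in hne; set w := s1 *m z1 in hne.
  have w0 : w != 0.
    by apply/eqP => w0; apply: hne; exists 0; rewrite /v (G0 _ hs1 w0) scale0r.
  have indw : lindep2 w v.
    apply: lindep2_notin => //; apply/negP => /vlineP [a e]; by apply: hne; exists a.
  have [m' [f' [B' [D' [_ [fz' Dz' _ DB' sum1']]]]]] := compl_vec zb0.
  have [i ri] : exists i, row i (D' *m (D *m t0)) != 0.
    apply: NNPP => h; case/negP: DtU.
    have D0 : D' *m (D *m t0) = 0.
      by apply/row_matrixP => i; rewrite row0; apply: NNPP => /eqP hi; apply: h; exists i.
    have e : D *m t0 = zb *m (f' *m (D *m t0)).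
      by rewrite -[LHS]mul1mx -sum1' mulmxDl -[B' *m D' *m _]mulmxA D0 mulmx0 addr0 -(mulmxA zb).
    apply/memv_imgP; exists (f' *m (D *m t0)); last by rewrite lfunE.
    by rewrite mem_Lam -e DTE.
  pose r := row i D'; pose h := r *m (D *m t0).
  have h0 : h != 0 by rewrite /h /r -row_mul.
  have rz : r *m zb = 0 by rewrite /r -row_mul Dz' row0.
  pose W : {vspace 'rV[K]_n} := lker (linfun (mulmxr w)).
  pose A1 : {vspace 'rV[K]_n} := lker (linfun (mulmxr v)).
  have dW : (n <= dm W + 1)%N := dm_kernel_row w.
  (* None of the three subspaces contains [W], of dimension at least [n - 1]; for the line of [h]
     this uses [n >= 3]. Avoiding three subspaces takes the three scalars [0], [1], [x]. *)
  have [||g gW gA] := @avoid_subspaces _ _ W [:: A1; L2; <[h]>%VS] [:: 0; 1; x] _ isT.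
  - by rewrite /= !inE !negb_or eq_sym oner_eq0 eq_sym x0 eq_sym x1.
  - move=> A; rewrite !inE => /or3P [] /eqP ->.
    + apply/subvPn; have [_ [_ [g [_ [_ [_ [[_ _ h3 h4] _]]]]]]] := compl_vec2 indw.
      exists g; first by rewrite memv_ker lfunE /= h3.
      by rewrite memv_ker lfunE /= h4; apply: matrix_nonzero1.
    + apply/negP => /dmS h'.
      have := leq_trans dL (leq_trans dW (leq_add h' (leqnn 1))).
      by rewrite leq_add2l.
    + apply/negP => /dmS h'.
      by have := leq_trans n2 (leq_trans dW (leq_add (leq_trans h' (dm_vline h)) (leqnn 1))).
  have gw : g *m w = 0 by move: gW; rewrite memv_ker lfunE => /eqP.
  have gv : g *m v != 0.
    by have := gA A1 (mem_head _ _); rewrite memv_ker lfunE.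
  have gL : g \notin L2 by apply: gA; rewrite !inE eqxx orbT.
  have gh : g \notin <[h]>%VS by apply: gA; rewrite !inE eqxx !orbT.
  have [u [u0 hu]] := rca_core Dz sum1 hG G0 hs1 gw gv.
  have [_ /memv_imgP [l hl ->] [c]] := hyperplane_split im1 dUT (DTE _ ht0) DtU hu.
  rewrite lfunE /= => e.
  have [c0|c0] := eqVneq c 0.
    have [_ [u' [_ [_ [_ [u'u _ _ _ _]]]]]] := compl_vec u0.
    case/negP: gL; have -> : g = (u' *m zb) 0 0 *: l; last exact: memvZ.
    by rewrite -mul_1rV -mulmxA -[LHS]mul1mx -u'u -mulmxA e c0 scale0r addr0.
  have e' : (r *m u) 0 0 *: g = c *: h.
    by rewrite -mul_1rV -mulmxA e mulmxDr mulmxA rz mul0mx add0r -scalemxAr.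
  case/negP: gh; have ru : (r *m u) 0 0 != 0.
    apply/eqP => ru; move/eqP: e'; rewrite ru scale0r eq_sym scaler_eq0 (negPf c0) /=.
    by rewrite (negPf h0).
  by rewrite -[g](scalerK ru) e' scalerA memvZ // memv_line.
have := dim_Sx_Lam (res D S) zb; rewrite d -/DT -/L2; lia.
Qed.
End TwoPlanes.

(** * Homogeneous maps in codimension 2n - 3 *)

Section Linear.
Variable K : fieldType.
Implicit Types n m p : nat.

Lemma rca_Sx_le1 n p (S : {vspace 'M[K]_(n, p)}) F z :
  (dm (orth S) + 3 <= 2 * n)%N -> z != 0 -> (dm (Sx S z) <= 1)%N -> rca S F ->
  islocal S F \/ (dm (Sx S z) = 1%N /\ ~ homog S F).
Proof.
move=> hd z0 d hF; apply: rca_codim_elim z0 _ hF.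
by have := dim_Sx_Lam S z; lia.
Qed.

(** A generator [t0] of rank one would make some [S z] at most a line, so its two columns are
    independent and support [orth S]. *)
Lemma orth_n2 p (S : {vspace 'M[K]_(2, p)}) :
  dm (orth S) = 1%N -> (forall z, z != 0 -> (1 < dm (Sx S z))%N) ->
  exists z1 z2 : 'cV[K]_p, lindep2 z1 z2 /\
    forall t, t \in orth S -> exists g1 g2 : 'rV[K]_2, t = z1 *m g1 + z2 *m g2.
Proof.
move=> d hz; have [t0 et] := dim_le1 (eq_leq d).
have ht0 : t0 \in orth S by rewrite et memv_line.
have t00 : t0 != 0 by apply/eqP => e; move: d; rewrite et e [dm _]dimv0.
pose e0 : 'cV[K]_2 := delta_mx 0 0; pose e1 : 'cV[K]_2 := delta_mx 1 0.
exists (t0 *m e0), (t0 *m e1); split=> [a b e|t].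
  pose y := a *: e0 + b *: e1.
  have ty : t0 *m y = 0 by rewrite mulmxDr -!scalemxAr.
  have [y0|y0] := eqVneq y 0.
    split; [have /colP /(_ 0) := y0 | have /colP /(_ 1) := y0]; rewrite !mxE /=.
      by rewrite mulr1 mulr0 addr0.
    by rewrite mulr1 mulr0 add0r.
  have [m [f [B [C [em [_ _ _ CB sum1]]]]]] := compl_vec y0.
  have {em} em : m = 1%N by lia.
  subst m; have et0 : t0 = t0 *m B *m C.
    by rewrite -[LHS]mulmx1 -sum1 mulmxDr !mulmxA ty mul0mx add0r.
  have z0 : t0 *m B != 0 by apply: contraNneq t00 => z0; rewrite et0 z0 mul0mx.
  have C0 : C != 0.
    by apply/eqP => C0; move/matrixP: CB => /(_ 0 0) /eqP; rewrite C0 mul0mx !mxE eq_sym oner_eq0.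
  have : (dm <[C]>%VS <= dm (Lam (orth S) (t0 *m B)))%N.
    by apply: dmS; rewrite -memvE mem_Lam -et0.
  rewrite [dm <[C]>%VS]dim_vline C0; have := dim_Sx_Lam S (t0 *m B); have := hz _ z0; lia.
rewrite et => /vlineP [k ->]; exists (k *: e0^T), (k *: e1^T).
rewrite -!scalemxAr -scalerDr -!mulmxA -mulmxDr; congr (_ *: _).
rewrite -[LHS]mulmx1; congr (_ *m _); apply/matrixP => i j.
rewrite /e0 /e1 !mxE !big_ord_recl !big_ord0 !mxE.
by case: (ord2P i) => ->; case: (ord2P j) => ->; rewrite /= ?mulr0 ?mul0r ?mulr1 ?addr0 ?add0r.
Qed.

Lemma rca_n2 p (S : {vspace 'M[K]_(2, p)}) F (x : K) : x != 0 -> x != 1 ->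
  (dm (orth S) + 3 <= 4)%N -> (forall z, z != 0 -> (1 < dm (Sx S z))%N) -> rca S F ->
  islocal S F \/ (type2 S /\ ~ homog S F).
Proof.
move=> x0 x1 d hz hF; have [d0|d1] := leqP (dm (orth S) + 2) 2.
  by left; apply: rca_codim_small.
have {}d1 : dm (orth S) = 1%N by lia.
have [z1 [z2 [ind hT]]] := orth_n2 d1 hz.
have le z : (dm (Sx S z) <= 2)%N by have := dim_Sx_Lam S z; lia.
by apply: (rca_planar _ x0 x1 ind hT); rewrite ?d1.
Qed.

(** Two independent vectors of [B] span some plane [S z]. All [z] with such small images lie on one
    line, so all these planes coincide. *)
Lemma local_quots_plane n p (S : {vspace 'M[K]_(n, p)}) F (B : 'cV[K]_n -> Prop) :
  ~ islocal S F ->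
  (forall z, z != 0 -> (1 < dm (Sx S z))%N) ->
  (forall z1 z2, lindep2 z1 z2 -> (dm (Sx S z1) <= 2)%N -> (dm (Sx S z2) <= 2)%N -> False) ->
  (forall y, B y -> y != 0 /\ exists x, forall s, s \in S -> exists a, F s - s *m x = a *: y) ->
  exists P : {vspace 'cV[K]_n}, (dm P <= 2)%N /\ forall y, B y -> y \in P.
Proof.
move=> nl hz n2z loc.
have step y1 y2 : B y1 -> B y2 -> lindep2 y1 y2 ->
    exists2 z, z != 0 & Sx S z = (<[y1]> + <[y2]>)%VS.
  move=> /loc [_ [x1 h1]] /loc [_ [x2 h2]] ind; have [//|[z0 hz0]] := two_local h1 h2 ind.
  exists (x1 - x2) => //; apply/eqP; rewrite eqEdim; apply/andP; split.
    by apply/subvP => _ /SxP [s hs ->]; apply: hz0.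
  by apply: leq_trans (dm_plane y1 y2) _; apply: hz.
have [h|h] := classic (exists y1 y2, [/\ B y1, B y2 & lindep2 y1 y2]); last first.
  have [h'|] := classic (forall y, ~ B y).
    by exists 0%VS; rewrite [dm _]dimv0; split=> // y /h'.
  move=> /not_all_ex_not [y0 /NNPP By0]; exists <[y0]>%VS; split.
    by apply: leq_trans (dm_vline _) _.
  move=> y By; apply: contraT => hy; case: h; exists y0, y; split=> //.
  by apply: lindep2_notin hy; have [] := loc _ By0.
case: h => y1 [y2 [B1 B2 ind]]; have [z z0 ez] := step _ _ B1 B2 ind.
exists (<[y1]> + <[y2]>)%VS; split; first exact: dm_plane.
move=> y By; apply: contraT => hy.
have ind' : lindep2 y1 y.
  apply: lindep2_notin; first by have [] := loc _ B1.
  by apply: contra hy; apply: (subvP (addvSl _ _)).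
have [z' z'0 ez'] := step _ _ B1 By ind'.
have le w : (dm (Sx S w) <= 2)%N -> w \in <[z]>%VS.
  move=> dw; apply: contraT => hw; case: (n2z z w _ _ dw); first exact: lindep2_notin.
  by rewrite ez dm_plane.
have /vlineP [k ek] : z' \in <[z]>%VS by apply: le; rewrite ez' dm_plane.
have le' : (Sx S z' <= Sx S z)%VS.
  by apply/subvP => _ /SxP [s hs ->]; rewrite ek -scalemxAr memvZ // mem_Sx.
by case/negP: hy; rewrite -ez; apply: (subvP le'); rewrite ez'; apply: (subvP (addvSr _ _)); apply: memv_line.
Qed.

(** Homogeneity passes to quotients, so every [y] with [dim T y >= 2] has a local quotient, and
    these [y] lie in a plane [P]. Off [P], one of the nonzero scalars [1] and [x] always keeps
    [y + c z] outside [P]. *)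
Lemma rca_homog_local n p (S : {vspace 'M[K]_(n, p)}) F (x : K) : x != 0 -> x != 1 ->
  (dm (orth S) + 3 <= 2 * n)%N -> rca S F -> homog S F -> islocal S F.
Proof.
move=> x0 x1; elim/ltn_ind: n p S F => n IH p S F hd hF hom; apply: NNPP => nl.
have [d4|d3] := leqP (dm (orth S) + 4) (2 * n).
  by have [|[]] := rca_codim_2n4 d4 hF.
have dT : (dm (orth S) + 3)%N = (2 * n)%N by lia.
have hz z : z != 0 -> (1 < dm (Sx S z))%N.
  move=> z0; rewrite ltnNge; apply/negP => d.
  by have [|[]] := rca_Sx_le1 hd z0 d hF.
have [n2|n2] := eqVneq n 2.
  subst n; by have [|[]] := rca_n2 x0 x1 hd hz hF.
have n3 : (2 < n)%N by lia.
have n2z z1 z2 : lindep2 z1 z2 -> (dm (Sx S z1) <= 2)%N -> (dm (Sx S z2) <= 2)%N -> False.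
  by move=> ind d1 d2; have [|[]] := rca_two_planes n3 x0 x1 ind dT d1 d2 hz hF.
pose good y := (1 < dm (Sx (orth S) y))%N.
have loc y : good y -> y != 0 /\ exists x, forall s, s \in S -> exists a, F s - s *m x = a *: y.
  move=> gy; have y0 : y != 0 by apply: contraTneq gy => ->; rewrite /good -leqNgt Sx0 [dm _]dimv0.
  split=> //; have [m [C [F' [em [[hF' hC homF' _ hk] [hdq _ _]]]]]] := quot_pack y0 hF.
  apply: islocal_quot hC hk _; apply: IH hF' (homF' hom); first by lia.
  by move: gy hdq; rewrite /good; lia.
have [P [dP hP]] := local_quots_plane nl hz n2z loc.
have spP : spans (fun y => y \notin P) by apply: spans_notin_dim; apply: leq_ltn_trans dP n3.
have bad y : y \notin P -> (dm (Sx (orth S) y) <= 1)%N.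
  by move=> yP; rewrite leqNgt; apply/negP => /hP; apply/negP.
have [||[u hu]] := compat spP bad.
- move=> y z t yP zP nyz _ ht ty.
  have [|||c hc hcP] := @line_avoid K _ [:: P] y z [:: 1; x].
  + by rewrite /= !inE eq_sym x1.
  + by [].
  + by move=> A; rewrite inE => /eqP ->; rewrite negb_and yP.
  have c0 : c != 0 by move: hc; rewrite !inE => /orP [] /eqP ->; rewrite ?oner_eq0.
  by apply: (bad_pair c0 nyz _ ht ty); apply: bad; apply: hcP; apply: mem_head.
- by lia.
by have [|[]] := rca_rank1 (ltnW n3) hu hF.
Qed.
End Linear.

(** * Three-dimensional targets *)

Section Basis3.
Variable K : fieldType.

Definition col3 n (u v w : 'cV[K]_n) : 'M[K]_(n, 3) :=
  \matrix_(i, j) if j == 0 then u i 0 else if j == 1 then v i 0 else w i 0.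

Lemma ord3P (j : 'I_3) : [\/ j = 0, j = 1 | j = 2].
Proof.
by case: j => [[|[|[|//]]] h]; [apply: Or31|apply: Or32|apply: Or33]; apply: val_inj.
Qed.

Lemma lift3 : (lift ord0 ord0 = 1 :> 'I_3) * (lift ord0 (lift ord0 ord0) = 2 :> 'I_3).
Proof. by split; apply: val_inj. Qed.

Lemma col3_mul n (u v w : 'cV[K]_n) (x : 'cV[K]_3) :
  col3 u v w *m x = x 0 0 *: u + x 1 0 *: v + x 2 0 *: w.
Proof.
apply/colP => i; rewrite !mxE !big_ord_recl big_ord0 addr0 !mxE /= !lift3.
by ring.
Qed.

Lemma mul_col3 m n (M : 'M[K]_(m, n)) u v w : M *m col3 u v w = col3 (M *m u) (M *m v) (M *m w).
Proof.
apply/matrixP => i j; rewrite /col3 !mxE; case: (ord3P j) => -> /=;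
by apply: eq_bigr => k _; rewrite mxE.
Qed.

Lemma leftinv_col3 n (u v w : 'cV[K]_n) : lindep3 u v w -> exists f, f *m col3 u v w = 1%:M.
Proof.
move=> uv; apply: leftinv_free => x; rewrite col3_mul => /uv [h0 h1 h2].
by apply/colP => i; rewrite mxE; case: (ord3P i) => ->.
Qed.

Lemma dual3 n (u v w : 'cV[K]_n) : lindep3 u v w -> exists f : 'M[K]_(3, n),
  forall a b c, f *m (a *: u + b *: v + c *: w) = \col_i (if i == 0 then a else if i == 1 then b else c).
Proof.
move=> /leftinv_col3 [f hf]; exists f => a b c.
set x := (X in _ = X); have -> : a *: u + b *: v + c *: w = col3 u v w *m x.
  by rewrite col3_mul !mxE.
by rewrite mulmxA hf mul1mx.
Qed.

Lemma span3 (u v w x : 'cV[K]_3) : lindep3 u v w -> exists a b c, x = a *: u + b *: v + c *: w.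
Proof.
move=> /leftinv_col3 [f hf]; have hf' := mulmx1C hf.
exists ((f *m x) 0 0), ((f *m x) 1 0), ((f *m x) 2 0).
by rewrite -col3_mul mulmxA hf' mul1mx.
Qed.
End Basis3.

(** * Cyclic vectors and additive maps attached to a matrix of size 3 *)

Section Pencil.
Variables (K : fieldType) (A : 'M[K]_3).
Hypothesis injA : forall v : 'cV[K]_3, A *m v = 0 -> v = 0.

Lemma plane_cap (U W : {vspace 'cV[K]_3}) : dm U = 2%N -> dm W = 2%N -> ~~ (W <= U)%VS ->
  dm (U :&: W)%VS = 1%N.
Proof.
move=> dU dW nWU; have e : (dm (U + W)%VS + dm (U :&: W)%VS)%N = (dm U + dm W)%N := dimv_sum_cap U W.
have le3 : (dm (U + W)%VS <= 3)%N by apply: leq_trans (dmS (subvf _)) _; rewrite dmf.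
have gt2 : (dm U < dm (U + W)%VS)%N.
  rewrite ltn_neqAle dmS ?addvSl // andbT; apply/eqP => eU; case/negP: nWU.
  have E : (U = U + W)%VS by apply/eqP; rewrite eqEdim addvSl -[\dim (U + W)]/(dm _) -eU leqnn.
  by rewrite E; exact: addvSr.
lia.
Qed.

Lemma dm_plane2 n (v w : 'cV[K]_n) : lindep2 v w -> dm (<[v]> + <[w]>)%VS = 2%N.
Proof.
move=> i; apply/eqP; rewrite eqn_leq dm_plane; apply/dim_gt1P; exists v, w.
by split=> //; [rewrite memvE addvSl | rewrite memvE addvSr].
Qed.

Lemma in_plane n (v w u : 'cV[K]_n) : u \in (<[v]> + <[w]>)%VS -> exists a b, u = a *: v + b *: w.
Proof. by case/memv_addP => _ /vlineP [a ->] [_ /vlineP [b ->] ->]; exists a, b. Qed.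

Lemma mem_plane n (v w : 'cV[K]_n) a b : a *: v + b *: w \in (<[v]> + <[w]>)%VS.
Proof. by rewrite memv_add // memvZ // memv_line. Qed.

Section Cyclic.
Hypothesis h1 : forall l (e : 'cV[K]_3), ~ (forall v, exists k, A *m v = l *: v + k *: e).
Hypothesis h2 : forall u v : 'cV[K]_3, u != 0 ->
  (exists l, A *m u = l *: u) -> (exists l, A *m v = l *: v) -> v \in <[u]>%VS.

Let eig (v : 'cV[K]_3) := exists l, A *m v = l *: v.
Let N (v : 'cV[K]_3) := (<[v]> + <[A *m v]>)%VS.

Lemma noneig_indep (v : 'cV[K]_3) : ~ eig v -> lindep2 v (A *m v).
Proof.
move=> nv; apply: lindep2_notin.
  by apply/eqP => v0; apply: nv; exists 0; rewrite v0 mulmx0 scaler0.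
by apply/negP => /vlineP [k e]; apply: nv; exists k.
Qed.

Lemma noneig_common (v w : 'cV[K]_3) : ~ eig v -> ~ eig w -> A *m (A *m v) \in N v -> A *m (A *m w) \in N w ->
  w \notin N v -> exists e, [/\ e != 0, eig e, e \in N v & e \in N w].
Proof.
move=> nv nw iv iw wNv.
have stab (u x : 'cV[K]_3) : A *m (A *m u) \in N u -> x \in N u -> A *m x \in N u.
  move=> iu /in_plane [a [b ->]]; rewrite mulmxDr -!scalemxAr memvD // memvZ //.
  by rewrite memvE addvSr.
have d : dm (N v :&: N w)%VS = 1%N.
  apply: plane_cap; try (apply: dm_plane2; exact: noneig_indep).
  by apply: contra wNv => /subvP; apply; rewrite memvE addvSl.
have [e ee] := dim_le1 (eq_leq d).
have e0 : e != 0 by apply/eqP => e0; move: d; rewrite ee e0 [dm _]dimv0.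
have /memv_capP [e1 e2] : e \in (N v :&: N w)%VS by rewrite ee memv_line.
exists e; split=> //; apply/vlineP; rewrite -ee; apply/memv_capP; split; exact: stab.
Qed.

Lemma noneig_eig (v e : 'cV[K]_3) : ~ eig v -> e != 0 -> eig e -> e \in N v -> exists a b, A *m v = a *: v + b *: e.
Proof.
move=> nv e0 ee /in_plane [a [b eN]].
have b0 : b != 0.
  apply/eqP => b0; apply: nv; have a0 : a != 0.
    by apply: contraNneq e0 => a0; rewrite eN a0 b0 !scale0r addr0.
  case: ee => l; rewrite eN b0 scale0r addr0 -scalemxAr scalerA mulrC -scalerA => /(scalerI a0) h.
  by exists l.
exists (- (b^-1 * a)), b^-1; rewrite eN scalerDr !scalerA mulVf // scale1r.
by rewrite addrA -scalerDl addNr scale0r add0r.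
Qed.

(** Without a cyclic vector, every non-eigenvector [v] spans a stable plane with [A v]. Any two
    distinct such planes meet in the only eigenline, that of [e]. So [v], [w] and [w + v] are
    eigenvectors modulo [e], and [A] is a scalar modulo [e], against [h1]. *)
Lemma cyclic_vector : exists v : 'cV[K]_3, lindep3 v (A *m v) (A *m (A *m v)).
Proof.
apply: NNPP => nc.
have st (v : 'cV[K]_3) : ~ eig v -> A *m (A *m v) \in N v.
  move=> nv; apply: contraT => h; case: nc; exists v; apply: lindep3_notin h; exact: noneig_indep.
have noneig_out (U : {vspace 'cV[K]_3}) x : (dm U < 3)%N -> x \in U -> x != 0 ->
    exists2 v, v \notin U & ~ eig v.
  move=> dU xU x0; have [v vU] := exists_notin dU; have [ev|] := classic (eig v); last by exists v.
  exists (v + x); first by rewrite rpredDr.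
  move=> evx; have v0 : v != 0 by apply: contraNneq vU => ->; rewrite mem0v.
  have /vlineP [k ek] := h2 v0 ev evx.
  have k1 : k - 1 != 0.
    apply: contraNneq x0 => /eqP; rewrite subr_eq0 => /eqP k1; apply/eqP; apply: (addrI v).
    by rewrite addr0 ek k1 scale1r.
  case/negP: vU; rewrite -[v](scalerK k1) memvZ //.
  by rewrite scalerBl scale1r -ek addrC addKr.
pose d0 : 'cV[K]_3 := delta_mx 0 0; have e00 : d0 != 0.
  by apply/eqP => /matrixP /(_ 0 0) /eqP; rewrite !mxE oner_eq0.
have [v _ nv] : exists2 v, v \notin <[d0]>%VS & ~ eig v.
  apply: (noneig_out _ d0); rewrite ?memv_line //.
  exact: leq_ltn_trans (dm_vline _) _.
have v0 : v != 0 := lindep2_neq0 (noneig_indep nv).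
have dN : (dm (N v) < 3)%N by rewrite ltnS dm_plane.
have vN : v \in N v by rewrite memvE addvSl.
have [w wN nw] := noneig_out _ _ dN vN v0.
have [e [e0 ee eNv eNw]] := noneig_common nv nw (st _ nv) (st _ nw) wN.
have [a [b Av]] := noneig_eig nv e0 ee eNv; have [c [d Aw]] := noneig_eig nw e0 ee eNw.
have uN : w + v \notin N v by rewrite rpredDr.
have nu : ~ eig (w + v).
  move=> eu; have /vlineP [k ek] := h2 e0 ee eu.
  by case/negP: uN; rewrite ek memvZ.
have [e' [e'0 ee' e'v e'u]] := noneig_common nv nu (st _ nv) (st _ nu) uN.
have eNu : e \in N (w + v).
  by have /vlineP [k ->] := h2 e'0 ee' ee; rewrite memvZ.
have [f [g Au]] := noneig_eig nu e0 ee eNu.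
have ve : lindep2 v e.
  apply: lindep2_sym; apply: lindep2_notin => //; apply/negP => /vlineP [k ek].
  case: ee => l el; apply: nv; exists l; by rewrite ek -scalemxAr el !scalerA mulrC.
have i3 : lindep3 v e w.
  apply: lindep3_notin ve _; apply: contra wN => /in_plane [k [k' ->]].
  by rewrite memvD ?memvZ.
have [] := i3 (a - f) (b + d - g) (c - f).
  have -> : (a - f) *: v + (b + d - g) *: e + (c - f) *: w =
    ((c *: w + d *: e) + (a *: v + b *: e)) - (f *: (w + v) + g *: e) by cvring.
  by rewrite -Av -Aw -Au mulmxDr subrr.
move=> /eqP; rewrite subr_eq0 => /eqP af _ /eqP; rewrite subr_eq0 => /eqP cf.
case: ee => l el; apply: (h1 (l := f) (e := e)) => x.
have [k1 [k2 [k3 ->]]] := span3 x i3.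
exists (k1 * b + k2 * (l - f) + k3 * d).
rewrite !mulmxDr -!scalemxAr Av Aw el af cf; cvring.
Qed.
End Cyclic.

Section Additive.
Variables (bt : 'cV[K]_3 -> 'cV[K]_3) (x : K).
Hypotheses (x0 : x != 0) (x1 : x != 1).
Hypothesis btD : forall u v, bt (u + v) = bt u + bt v.
Hypothesis btP : forall v, exists a b, bt v = a *: v + b *: (A *m v).

(* Writing [bt (k v) = a v + b Av] and [bt (m Av) = c Av + d A^2 v], membership of
   [bt (k v + m Av)] in the span of [k v + m Av] and its image reads
   [k m (b(k) + c(m)) = m^2 a(k) + k^2 d(m)]. *)
Lemma cyclic_additive (v : 'cV[K]_3) : lindep3 v (A *m v) (A *m (A *m v)) -> bt v = 0 ->
  exists c, forall k, bt (k *: v) = ((k - k ^+ 2) * c) *: v /\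
    bt (k *: (A *m v)) = (k * c) *: (A *m v) + (k ^+ 2 * c) *: (A *m (A *m v)).
Proof.
set w := A *m v; set u := A *m w => i3 v0.
have [f fE] := dual3 i3; pose p i (y : 'cV[K]_3) := (f *m y) i 0.
have pD i y z : p i (y + z) = p i y + p i z by rewrite /p mulmxDr mxE.
have pE a b c : [/\ p 0 (a *: v + b *: w + c *: u) = a, p 1 (a *: v + b *: w + c *: u) = b
    & p 2 (a *: v + b *: w + c *: u) = c] by rewrite /p fE !mxE.
pose a k := p 0 (bt (k *: v)); pose b k := p 1 (bt (k *: v)).
pose c k := p 1 (bt (k *: w)); pose d k := p 2 (bt (k *: w)).
have Ev k : bt (k *: v) = a k *: v + b k *: w.
  rewrite /a /b; have [r [t ->]] := btP (k *: v); rewrite -scalemxAr -/w !scalerA.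
  have := pE (r * k) (t * k) 0; rewrite scale0r addr0 => -[-> -> _] //.
have Ew k : bt (k *: w) = c k *: w + d k *: u.
  rewrite /c /d; have [r [t ->]] := btP (k *: w); rewrite -scalemxAr -/u !scalerA.
  by have := pE 0 (r * k) (t * k); rewrite scale0r add0r => -[_ -> ->].
have cD k l : c (k + l) = c k + c l by rewrite /c scalerDl btD pD.
have dD k l : d (k + l) = d k + d l by rewrite /d scalerDl btD pD.
have key k m : k != 0 -> m != 0 -> k * m * (b k + c m) = m ^+ 2 * a k + k ^+ 2 * d m.
  move=> k0 m0; have [r [t]] := btP (k *: v + m *: w).
  rewrite btD Ev Ew mulmxDr -!scalemxAr -/w -/u => e.
  have e1 : a k *: v + b k *: w + (c m *: w + d m *: u) = a k *: v + (b k + c m) *: w + d m *: u by cvring.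
  have e2 : r *: (k *: v + m *: w) + t *: (k *: w + m *: u) = (r * k) *: v + (r * m + t * k) *: w + (t * m) *: u by cvring.
  have [q0 q1 q2] := pE (a k) (b k + c m) (d m); have [q0' q1' q2'] := pE (r * k) (r * m + t * k) (t * m).
  rewrite -e1 e -/w e2 q0' in q0; rewrite -e1 e e2 q1' in q1; rewrite -e1 e e2 q2' in q2.
  by rewrite -q0 -q1 -q2; ring.
have [a1 b1 _] := pE 0 0 0; rewrite !scale0r !addr0 in a1 b1.
have {}a1 : a 1 = 0 by rewrite /a scale1r v0.
have {}b1 : b 1 = 0 by rewrite /b scale1r v0.
have cd m : m != 0 -> d m = m * c m.
  by move=> m0; have := key 1 m (oner_neq0 _) m0; rewrite a1 b1 mulr0 !add0r expr1n !mul1r.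
have zero g : (forall k l : K, g (k + l) = g k + g l :> K) -> g 0 = 0.
  by move=> gD; have := gD 0 0; rewrite addr0 => /eqP; rewrite -subr_eq subrr eq_sym => /eqP.
have cd' m : d m = m * c m.
  by have [->|/cd //] := eqVneq m 0; rewrite (zero _ dD) mul0r.
(* Both [c] and [d m = m c m] are additive; the cross terms must cancel, which leads to
   [c k = k c 1]. *)
have anti k l : k * c l + l * c k = 0.
  have := dD k l; rewrite !cd' cD => e.
  have -> : k * c l + l * c k = (k + l) * (c k + c l) - (k * c k + l * c l) by ring.
  by rewrite e subrr.
have cc : c 1 + c 1 = 0 by have := anti 1 1; rewrite mul1r.
have cE k : c k = k * c 1.
  have := anti k 1; rewrite mul1r => /eqP; rewrite addrC addr_eq0 => /eqP ->.
  by rewrite -mulrN; congr (_ * _); apply/eqP; rewrite eq_sym -addr_eq0 cc.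
have ab k : a k = (k - k ^+ 2) * c 1 /\ b k = 0.
  have [->|k0] := eqVneq k 0.
    rewrite /a /b scale0r (_ : bt 0 = 0); last first.
      by have := btD 0 0; rewrite addr0 => /eqP; rewrite -subr_eq subrr eq_sym => /eqP.
    by rewrite /p mulmx0 !mxE expr0n subrr mul0r.
  have K1 := key k 1 k0 (oner_neq0 _); have Kx := key k x k0 x0.
  rewrite cd' cE in Kx; rewrite cd' expr1n !mul1r mulr1 in K1.
  have bE : k * b k = a k + (k ^+ 2 - k) * c 1.
    have -> : k * b k = k * (b k + c 1) - k * c 1 by ring.
    by rewrite K1; ring.
  have e2 : (x - x ^+ 2) * (k * b k) = 0.
    have -> : (x - x ^+ 2) * (k * b k) =
      (k * x * (b k + x * c 1) - x ^+ 2 * (k * b k)) - k * x * (x * c 1) by ring.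
    by rewrite Kx {1}bE; ring.
  have b0 : b k = 0.
    move/eqP: e2; rewrite !mulf_eq0 (negPf k0) /= => /orP [|/eqP //].
    rewrite -[X in X - _]mulr1 expr2 -mulrBr mulf_eq0 (negPf x0) /= subr_eq0 eq_sym.
    by rewrite (negPf x1).
  split=> //; move/eqP: bE; rewrite b0 mulr0 eq_sym addr_eq0 => /eqP ->; ring.
exists (c 1) => k; rewrite Ev Ew; have [-> ->] := ab k; rewrite scale0r addr0; split=> //.
by rewrite cd' cE mulrA expr2.
Qed.
End Additive.

(** [cyclic_additive] at [v] leaves a defect governed by one constant [c]. As [A] is injective,
    [A v] is cyclic too; after removing the value at [A v], the same lemma there expresses the
    defect along [A v], whereas the first expression is along [A (A v)]. Evaluation at [x] kills
    both constants. *)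
Lemma pencil_additive (bt : 'cV[K]_3 -> 'cV[K]_3) (x : K) : x != 0 -> x != 1 ->
  (forall l (e : 'cV[K]_3), ~ (forall v, exists k, A *m v = l *: v + k *: e)) ->
  (forall u v : 'cV[K]_3, u != 0 ->
    (exists l, A *m u = l *: u) -> (exists l, A *m v = l *: v) -> v \in <[u]>%VS) ->
  (forall u v, bt (u + v) = bt u + bt v) ->
  (forall v, exists a b, bt v = a *: v + b *: (A *m v)) ->
  exists a b, forall v, bt v = a *: v + b *: (A *m v).
Proof.
move=> x0 x1 h1 h2 btD btP; have [v i3] := cyclic_vector h1 h2.
have [a [b eb]] := btP v; exists a, b.
pose b1 y := bt y - a *: y - b *: (A *m y).
have b1D y z : b1 (y + z) = b1 y + b1 z.
  rewrite /b1 btD mulmxDr; move: (bt y) (bt z) (A *m y) (A *m z) => *; cvring.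
have b1P y : exists a' b', b1 y = a' *: y + b' *: (A *m y).
  have [a' [b' e]] := btP y; exists (a' - a), (b' - b); rewrite /b1 e.
  by move: (A *m y) => *; cvring.
have b1v : b1 v = 0 by rewrite /b1 eb; move: (A *m v) => *; cvring.
have [c hc] := cyclic_additive x0 x1 b1D b1P i3 b1v.
set w := A *m v in i3 hc; set u := A *m w in i3 hc.
have i3' : lindep3 w u (A *m u).
  move=> r s t e; apply: i3; apply: injA.
  by rewrite !mulmxDr -!scalemxAr.
have i2 : lindep2 w u.
  by move=> r s e; have [] := i3' r s 0; rewrite ?scale0r ?addr0.
pose b2 y := b1 y - c *: y - c *: (A *m y).
have b2D y z : b2 (y + z) = b2 y + b2 z.
  rewrite /b2 b1D mulmxDr; move: (b1 y) (b1 z) (A *m y) (A *m z) => *; cvring.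
have b2P y : exists a' b', b2 y = a' *: y + b' *: (A *m y).
  have [a' [b' e]] := b1P y; exists (a' - c), (b' - c); rewrite /b2 e.
  by move: (A *m y) => *; cvring.
have b2w : b2 w = 0.
  have [_] := hc 1; rewrite scale1r /b2 => ->; rewrite -/u; cvring.
have [c' hc'] := cyclic_additive x0 x1 b2D b2P i3' b2w.
have E k : ((k - k ^+ 2) * c') *: w = ((k ^+ 2 - k) * c) *: u.
  have [<- _] := hc' k; rewrite /b2; have [_ ->] := hc k.
  by rewrite -scalemxAr -/u; cvring.
have [z1 z2] : (x - x ^+ 2) * c' = 0 /\ - ((x ^+ 2 - x) * c) = 0.
  by apply: i2; rewrite scaleNr E subrr.
have xx : x - x ^+ 2 != 0.
  by rewrite -[X in X - _]mulr1 expr2 -mulrBr mulf_eq0 negb_or x0 subr_eq0 eq_sym.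
have c'0 : c' = 0 by move/eqP: z1; rewrite mulf_eq0 (negPf xx) => /eqP.
have c0 : c = 0.
  by move/eqP: z2; rewrite oppr_eq0 -opprB mulNr oppr_eq0 mulf_eq0 (negPf xx) => /eqP.
have H y : b1 y = 0.
  have [k1 [k2 [k3 ->]]] := span3 y i3; rewrite !b1D.
  have [-> _] := hc k1; have [_ ->] := hc k2.
  have : b2 (k3 *: u) = 0 by have [_ ->] := hc' k3; rewrite c'0 !mulr0 !scale0r addr0.
  rewrite /b2 c0 !scale0r !subr0 => ->.
  by rewrite !mulr0 !scale0r !addr0.
move=> y; have /eqP := H y; rewrite /b1 subr_eq add0r subr_eq => /eqP ->.
by rewrite addrC.
Qed.
End Pencil.

(** * Three-dimensional annihilators supported on two columns *)

Section Three.
Variable K : fieldType.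

(** Full images make [s z1] and [s z2] determine each other through an injective [A]. Since
    [S (z2 - l z1)] is the image of [A - l], the hypotheses on [S] say that no [A - l] has rank at
    most one and that there is at most one eigenline. *)
Lemma rca_pencil_full p (S : {vspace 'M[K]_(3, p)}) F (z1 z2 : 'cV[K]_p) (x : K) :
  x != 0 -> x != 1 -> lindep2 z1 z2 ->
  (forall t, t \in orth S -> exists g1 g2 : 'rV[K]_3, t = z1 *m g1 + z2 *m g2) ->
  dm (orth S) = 3%N -> dm (Sx S z1) = 3%N -> dm (Sx S z2) = 3%N ->
  (forall z, z != 0 -> (1 < dm (Sx S z))%N) ->
  (forall z1 z2, lindep2 z1 z2 -> (dm (Sx S z1) <= 2)%N -> (dm (Sx S z2) <= 2)%N -> False) ->
  rca S F -> islocal S F.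
Proof.
move=> x0 x1 ind hT dT d1 d2 hz n2z hF.
have sat := planar_sat hT.
have hS s : s *m z1 = 0 -> s *m z2 = 0 -> s \in S.
  by move=> e1 e2; apply: (sat 0); rewrite ?mem0v // mul0mx.
have hS' s : s *m z2 = 0 -> s *m z1 = 0 -> s \in S by move=> e2 e1; apply: hS.
have ker w1 w2 : lindep2 w1 w2 -> (forall s, s *m w1 = 0 -> s *m w2 = 0 -> s \in S) ->
    dm (Sx S w1) = 3%N -> forall s, s \in S -> s *m w1 = 0 -> s *m w2 = 0.
  move=> iw hw dw s hs sw; have := planar_ker_dim iw hw; set R1 := (S :&: _)%VS => e.
  have /eqP : dm (Sx R1 w2) = 0%N by lia.
  rewrite dimv_eq0 => /eqP e0; apply/eqP; rewrite -memv0 -e0 mem_Sx //.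
  by rewrite memv_cap hs memv_ker lfunE /= sw eqxx.
have ker1 := ker _ _ ind hS d1; have ker2 := ker _ _ (lindep2_sym ind) hS' d2.
have full : Sx S z1 = fullv.
  by apply/eqP; rewrite eqEdim subvf -[\dim fullv]/(dm fullv) dmf -[\dim _]/(dm _) d1.
have /fin_all_exists [sj hsj] : forall j : 'I_3, exists s, s \in S /\ s *m z1 = delta_mx j 0.
  move=> j; have /SxP [s hs e] : (delta_mx j 0 : 'cV[K]_3) \in Sx S z1 by rewrite full memvf.
  by exists s.
pose A : 'M[K]_3 := \matrix_(i, j) (sj j *m z2) i 0.
pose sv (v : 'cV[K]_3) := \sum_j v j 0 *: sj j.
have svS v : sv v \in S by apply: memv_suml => j _; apply: memvZ; case: (hsj j).
have sv1 v : sv v *m z1 = v.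
  rewrite mulmx_suml; apply/colP => i; rewrite summxE (bigD1 i) //= big1 => [|j ji].
    by rewrite -scalemxAl (proj2 (hsj i)) !mxE !eqxx mulr1 addr0.
  by rewrite -scalemxAl (proj2 (hsj j)) !mxE eq_sym (negPf ji) mulr0.
have sv2 v : sv v *m z2 = A *m v.
  rewrite mulmx_suml; apply/colP => i; rewrite summxE mxE; apply: eq_bigr => j _.
  by rewrite -scalemxAl [in LHS]mxE [A i j]mxE mulrC.
have SA s : s \in S -> s *m z2 = A *m (s *m z1).
  move=> hs; apply/eqP; rewrite -subr_eq0 -sv2 -mulmxBl; apply/eqP; apply: ker1.
    by rewrite memvB.
  by rewrite mulmxBl sv1 subrr.
have injA (v : 'cV[K]_3) : A *m v = 0 -> v = 0.
  by move=> Av; rewrite -[v]sv1; apply: ker2; rewrite ?sv2.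
have zn0 l : z2 - l *: z1 != 0.
  apply/eqP => e; case: (ind (- l) 1); first by rewrite scale1r scaleNr addrC.
  by move=> _ /eqP; rewrite oner_eq0.
have Sl l s : s \in S -> s *m (z2 - l *: z1) = (A - l%:M) *m (s *m z1).
  by move=> hs; rewrite mulmxBr -scalemxAr SA // mulmxBl mul_scalar_mx.
have h1 l (e : 'cV[K]_3) : ~ (forall v, exists k, A *m v = l *: v + k *: e).
  move=> h; have := hz _ (zn0 l); rewrite ltnNge => /negP; apply.
  apply: leq_trans (dm_vline e); apply: dm_Sx_plane => s hs; rewrite Sl // mulmxBl.
  have [k ->] := h (s *m z1); apply/vlineP; exists k.
  by rewrite mul_scalar_mx addrC addKr.
have h2 (u v : 'cV[K]_3) : u != 0 ->
    (exists l, A *m u = l *: u) -> (exists l, A *m v = l *: v) -> v \in <[u]>%VS.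
  move=> u0 [l eu] [m ev]; apply: contraT => hv; have uv := lindep2_notin u0 hv.
  have v0 := lindep2_neq0 (lindep2_sym uv).
  have [w hw] : exists w, w \notin (<[u]> + <[v]>)%VS.
    by apply: exists_notin; rewrite ltnS dm_plane.
  have i3 := lindep3_notin uv hw.
  have [lm|lm] := eqVneq l m.
    case: (h1 l (A *m w - l *: w)) => y; have [a [b [c ->]]] := span3 y i3; exists c.
    rewrite !mulmxDr -!scalemxAr eu ev lm; move: (A *m w) => Aw; cvring.
  have small k (y : 'cV[K]_3) : y != 0 -> A *m y = k *: y -> (dm (Sx S (z2 - k *: z1)) <= 2)%N.
    move=> y0 ey; have := dm_img (linfun (mulmx (A - k%:M)) : 'Hom('cV[K]_3, 'cV[K]_3)) fullv.
    rewrite capfv dmf => e.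
    have : (dm <[y]>%VS <= dm (lker (linfun (mulmx (A - k%:M)) : 'Hom('cV[K]_3, 'cV[K]_3))))%N.
      by apply: dmS; rewrite -memvE memv_ker lfunE /= mulmxBl mul_scalar_mx ey subrr.
    rewrite [dm <[y]>%VS]dim_vline y0 => e'.
    have le : (dm (Sx S (z2 - k *: z1)) <= dm (limg (linfun (mulmx (A - k%:M)) : 'Hom('cV[K]_3, 'cV[K]_3))))%N.
      apply: dmS; apply/subvP => _ /SxP [s hs ->]; rewrite Sl //.
      by apply/memv_imgP; exists (s *m z1); rewrite ?memvf // lfunE.
    apply: leq_trans le _; rewrite -(leq_add2l 1) -[(1 + 2)%N]/(3 * 1)%N -e.
    exact: leq_add e' (leqnn _).
  case: (n2z (z2 - l *: z1) (z2 - m *: z1)); last 2 first.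
  - exact: small u0 eu.
  - exact: small v0 ev.
  move=> a b e; have [] := ind (- (a * l + b * m)) (a + b).
    by rewrite -e; cvring.
  move=> e1 /eqP; rewrite addrC addr_eq0 => /eqP eb; move/eqP: e1; rewrite oppr_eq0 eb.
  rewrite mulNr -mulrBr mulf_eq0 subr_eq0 (negPf lm) orbF => /eqP a0.
  by rewrite a0 oppr0.
have [w0 [mk [mkz mkD mkZ hm]]] := planar_model (isT : (1 < 3)%N) ind hS hF.
have mkS v : mk v (A *m v) \in S.
  have [e1 e2] := mkz v (A *m v).
  by apply: (sat (sv v)); rewrite ?e1 ?e2 ?sv1 ?sv2.
pose bt v := F (mk v (A *m v)) - mk v (A *m v) *m w0.
have btD u v : bt (u + v) = bt u + bt v.
  by rewrite /bt mulmxDr mkD (rcaD (rca_subl w0 hF)).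
have btP v : exists a b, bt v = a *: v + b *: (A *m v).
  have [_ _ [a [b e]]] := hm _ (mkS v); exists a, b; move: e.
  by have [-> ->] := mkz v (A *m v).
have [a [b hab]] := pencil_additive injA x0 x1 h1 h2 btD btP.
exists (w0 + a *: z1 + b *: z2) => s hs; have [_ e _] := hm s hs.
rewrite (SA s hs) -/(bt _) hab -(SA s hs) in e.
by rewrite !mulmxDr -!scalemxAr -addrA -e addrC subrK.
Qed.

(** At most one of [z1], [z2], [z1 + z2] has a proper image; the other two serve as the pair. *)
Lemma rca_pencil p (S : {vspace 'M[K]_(3, p)}) F (z1 z2 : 'cV[K]_p) (x : K) :
  x != 0 -> x != 1 -> lindep2 z1 z2 ->
  (forall t, t \in orth S -> exists g1 g2 : 'rV[K]_3, t = z1 *m g1 + z2 *m g2) ->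
  dm (orth S) = 3%N -> (forall z, z != 0 -> (1 < dm (Sx S z))%N) ->
  (forall z1 z2, lindep2 z1 z2 -> (dm (Sx S z1) <= 2)%N -> (dm (Sx S z2) <= 2)%N -> False) ->
  rca S F -> islocal S F.
Proof.
move=> x0 x1 ind hT dT hz n2z hF.
have d3 z : ~~ (dm (Sx S z) <= 2)%N -> dm (Sx S z) = 3%N.
  by have := dim_Sx_Lam S z; lia.
have ind1 : lindep2 z1 (z1 + z2).
  move=> a b e; have [] := ind (a + b) b; first by rewrite -e scalerDr addrA scalerDl.
  by move=> e1 b0; move: e1; rewrite b0 addr0.
have ind2 : lindep2 z2 (z1 + z2).
  move=> a b e; have [] := ind b (a + b); first by rewrite -e scalerDr scalerDl addrCA.
  by move=> b0; rewrite b0 addr0.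
have [d1|d1] := boolP (dm (Sx S z1) <= 2)%N.
  have d2 : ~~ (dm (Sx S z2) <= 2)%N by apply/negP => d2; apply: n2z ind d1 d2.
  have d12 : ~~ (dm (Sx S (z1 + z2)) <= 2)%N by apply/negP => d12; apply: n2z ind1 d1 d12.
  apply: (rca_pencil_full x0 x1 ind2) (dT) (d3 _ d2) (d3 _ d12) hz n2z hF => t /hT [g1 [g2 ->]].
  by exists (g2 - g1), g1; rewrite mulmxDl mulmxBr addrCA subrK.
have [d2|d2] := boolP (dm (Sx S z2) <= 2)%N; last first.
  exact: (rca_pencil_full x0 x1 ind hT dT (d3 _ d1) (d3 _ d2) hz n2z hF).
have d12 : ~~ (dm (Sx S (z1 + z2)) <= 2)%N by apply/negP => d12; apply: n2z ind2 d2 d12.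
apply: (rca_pencil_full x0 x1 ind1) (dT) (d3 _ d1) (d3 _ d12) hz n2z hF => t /hT [g1 [g2 ->]].
by exists (g1 - g2), g2; rewrite mulmxDl mulmxBr addrA subrK.
Qed.
End Three.

(** * Recognising alternating annihilators *)

Section Alternating.
Variable K : fieldType.

Lemma col_rank2 n p (u v : 'cV[K]_p) (t : 'M[K]_(p, n)) : lindep2 u v ->
  (forall y, t *m y \in (<[u]> + <[v]>)%VS) -> exists g1 g2, t = u *m g1 + v *m g2.
Proof.
move=> uv h.
have [m [f [g [B [C [_ [_ [[Cu Cv _ _] [_ sum1]]]]]]]]] := compl_vec2 uv.
exists (f *m t), (g *m t); rewrite -[LHS]mul1mx -sum1 2!mulmxDl -[B *m C *m t]mulmxA.
rewrite (_ : C *m t = 0) ?mulmx0 ?addr0 ?mulmxA //.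
apply: mulmx_cV_eq0 => y; rewrite -mulmxA.
by have [a [b ->]] := in_plane (h y); rewrite mulmxDr -!scalemxAr Cu Cv !scaler0 addr0.
Qed.

(** The scalar in excess lets one avoid, besides the given subspaces, a proper subspace supposed to
    contain all avoiding vectors. *)
Lemma spans_avoid n (As : seq {vspace 'cV[K]_n}) (ks : seq K) : uniq ks ->
  (size As < size ks)%N -> (forall A, A \in As -> (dm A < n)%N) ->
  spans (fun y => forall A, A \in As -> y \notin A).
Proof.
move=> uks hs hA W hW; apply/eqP; apply: contraT => Wf.
have nf (A : {vspace 'cV[K]_n}) : (dm A < n)%N -> ~~ (fullv <= A)%VS.
  by move=> dA; apply/negP => /dmS; rewrite dmf muln1 leqNgt dA.
have [|v _ hv] := @avoid_subspaces _ _ fullv (W :: As) ks uks hs.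
  move=> A; rewrite inE => /orP [/eqP ->|/hA /nf //].
  by apply: contra Wf => h; rewrite eqEsubv subvf.
have := hv W (mem_head _ _); rewrite hW // => A hA'; apply: hv.
by rewrite inE hA' orbT.
Qed.

Variables (p : nat) (S : {vspace 'M[K]_(3, p)}) (l : 'cV[K]_3) (Pi : {vspace 'cV[K]_3}) (x w : K).
Let T := orth S.
Hypotheses (dT : dm T = 3%N) (hz : forall z, z != 0 -> (1 < dm (Sx S z))%N).
Hypotheses (dPi : (dm Pi <= 2)%N)
  (HPi : forall z, z != 0 -> (dm (Sx S z) <= 2)%N -> (Sx S z <= Pi)%VS).
Let out (y : 'cV[K]_3) := (y \notin <[l]>%VS) && (y \notin Pi).
Hypothesis HQ : forall y, out y -> (dm (Sx T y) <= 2)%N.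
Hypothesis uK : uniq [:: 0; 1; x; w].

Let ks := [:: 1; x; w].
Lemma uks : uniq ks. Proof. by case/andP: uK. Qed.
Lemma ks_neq0 k : k \in ks -> k != 0.
Proof. by case/andP: uK => h _; apply: contraTneq => ->. Qed.

Lemma dm_add_lines (u v : 'cV[K]_3) : (dm (<[u]> + <[v]>)%VS < 3)%N.
Proof. by rewrite ltnS dm_plane. Qed.

Lemma out_neq0 y : out y -> y != 0.
Proof. by case/andP => h _; apply: contraNneq h => ->; rewrite mem0v. Qed.

(** If [t] is nonzero, it is [z C] with [C] vanishing on the plane of [y] and [v]. Then [S z] lies
    in that plane, fills it because its dimension is at least two, and [HPi] puts [y] in [Pi]. *)
Lemma kill2 t (y v : 'cV[K]_3) : t \in T -> y \notin Pi -> lindep2 y v ->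
  t *m y = 0 -> t *m v = 0 -> t = 0.
Proof.
move=> ht yPi yv ty tv.
have [m [f [g [B [C [em [_ [[Cy Cv _ _] [CB sum1]]]]]]]]] := compl_vec2 yv.
have {em} em : m = 1%N by lia.
subst m; have et : t = t *m B *m C.
  by rewrite -[LHS]mulmx1 -sum1 !mulmxDr !mulmxA ty tv !mul0mx !add0r.
apply/eqP; apply: contraNT yPi => t0.
have z0 : t *m B != 0 by apply: contraNneq t0 => z0; rewrite et z0 mul0mx.
have C0 : C != 0.
  by apply/eqP => C0; move/matrixP: CB => /(_ 0 0) /eqP; rewrite C0 mul0mx !mxE eq_sym oner_eq0.
have CL : C \in Lam T (t *m B) by rewrite mem_Lam -et.
have : (dm <[C]>%VS <= dm (Lam (orth S) (t *m B)))%N by apply: dmS; rewrite -memvE.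
rewrite [dm <[C]>%VS]dim_vline C0 => le.
have e := dim_Sx_Lam S (t *m B); have d2 : (dm (Sx S (t *m B)) <= 2)%N by lia.
apply: (subvP (HPi z0 d2)).
suff -> : Sx S (t *m B) = (<[y]> + <[v]>)%VS by rewrite memvE addvSl.
apply/eqP; rewrite eqEdim; apply/andP; split; last first.
  by rewrite -[\dim _]/(dm _); apply: leq_trans (dm_plane y v) _; apply: hz.
apply/subvP => _ /SxP [s hs ->].
have Cs : C *m (s *m (t *m B)) = 0.
  have /orth_rank1P h : t *m B *m C \in orth S by rewrite -et.
  by have := h s hs; rewrite !mulmxA.
rewrite -[_ *m _]mul1mx -sum1 !mulmxDl -[B *m C *m _]mulmxA Cs mulmx0 addr0.
by rewrite -!mulmxA !mul_cV1 mem_plane.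
Qed.

Lemma kernel_ex y : out y -> exists t, [/\ t \in T, t != 0 & t *m y = 0].
Proof.
move=> oy; have e : (dm (T :&: lker (linfun (mulmxr y)))%VS + dm (Sx T y))%N = dm T :=
  dm_img (linfun (mulmxr y)) T.
have d := HQ oy; have h : (0 < dm (T :&: lker (linfun (mulmxr y)))%VS)%N by lia.
have /subvPn [t] : ~~ (T :&: lker (linfun (mulmxr y)) <= 0)%VS.
  by apply/negP => /dmS; rewrite [dm 0%VS]dimv0 leqNgt h.
rewrite memv_cap => /andP [h1]; rewrite memv_ker lfunE /= memv0 => /eqP h2 h3.
by exists t.
Qed.

Lemma off_line y v c : c != 0 -> v \notin (<[l]> + <[y]>)%VS -> y + c *: v \notin <[l]>%VS.
Proof.
move=> c0; apply: contra => h; rewrite -[v](scalerK c0) memvZ //.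
rewrite -(addKr y (c *: v)) addrC memv_add // memvN memv_line //.
Qed.

Lemma generic_spans y : spans (fun v => (v \notin (<[l]> + <[y]>)%VS) /\ (v \notin Pi)).
Proof.
move=> W hW; apply: (@spans_avoid _ [:: (<[l]> + <[y]>)%VS; Pi] ks uks) => //.
  move=> A; rewrite !inE => /orP [] /eqP ->; first exact: dm_add_lines.
  by rewrite ltnS.
by move=> v hv; apply: hW; split; apply: hv; rewrite !inE eqxx ?orbT.
Qed.

Lemma generic_out y v : v \notin (<[l]> + <[y]>)%VS -> v \notin Pi -> y != 0 ->
  out v /\ lindep2 y v.
Proof.
move=> h1 h2 y0; split.
  by rewrite /out h2 andbT; apply: contra h1; apply: (subvP (addvSl _ _)).
by apply: lindep2_notin => //; apply: contra h1; apply: (subvP (addvSr _ _)).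
Qed.

Lemma lindep2_addr (y v : 'cV[K]_3) c : c != 0 -> lindep2 y v -> lindep2 v (y + c *: v).
Proof.
move=> c0 yv a b e; have [] := yv b (a + b * c); first by rewrite -e; cvring.
by move=> ->; rewrite mul0r addr0.
Qed.

(* Four kernel elements, at [y], [v] and two further points of the line they span,
   cannot be independent in the 3-dimensional space [T]. *)
Lemma image_kernel y t : out y -> (1 < dm (Sx T y))%N -> t \in T -> t *m y = 0 ->
  forall v, t *m v \in Sx T y.
Proof.
move=> oy gy ht ty; apply: (@spans_mem _ _ _ _ (Sx T y) t (@generic_spans y)) => v [v1 v2].
have y0 := out_neq0 oy; have [ov yv] := generic_out v1 v2 y0.
have [_ yPi] := andP oy.
have [t0|t0] := eqVneq t 0; first by rewrite t0 mul0mx mem0v.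
have hA A : A \in [:: Pi] -> ~~ ((y \in A) && (v \in A)).
  by rewrite inE => /eqP ->; rewrite negb_and yPi.
have [c1 hc1 h1] := line_avoid (As := [:: Pi]) uks isT hA.
have s2 : (1 < size (rem c1 ks))%N by rewrite size_rem.
have [c2 hc2 h2] := line_avoid (As := [:: Pi]) (rem_uniq c1 uks) s2 hA.
have {}h1 := h1 Pi (mem_head _ _); have {}h2 := h2 Pi (mem_head _ _).
have c10 := ks_neq0 hc1; have c20 := ks_neq0 (mem_rem hc2).
have c12 : c2 - c1 != 0.
  by rewrite subr_eq0; move: hc2; rewrite mem_rem_uniq ?uks // inE => /andP [].
have o1 : out (y + c1 *: v) by rewrite /out h1 off_line.
have o2 : out (y + c2 *: v) by rewrite /out h2 off_line.
have [t1 [ht1 t10 t1y]] := kernel_ex o1; have [t2 [ht2 t20 t2y]] := kernel_ex o2.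
have [tv [htv tv0 tvv]] := kernel_ex ov.
have E1 : t1 *m y = - c1 *: (t1 *m v).
  by apply/eqP; rewrite scaleNr -addr_eq0 scalemxAr -mulmxDr t1y.
have E2 : t2 *m y = - c2 *: (t2 *m v).
  by apply/eqP; rewrite scaleNr -addr_eq0 scalemxAr -mulmxDr t2y.
have n1 : t1 *m v != 0.
  apply/eqP => e; case/negP: t10; apply/eqP; apply: (kill2 ht1 yPi yv) => //.
  by rewrite E1 e scaler0.
have n2 : t2 *m v != 0.
  apply/eqP => e; case/negP: t20; apply/eqP; apply: (kill2 ht2 yPi yv) => //.
  by rewrite E2 e scaler0.
have in1 : t1 *m v \in Sx T y.
  by rewrite -[t1 *m v](scalerK (a := - c1)) ?oppr_eq0 // -E1 memvZ // mem_Sx.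
have in2 : t2 *m v \in Sx T y.
  by rewrite -[t2 *m v](scalerK (a := - c2)) ?oppr_eq0 // -E2 memvZ // mem_Sx.
have ind : lindep2 t1 t2.
  move=> a b e; have ev : a *: (t1 *m v) + b *: (t2 *m v) = 0.
    by rewrite !scalemxAl -mulmxDl e mul0mx.
  have ey : - (c1 * a) *: (t1 *m v) - (c2 * b) *: (t2 *m v) = 0.
    have : (a *: t1 + b *: t2) *m y = 0 by rewrite e mul0mx.
    rewrite mulmxDl -!scalemxAl E1 E2; move: (t1 *m v) (t2 *m v) => r1 r2 <-; cvring.
  have : (b * (c2 - c1)) *: (t2 *m v) = 0.
    have -> : (b * (c2 - c1)) *: (t2 *m v) =
      - c1 *: (a *: (t1 *m v) + b *: (t2 *m v)) - (- (c1 * a) *: (t1 *m v) - (c2 * b) *: (t2 *m v)).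
      by move: (t1 *m v) (t2 *m v) => r1 r2; cvring.
    by rewrite ev ey scaler0 subr0.
  move/eqP; rewrite scaler_eq0 (negPf n2) orbF mulf_eq0 (negPf c12) orbF => /eqP b0.
  by move/eqP: ev; rewrite b0 scale0r addr0 scaler_eq0 (negPf n1) orbF => /eqP ->.
pose U : {vspace 'M[K]_(p, 3)} := (<[t1]> + <[t2]>)%VS.
have UP r : r \in U -> exists a b, r = a *: t1 + b *: t2.
  by case/memv_addP => _ /vlineP [a ->] [_ /vlineP [b ->] ->]; exists a, b.
have [tU|tU] := boolP (t \in U).
  by have [a [b ->]] := UP _ tU; rewrite mulmxDl -!scalemxAl memvD // memvZ.
have UT : (U <= T)%VS by rewrite subv_add -!memvE ht1.
have dU : (dm T <= dm U + 1)%N.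
  rewrite dT addn1 ltnS; apply/dim_gt1P; exists t1, t2.
  by split=> //; [rewrite memvE addvSl | rewrite memvE addvSr].
have split := hyperplane_split UT dU ht tU.
have [_ /UP [a [b ->]] [c etv]] := split _ htv.
have e0 : a *: (t1 *m v) + b *: (t2 *m v) + c *: (t *m v) = 0.
  by rewrite !scalemxAl -!mulmxDl -etv.
have [c0|c0] := eqVneq c 0; last first.
  rewrite -[t *m v](scalerK c0) memvZ //.
  have -> : c *: (t *m v) = - (a *: (t1 *m v) + b *: (t2 *m v)).
    by apply/eqP; rewrite -addr_eq0 addrC e0.
  by rewrite memvN memvD // memvZ.
rewrite c0 scale0r addr0 in e0; rewrite c0 scale0r addr0 in etv.
have b0 : b != 0.
  apply/eqP => b0; move/eqP: e0; rewrite b0 scale0r addr0 scaler_eq0 (negPf n1) orbF => /eqP a0.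
  by case/negP: tv0; rewrite etv a0 b0 !scale0r addr0.
have e2 : t2 *m v = - (b^-1 * a) *: (t1 *m v).
  apply: (scalerI b0); rewrite scalerA mulrN mulrA mulfV // mul1r scaleNr.
  by apply/eqP; rewrite -addr_eq0 addrC e0.
have : (dm (Sx T y) <= dm <[t1 *m v]>%VS)%N.
  apply: dmS; apply/subvP => _ /SxP [r hr ->].
  have [_ /UP [a' [b' ->]] [c' ->]] := split _ hr.
  rewrite !mulmxDl -!scalemxAl ty scaler0 addr0 E1 E2 e2 !scalerA -scalerDl memvZ //.
  exact: memv_line.
by move=> h; have := leq_trans gy (leq_trans h (dm_vline _)).
Qed.

Definition planar_T := exists z1 z2 : 'cV[K]_p, lindep2 z1 z2 /\
  forall t, t \in T -> exists g1 g2 : 'rV[K]_3, t = z1 *m g1 + z2 *m g2.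

Lemma planar_of_generic (u v : 'cV[K]_p) (B : 'cV[K]_3 -> Prop) : lindep2 u v -> spans B ->
  (forall t y, t \in T -> B y -> t *m y \in (<[u]> + <[v]>)%VS) -> planar_T.
Proof.
move=> uv sB h; exists u, v; split=> // t ht; apply: (col_rank2 uv).
by apply: (spans_mem sB) => y; apply: h.
Qed.

(** Elements killing a generic [v] and [v + c y] combine into one that kills [y] and takes a
    prescribed value of [T y] at [v]. Three of these, at [v1], [v2] and [v1 + c v2], show that the
    elements killing [y] have their images in one plane. For generic [v], any [t] can be corrected
    by an element killing [v] so as to kill [y], which leaves [t v] unchanged. *)
Lemma bad_planar y : out y -> (dm (Sx T y) <= 1)%N -> planar_T.
Proof.
move=> oy by1; have y0 := out_neq0 oy; have [_ yPi] := andP oy.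
have [u eu] := dim_le1 by1.
pose gen v := (v \notin (<[l]> + <[y]>)%VS) /\ (v \notin Pi).
have yN v : gen v -> forall t, t \in T -> t != 0 -> t *m v = 0 -> t *m y != 0.
  move=> [v1 v2] t ht t0 tv; apply: contra t0 => /eqP ty; apply/eqP.
  by have [_ yv] := generic_out v1 v2 y0; apply: (kill2 ht yPi yv).
have lift v : gen v -> forall t, t \in T -> exists r, [/\ r \in T, r *m y = 0 & r *m v = t *m y].
  move=> gv t ht; have [v1 v2] := gv; have [ov yv] := generic_out v1 v2 y0.
  have hA A : A \in [:: Pi] -> ~~ ((v \in A) && (y \in A)).
    by rewrite inE => /eqP ->; rewrite negb_and v2.
  have [c hc hcP] := line_avoid (As := [:: Pi]) uks isT hA; have {}hcP := hcP Pi (mem_head _ _).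
  have c0 := ks_neq0 hc.
  have oc : out (v + c *: y).
    rewrite /out hcP andbT; apply: contra v1 => h.
    by rewrite -(addrK (c *: y) v) memv_add // memvN memvZ // memv_line.
  have [tv [htv tv0 tvv]] := kernel_ex ov; have [tc [htc tc0 tcc]] := kernel_ex oc.
  have Y1 := yN v gv tv htv tv0 tvv.
  have ycv : lindep2 y (v + c *: y) by apply: (lindep2_addr c0); apply: lindep2_sym.
  have Y2 : tc *m y != 0.
    by apply: contra tc0 => /eqP ty; apply/eqP; apply: (kill2 htc yPi ycv).
  have line s : s \in T -> exists k, s *m y = k *: u.
    by move=> hs; apply/vlineP; rewrite -eu mem_Sx.
  have [k1 ek1] := line _ htv; have [k2 ek2] := line _ htc; have [k ek] := line _ ht.
  have k10 : k1 != 0 by apply: contraNneq Y1 => k0; rewrite ek1 k0 scale0r.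
  have k20 : k2 != 0 by apply: contraNneq Y2 => k0; rewrite ek2 k0 scale0r.
  have tcv : tc *m v = - (c * k2) *: u.
    move: tcc; rewrite mulmxDr -scalemxAr ek2 scalerA => /eqP.
    by rewrite addr_eq0 scaleNr => /eqP.
  pose r := tc - (k2 / k1) *: tv; pose s := - (c * k2)^-1 * k.
  have ck : c * k2 != 0 by rewrite mulf_neq0.
  exists (s *: r); split; first by rewrite memvZ // memvB // memvZ.
    by rewrite -scalemxAl mulmxBl -scalemxAl ek1 ek2 scalerA divfK // subrr scaler0.
  rewrite -scalemxAl mulmxBl -scalemxAl tvv scaler0 subr0 tcv scalerA ek; congr (_ *: _).
  have -> : s * - (c * k2) = k * ((c * k2)^-1 * (c * k2)) by rewrite /s; ring.
  by rewrite mulVf // mulr1.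
have [v1 [gv1a gv1b]] : exists v, gen v.
  have [|v _ hv] := @avoid_subspaces _ _ fullv [:: (<[l]> + <[y]>)%VS; Pi] ks uks isT.
    move=> A; rewrite !inE => /orP [] /eqP ->; apply/negP => /dmS; rewrite dmf muln1 leqNgt.
      by rewrite dm_add_lines.
    by rewrite ltnS dPi.
  by exists v; split; apply: hv; rewrite !inE eqxx ?orbT.
have gv1 : gen v1 by [].
have [ov1 yv1] := generic_out gv1a gv1b y0.
have [v2 gv2 v2n] : exists2 v, gen v & v \notin (<[y]> + <[v1]>)%VS.
  have [|v _ hv] := @avoid_subspaces _ _ fullv [:: (<[l]> + <[y]>)%VS; Pi; (<[y]> + <[v1]>)%VS] ks uks isT.
    move=> A; rewrite !inE => /or3P [] /eqP ->; apply/negP => /dmS; rewrite dmf muln1 leqNgt ?dm_add_lines //.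
    by rewrite ltnS dPi.
  by exists v; [split|]; apply: hv; rewrite !inE eqxx ?orbT.
have i3 := lindep3_notin yv1 v2n.
have [tv [htv tv0 tvv]] := kernel_ex ov1; have tvy := yN _ gv1 _ htv tv0 tvv.
have [r1 [hr1 r1y r1v]] := lift _ gv1 _ htv; have [r2 [hr2 r2y r2v]] := lift _ gv2 _ htv.
set u' := tv *m y in tvy r1v r2v.
have hA A : A \in [:: (<[l]> + <[y]>)%VS; Pi] -> ~~ ((v1 \in A) && (v2 \in A)).
  by rewrite !inE => /orP [] /eqP ->; rewrite negb_and ?gv1a ?gv1b.
have [c hc hcA] := line_avoid (As := [:: (<[l]> + <[y]>)%VS; Pi]) uks isT hA; have c0 := ks_neq0 hc.
have gv3 : gen (v1 + c *: v2) by split; apply: hcA; rewrite !inE eqxx ?orbT.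
have [r3 [hr3 r3y r3v]] := lift _ gv3 _ htv; rewrite -/u' in r3v.
have iy v : lindep2 y v -> forall r, r \in T -> r *m y = 0 -> r *m v = 0 -> r = 0.
  by move=> yv r hr ry rv; apply: (kill2 hr yPi yv).
have ycomb a b : (a, b) != (0, 0) -> lindep2 y (a *: v1 + b *: v2).
  move=> ab s t e; have [] := i3 s (t * a) (t * b); first by rewrite -e; cvring.
  move=> -> /eqP e1 /eqP e2; split=> //; apply/eqP; apply: contraNT ab => t0.
  by move: e1 e2; rewrite !mulf_eq0 (negPf t0) /= => /eqP -> /eqP ->.
have u'0 : u' != 0 := tvy.
have r10 : r1 != 0 by apply: contraNneq u'0 => e; rewrite -r1v e mul0mx.
pose q := r1 *m v2; pose q' := r2 *m v1.
have uq : lindep2 u' q.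
  apply: lindep2_notin => //; apply/negP => /vlineP [k ek].
  case/negP: r10; apply/eqP; apply: (iy ((- k) *: v1 + 1 *: v2)) => //.
    by apply: ycomb; rewrite xpair_eqE oner_eq0 andbF.
  by rewrite mulmxDr -!scalemxAr r1v -/q ek scale1r scaleNr addNr.
pose Ty : {vspace 'M[K]_(p, 3)} := (T :&: lker (linfun (mulmxr y)))%VS.
have TyP r : (r \in Ty) = (r \in T) && (r *m y == 0) by rewrite memv_cap (memv_ker (linfun (mulmxr y))) lfunE.
have dTy : (dm Ty + dm (Sx T y))%N = dm T := dm_img (linfun (mulmxr y)) T.
have TyT r : r \in T -> r *m y = 0 -> r \in Ty by move=> h1 h2; rewrite TyP h1 h2 eqxx.
have dSy : dm (Sx T y) = 1%N.
  apply/eqP; rewrite eqn_leq by1 lt0n dimv_eq0; apply/eqP => e0; case/negP: u'0.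
  by rewrite -memv0 -e0 mem_Sx.
have ind12 : lindep2 r1 r2.
  apply: lindep2_notin => //; apply/negP => /vlineP [k ek].
  have k0 : k *: q = u' by rewrite -r2v ek -scalemxAl.
  have [] := uq (-1) k; first by rewrite k0 scaleN1r addNr.
  by move=> /eqP; rewrite oppr_eq0 oner_eq0.
have Tyin r : r \in Ty -> exists a b, r = a *: r1 + b *: r2.
  have -> : Ty = (<[r1]> + <[r2]>)%VS; last first.
    by case/memv_addP => _ /vlineP [a ->] [_ /vlineP [b ->] ->]; exists a, b.
  apply/esym/eqP; rewrite eqEdim subv_add -!memvE !TyT // andTb -[\dim Ty]/(dm Ty).
  have -> : dm Ty = 2%N by move: dTy; rewrite dSy dT addn1 => -[].
  apply/dim_gt1P; exists r1, r2; split=> //; first by rewrite memvE addvSl.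
  by rewrite memvE addvSr.
(* [r3] is a combination of [r1] and [r2]; its value at [v1 + c v2] is a linear relation in which
   [q'] has a nonzero coefficient. *)
have q'P : q' \in (<[u']> + <[q]>)%VS.
  have [a [b er]] := Tyin r3 (TyT _ hr3 r3y).
  have e : a *: u' + (c * a) *: q + b *: q' + (c * b) *: u' = u'.
    rewrite -[RHS]r3v er mulmxDl -!scalemxAl !mulmxDr -!scalemxAr r1v r2v -/q -/q'.
    by cvring.
  have b0 : b != 0.
    apply/eqP => b0; move: e; rewrite b0 mulr0 !scale0r !addr0 => e.
    have [] := uq (a - 1) (c * a); first by rewrite scalerBl scale1r addrAC e subrr.
    move=> a1 /eqP; rewrite mulf_eq0 (negPf c0) /= => /eqP a0; move/eqP: a1.
    by rewrite a0 sub0r oppr_eq0 oner_eq0.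
  rewrite -[q'](scalerK b0) memvZ //.
  have -> : b *: q' = (1 - a - c * b) *: u' + (- (c * a)) *: q.
    apply: (@addrI _ (a *: u' + (c * a) *: q + (c * b) *: u')).
    have -> : a *: u' + (c * a) *: q + (c * b) *: u' + b *: q' = u' by rewrite -[RHS]e addrAC.
    by cvring.
  exact: mem_plane.
have Tyv r v : r \in Ty -> r *m v \in (<[u']> + <[q]>)%VS.
  move=> /Tyin [a [b ->]]; have [k1 [k2 [k3 ->]]] := span3 v i3.
  have U1 : u' \in (<[u']> + <[q]>)%VS by rewrite memvE addvSl.
  have U2 : q \in (<[u']> + <[q]>)%VS by rewrite memvE addvSr.
  rewrite mulmxDl -!scalemxAl !mulmxDr -!scalemxAr r1y r2y r1v r2v -/q -/q'.
  by rewrite !scaler0 !add0r !memvD // memvZ // memvD // memvZ.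
apply: (@planar_of_generic u' q gen uq (@generic_spans y)) => t v ht gv.
have [gva gvb] := gv; have [ov yv] := generic_out gva gvb y0.
have [t' [ht' t'0 t'v]] := kernel_ex ov; have t'y := yN _ gv _ ht' t'0 t'v.
have /vlineP [k ek] : t' *m y \in <[u]>%VS by rewrite -eu mem_Sx.
have /vlineP [k' ek'] : t *m y \in <[u]>%VS by rewrite -eu mem_Sx.
have k0 : k != 0 by apply: contraNneq t'y => k0; rewrite ek k0 scale0r.
have -> : t *m v = (t - (k' / k) *: t') *m v.
  by rewrite mulmxBl -scalemxAl t'v scaler0 subr0.
apply: Tyv; apply: TyT; first by rewrite memvB // memvZ.
by rewrite mulmxBl -scalemxAl ek ek' scalerA divfK // subrr.
Qed.

Lemma lindep3_swap12 (V : lmodType K) (a b c : V) : lindep3 a b c -> lindep3 b a c.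
Proof. by move=> h r s t; rewrite (addrC (r *: _)) => /h []. Qed.

Lemma lindep3_swap23 (V : lmodType K) (a b c : V) : lindep3 a b c -> lindep3 a c b.
Proof. by move=> h r s t; rewrite addrAC => /h []. Qed.

Lemma lindep3_2 (V : lmodType K) (a b c : V) : lindep3 a b c -> lindep2 a b.
Proof. by move=> h r s e; case: (h r s 0); rewrite ?scale0r ?addr0. Qed.

Lemma kernel_lindep t (y u v : 'cV[K]_3) : t \in T -> t != 0 -> out y -> t *m y = 0 ->
  lindep3 y u v -> lindep2 (t *m u) (t *m v).
Proof.
move=> ht t0 /andP [_ yPi] ty i3 a b e.
suff h : ~~ ((a != 0) || (b != 0)) by move: h; rewrite negb_or !negbK => /andP [/eqP -> /eqP ->].
apply: contra t0 => ab; apply/eqP; apply: (@kill2 t y (a *: u + b *: v)) => //.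
  move=> r s e'; have [] := i3 r (s * a) (s * b); first by rewrite -e'; cvring.
  move=> -> /eqP; rewrite mulf_eq0 => /orP [/eqP -> //|/eqP a0].
  move=> /eqP; rewrite mulf_eq0 => /orP [/eqP -> //|/eqP b0].
  by move: ab; rewrite a0 b0 eqxx.
by rewrite mulmxDr -!scalemxAr.
Qed.

Lemma plane_eq n (R : {vspace 'cV[K]_n}) a b : dm R = 2%N -> a \in R -> b \in R ->
  lindep2 a b -> R = (<[a]> + <[b]>)%VS.
Proof.
move=> dR aR bR i; apply/esym/eqP; rewrite eqEdim subv_add -!memvE aR bR /=.
by have := dm_plane2 i; rewrite /dm => ->; rewrite -[\dim R]/(dm R) dR.
Qed.

Lemma plane_cap_line n (R R' : {vspace 'cV[K]_n}) a b : dm R = 2%N -> dm R' = 2%N ->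
  ~~ (R' <= R)%VS -> a \in R -> a \in R' -> b \in R -> b \in R' -> a != 0 -> b != 0 ->
  exists2 c, c != 0 & a = c *: b.
Proof.
move=> dR dR' nle aR aR' bR bR' a0 b0.
have /vlineP [c ec] : a \in <[b]>%VS.
  apply: contraT => h; have i := lindep2_notin b0 h; case/negP: nle.
  by rewrite (plane_eq dR bR aR i) (plane_eq dR' bR' aR' i).
by exists c => //; apply: contraNneq a0 => c0; rewrite ec c0 scale0r.
Qed.

(** If [T] is not planar, generic [T y] are planes. By [image_kernel], an element killing one basis
    vector sends another into the intersection of their two planes, a line; so three elements
    killing [y0], [y1], [y2] have, up to scalars, the values of the basic alternating matrices,
    whose annihilator is the space of symmetric ones. *)
Lemma planar_or_type3 : 2%N \in [pchar K] -> planar_T \/ type3 S.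
Proof.
move=> ch2; have [pl|npl] := classic planar_T; [by left|right].
have d2 y : out y -> dm (Sx T y) = 2%N.
  move=> oy; apply/eqP; rewrite eqn_leq HQ //= ltnNge; apply/negP => h; apply: npl.
  exact: bad_planar oy h.
have gd y : out y -> (1 < dm (Sx T y))%N by move=> /d2 ->.
have im := fun y t oy => @image_kernel y t oy (gd y oy).
have mS t y : t \in T -> t *m y \in Sx T y by apply: mem_Sx.
have pick (A : {vspace 'cV[K]_3}) : (dm A < 3)%N -> exists2 y, out y & y \notin A.
  move=> dA; have [|v _ hv] := @avoid_subspaces _ _ fullv [:: <[l]>%VS; Pi; A] ks uks isT.
    move=> A'; rewrite !inE => /or3P [] /eqP ->; apply/negP => /dmS; rewrite dmf muln1 leqNgt ?dA //.
      by apply/negP; rewrite negbK; apply: leq_ltn_trans (dm_vline l) _.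
    by rewrite ltnS dPi.
  exists v; last by apply: hv; rewrite !inE eqxx !orbT.
  by rewrite /out !hv // !inE eqxx ?orbT.
have [y0 o0 _] : exists2 y, out y & y \notin (0%VS : {vspace 'cV[K]_3}).
  by apply: pick; rewrite [dm _]dimv0.
have y00 := out_neq0 o0.
have [y1 o1 n10] : exists2 y, out y & ~~ (Sx T y <= Sx T y0)%VS.
  apply: NNPP => h; apply: npl.
  have /dim_gt1P [a [b [aR bR ab]]] := gd _ o0.
  apply: (@planar_of_generic a b out ab) => [|t y ht oy].
    move=> W hW; apply: (@spans_avoid _ [:: <[l]>%VS; Pi] ks uks) => //.
      move=> A; rewrite !inE => /orP [] /eqP ->; first exact: leq_ltn_trans (dm_vline l) _.
      by rewrite ltnS.
    by move=> v hv; apply: hW; rewrite /out !hv // !inE eqxx ?orbT.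
  rewrite -(plane_eq (d2 _ o0) aR bR ab).
  have le : (Sx T y <= Sx T y0)%VS by apply: contraT => nle; case: h; exists y.
  by apply: (subvP le); apply: mS.
have [t0 [ht0 t00 t0y0]] := kernel_ex o0; have [s1 [hs1 s10 s1y1]] := kernel_ex o1.
have i01 : lindep2 y0 y1.
  apply: lindep2_notin => //; apply: contra n10 => /vlineP [k ->].
  by apply/subvP => _ /SxP [s hs ->]; rewrite -scalemxAr memvZ // mS.
have [_ P0] := andP o0; have [_ P1] := andP o1.
set w2 := t0 *m y1; have w20 : w2 != 0.
  by apply: contra t00 => /eqP e; apply/eqP; apply: (kill2 ht0 P0 i01).
have s1y0 : s1 *m y0 != 0.
  by apply: contra s10 => /eqP e; apply/eqP; apply: (kill2 hs1 P1 (lindep2_sym i01)).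
have [c c0 ec] : exists2 c, c != 0 & w2 = c *: (s1 *m y0).
  apply: (plane_cap_line (d2 _ o0) (d2 _ o1) n10) => //; first exact: im.
  - exact: mS.
  - exact: mS.
  exact: im.
pose t1 := (- c) *: s1; have ht1 : t1 \in T by apply: memvZ.
have t1y0 : t1 *m y0 = - w2 by rewrite -scalemxAl scaleNr -ec.
have t1y1 : t1 *m y1 = 0 by rewrite -scalemxAl s1y1 scaler0.
have t10 : t1 != 0 by rewrite scaler_eq0 oppr_eq0 negb_or c0.
clearbody t1.
have [y2 o2 n2] := pick _ (dm_add_lines y0 y1).
have i3 := lindep3_notin i01 n2.
have [t2' [ht2' t2'0 t2'y2]] := kernel_ex o2.
set w1 := t0 *m y2; set w0 := t1 *m y2.
have i21 : lindep2 w2 w1 := kernel_lindep ht0 t00 o0 t0y0 i3.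
have i20 : lindep2 w2 w0.
  have h := kernel_lindep ht1 t10 o1 t1y1 (lindep3_swap12 i3); rewrite t1y0 -/w0 in h.
  move=> a b e; have [] := h (- a) b; first by rewrite scalerN scaleNr opprK.
  by move=> /eqP; rewrite oppr_eq0 => /eqP.
have R0 : Sx T y0 = (<[w2]> + <[w1]>)%VS by apply: plane_eq; rewrite ?d2 //; apply: im.
have R1 : Sx T y1 = (<[w2]> + <[w0]>)%VS.
  apply: plane_eq; rewrite ?d2 //; first exact: mS.
  by apply: im.
have w0n : w0 \notin (<[w2]> + <[w1]>)%VS.
  apply: contra n10 => h; rewrite R0 R1 subv_add -!memvE h andbT memvE addvSl //.
have w3 := lindep3_notin i21 w0n.
have i10 : lindep2 w1 w0 := lindep3_2 (lindep3_swap23 (lindep3_swap12 w3)).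
have R2 : Sx T y2 = (<[w1]> + <[w0]>)%VS by apply: plane_eq; rewrite ?d2 //; apply: mS.
have w10 := lindep2_neq0 i10; have w00 := lindep2_neq0 (lindep2_sym i10).
have [_ P2] := andP o2.
have y2i0 : lindep2 y2 y0 := lindep2_sym (lindep3_2 (lindep3_swap23 i3)).
have y2i1 : lindep2 y2 y1 := lindep2_sym (lindep3_2 (lindep3_swap23 (lindep3_swap12 i3))).
have [c' c'0 ec'] : exists2 c, c != 0 & t2' *m y0 = c *: w1.
  apply: (plane_cap_line (d2 _ o0) (d2 _ o2)) => //.
  - by apply: contra w0n => /subvP h; rewrite -R0; apply: h; apply: mS.
  - exact: mS.
  - exact: im.
  - exact: im.
  - exact: mS.
  by apply: contra t2'0 => /eqP e; apply/eqP; apply: (kill2 ht2' P2 y2i0).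
pose t2 := (- c'^-1) *: t2'; have ht2 : t2 \in T by apply: memvZ.
have t2y0 : t2 *m y0 = - w1 by rewrite -scalemxAl ec' scalerA mulNr mulVf // scaleN1r.
have t2y2 : t2 *m y2 = 0 by rewrite -scalemxAl t2'y2 scaler0.
have t20 : t2 != 0 by rewrite scaler_eq0 oppr_eq0 invr_eq0 negb_or c'0.
clearbody t2.
have [e e0 ee] : exists2 c, c != 0 & t2 *m y1 = c *: w0.
  apply: (plane_cap_line (d2 _ o1) (d2 _ o2)) => //.
  - apply/negP => /subvP h; have : w1 \in (<[w2]> + <[w0]>)%VS by rewrite -R1; apply: h; apply: mS.
    move=> /in_plane [a [b eab]]; have [] := w3 a (-1) b.
      by rewrite eab scaleN1r addrAC subrr.
    by move=> _ /eqP; rewrite oppr_eq0 oner_eq0.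
  - exact: mS.
  - exact: im.
  - by apply: im.
  - exact: mS.
  by apply: contra t20 => /eqP e'; apply/eqP; apply: (kill2 ht2 P2 y2i1).
pose U : {vspace 'M[K]_(p, 3)} := (<[t0]> + <[t1]>)%VS.
have UP r : r \in U -> exists a b, r = a *: t0 + b *: t1.
  by case/memv_addP => _ /vlineP [a ->] [_ /vlineP [b ->] ->]; exists a, b.
have it : lindep2 t0 t1.
  move=> a b eab; have := congr1 (mulmx^~ y0) eab; have := congr1 (mulmx^~ y1) eab.
  rewrite /= !mul0mx !mulmxDl -!scalemxAl t0y0 t1y1 t1y0 !scaler0 addr0 add0r -/w2.
  move/eqP; rewrite scaler_eq0 (negPf w20) orbF => /eqP ->.
  by move/eqP; rewrite scaler_eq0 oppr_eq0 (negPf w20) orbF => /eqP ->.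
have t2U : t2 \notin U.
  apply/negP => /UP [a [b eab]]; case/negP: t20.
  have := t2y2; rewrite {1}eab mulmxDl -!scalemxAl -/w1 -/w0 => /i10 [a0 b0].
  by rewrite eab a0 b0 !scale0r addr0.
have UT : (U <= T)%VS by rewrite subv_add -!memvE ht0.
have dU : (dm T <= dm U + 1)%N.
  rewrite dT addn1 ltnS; apply/dim_gt1P; exists t0, t1.
  by split=> //; [rewrite memvE addvSl | rewrite memvE addvSr].
have Tgen r : r \in T -> exists a b c, r = a *: t0 + b *: t1 + c *: t2.
  by move=> hr; have [_ /UP [a [b ->]] [k ->]] := hyperplane_split UT dU ht2 t2U hr; exists a, b, k.
have outadd y v : out y -> exists2 k, k != 0 & out (y + k *: v).
  move=> /andP [h1 h2]; have hA A : A \in [:: <[l]>%VS; Pi] -> ~~ ((y \in A) && (v \in A)).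
    by rewrite !inE => /orP [] /eqP ->; rewrite negb_and ?h1 ?h2.
  have [k hk hkA] := line_avoid (As := [:: <[l]>%VS; Pi]) uks isT hA.
  by exists k; [exact: ks_neq0 | rewrite /out !hkA // !inE eqxx ?orbT].
(* Rescaling has fixed every value but [e]; an element killing a fourth generic point
   [y0 + mu y1 + nu y2] determines it. *)
have e1 : e = -1.
  have [mu mu0 o01] := outadd y0 y1 o0; have [nu nu0 o3] := outadd _ y2 o01.
  have [t3 [ht3 t30 t3y]] := kernel_ex o3; have [a [b [k et3]]] := Tgen _ ht3.
  have [] := w3 (a * mu - b) (a * nu - k) (b * nu + k * mu * e).
    rewrite -t3y et3 !mulmxDl -!scalemxAl !mulmxDr -!scalemxAr t0y0 t1y0 t1y1 t2y0 t2y2 ee.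
    rewrite -/w2 -/w1 -/w0; cvring.
  move=> /eqP; rewrite subr_eq0 => /eqP eb /eqP; rewrite subr_eq0 => /eqP ek.
  have a0 : a != 0.
    by apply: contraNneq t30 => a0; rewrite et3 -eb -ek a0 !mul0r !scale0r !addr0.
  rewrite -eb -ek => /eqP.
  have -> : a * mu * nu + a * nu * mu * e = (a * mu * nu) * (1 + e) by ring.
  rewrite mulf_eq0 !mulf_eq0 (negPf a0) (negPf mu0) (negPf nu0) /= addrC addr_eq0.
  by move/eqP.
have N v : - v = v :> 'cV[K]_p.
  apply/colP => i; rewrite mxE; exact: oppr_pchar2.
rewrite e1 scaleN1r N in ee; rewrite N in t1y0; rewrite N in t2y0.
have [f fY] := leftinv_col3 i3; have Yf := mulmx1C fY.
have [uf _] := mulmx1_unit fY.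
have w012 : lindep3 w0 w1 w2 := lindep3_swap12 (lindep3_swap23 (lindep3_swap12 w3)).
have [z zZ] := leftinv_col3 w012; set Z := col3 w0 w1 w2 in zZ.
pose dl (i : 'I_3) : 'cV[K]_3 := delta_mx i 0.
have Zd : [/\ Z *m dl 0 = w0, Z *m dl 1 = w1 & Z *m dl 2 = w2].
  by rewrite !col3_mul !mxE /= !scale1r !scale0r !addr0 !add0r.
have [Z0 Z1 Z2] := Zd.
have E t a b c'' : t *m y0 = Z *m a -> t *m y1 = Z *m b -> t *m y2 = Z *m c'' ->
    t = Z *m col3 a b c'' *m f.
  move=> h1 h2 h3; rewrite mul_col3 -h1 -h2 -h3 -mul_col3 -mulmxA Yf mulmx1 //.
have E0 : t0 = Z *m col3 0 (dl 2) (dl 1) *m f by apply: E; rewrite ?mulmx0 ?Z1 ?Z2.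
have E1 : t1 = Z *m col3 (dl 2) 0 (dl 0) *m f by apply: E; rewrite ?mulmx0 ?Z0 ?Z2.
have E2 : t2 = Z *m col3 (dl 1) (dl 0) 0 *m f by apply: E; rewrite ?mulmx0 ?Z1 ?Z0.
have trE C M : \tr (Z *m C *m f *m M) = \tr (C *m (f *m M *m Z)).
  by rewrite -!mulmxA mxtrace_mulC !mulmxA.
apply: (type3_intro ch2 uf zZ) => M; set G := f *m M *m Z.
have tr0 : \tr (t0 *m M) = G 1 2 + G 2 1.
  rewrite E0 trE -/G /mxtrace !big_ord_recl big_ord0 !mxE !big_ord_recl !big_ord0 !mxE /= !lift3.
  ring.
have tr1 : \tr (t1 *m M) = G 0 2 + G 2 0.
  rewrite E1 trE -/G /mxtrace !big_ord_recl big_ord0 !mxE !big_ord_recl !big_ord0 !mxE /= !lift3.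
  ring.
have tr2 : \tr (t2 *m M) = G 0 1 + G 1 0.
  rewrite E2 trE -/G /mxtrace !big_ord_recl big_ord0 !mxE !big_ord_recl !big_ord0 !mxE /= !lift3.
  ring.
have eqadd (a b : K) : (a + b == 0) = (a == b) by rewrite addr_eq0 oppr_pchar2.
split=> [hM|sG].
  have trM t : t \in T -> \tr (t *m M) = 0 by move=> /orthP; apply.
  have g12 : G 1 2 = G 2 1 by apply/eqP; rewrite -eqadd -tr0 trM.
  have g02 : G 0 2 = G 2 0 by apply/eqP; rewrite -eqadd -tr1 trM.
  have g01 : G 0 1 = G 1 0 by apply/eqP; rewrite -eqadd -tr2 trM.
  by apply/matrixP => i j; rewrite mxE; case: (ord3P i) => ->; case: (ord3P j) => ->.
have sG' i j : G i j = G j i by rewrite -{1}sG mxE.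
have zz i j : G i j + G j i = 0 by apply/eqP; rewrite eqadd sG'.
rewrite -(orthK S); apply/orthP => t /Tgen [a [b [k ->]]].
by rewrite mxtrace_mulC !mulmxDl -!scalemxAl !mxtraceD !mxtraceZ tr0 tr1 tr2 !zz !mulr0 !addr0.
Qed.
End Alternating.

(** * Targets of dimension at least four *)

Section Large.
Variable K : fieldType.

Lemma le2_of_sum (a b k n : nat) : (k < b)%N -> (a + b)%N = n -> (k + 3)%N = n -> (a <= 2)%N.
Proof. lia. Qed.

Lemma tr_delta n (G : 'M[K]_n) i j : \tr (delta_mx j i *m G) = G i j.
Proof.
rewrite /mxtrace (bigD1 j) //= big1 => [|k kj].
  rewrite mxE (bigD1 i) //= big1 => [|k ki]; first by rewrite !mxE !eqxx mul1r !addr0.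
  by rewrite mxE (negPf ki) andbF mul0r.
by rewrite mxE big1 // => m _; rewrite mxE (negPf kj) mul0r.
Qed.

(** The equations of the plane in the quotient pull back to [n - 3] independent functionals killing
    [y], and their products with either column lie in [orth S]. *)
Lemma quot_type2_data n m p (S : {vspace 'M[K]_(n, p)}) (C : 'M[K]_(m, n)) (y : 'cV[K]_n) :
  (m + 1)%N = n -> C *m y = 0 -> (forall k (f : 'M[K]_(k, m)), f *m C = 0 -> f = 0) ->
  type2 (quot C S) ->
  exists k (D : 'M[K]_(k, n)) (z1 z2 : 'cV[K]_p),
   [/\ (k + 3)%N = n, lindep2 z1 z2, D *m y = 0, forall g : 'rV[K]_k, g *m D = 0 -> g = 0 &
    forall g : 'rV[K]_k, z1 *m (g *m D) \in orth S /\ z2 *m (g *m D) \in orth S].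
Proof.
move=> em Cy inj /type2_elim [_ [k [Z [z [C2 [R [ek zZ CR h]]]]]]].
exists k, (C2 *m C), (Z *m delta_mx 0 0), (Z *m delta_mx 1 0); split.
- lia.
- move=> a b e; have : a *: delta_mx 0 0 + b *: delta_mx 1 0 = 0 :> 'cV[K]_2.
    by rewrite -[LHS]mul1mx -zZ -mulmxA mulmxDr -!scalemxAr e mulmx0.
  move=> /colP e2; have := e2 0; have := e2 1; rewrite !mxE /= !mulr1 !mulr0 addr0 add0r.
  by move=> -> ->.
- by rewrite -mulmxA Cy mulmx0.
- move=> g; rewrite mulmxA => /inj gC.
  by rewrite -[g]mulmx1 -CR mulmxA gC mul0mx.
move=> g; split; apply/orth_rank1P => s hs.
  by rewrite -!mulmxA (mulmxA C s) (mulmxA _ Z) (mulmxA C2) (mulmxA C2) h ?mem_quot // mul0mx mulmx0.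
by rewrite -!mulmxA (mulmxA C s) (mulmxA _ Z) (mulmxA C2) (mulmxA C2) h ?mem_quot // mul0mx mulmx0.
Qed.

Variables (n p : nat) (S : {vspace 'M[K]_(n, p)}) (l : 'cV[K]_n) (Pi : {vspace 'cV[K]_n}) (ks : seq K).
Hypotheses (n4 : (3 < n)%N) (uks : uniq ks) (sks : size ks = 4%N).
Hypothesis dPi : (dm Pi <= 2)%N.
Let out (y : 'cV[K]_n) := (y \notin <[l]>%VS) && (y \notin Pi).
Hypothesis HQ : forall y, out y -> (dm (Sx (orth S) y) <= 2)%N.

(** Type 3 puts [Z] times the alternating matrices times [D] in [orth S]. At a generic [y'] these
    already give a plane, the vectors [Z a] with [a] orthogonal to [D y'], which is therefore all of
    [T y']. So each [t] yields a quadratic form, with matrix [N], that vanishes at generic points;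
    comparing [v] and [v + y] gives [N y = 0], hence [t y = 0], although [T y] has dimension at
    least two. *)
Lemma quot_not_type3 m (C : 'M[K]_(m, n)) y : out y -> (1 < dm (Sx (orth S) y))%N ->
  C *m y = 0 -> (forall k (f : 'M[K]_(k, m)), f *m C = 0 -> f = 0) ->
  (forall v, C *m v = 0 -> exists a, v = a *: y) -> ~ type3 (quot C S).
Proof.
move=> oy gy Cy inj Ck /type3_elim [_ _ [f [g [Z [z [gf fg zZ sym]]]]]].
pose D := f *m C.
have Dy : D *m y = 0 by rewrite -mulmxA Cy mulmx0.
have Dk v : D *m v = 0 -> exists a, v = a *: y.
  move=> Dv; apply: Ck; rewrite -[C]mul1mx -gf -!mulmxA (mulmxA f) Dv mulmx0 //.
have Dinj (r : 'rV[K]_3) : r *m D = 0 -> r = 0.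
  by rewrite /D mulmxA => /inj rf; rewrite -[r]mulmx1 -fg mulmxA rf mul0mx.
have altT i j : Z *m (delta_mx j i - delta_mx i j) *m D \in orth S.
  apply/orthP => s hs; have sG := sym _ (mem_quot C hs); set G := f *m _ *m Z in sG.
  have -> : \tr (Z *m (delta_mx j i - delta_mx i j) *m D *m s) = \tr ((delta_mx j i - delta_mx i j) *m G).
    by rewrite /G /D -!mulmxA mxtrace_mulC !mulmxA.
  have sGij : G j i = G i j by rewrite -{1}sG mxE.
  by rewrite mulmxBl raddfB /= !tr_delta sGij subrr.
have key y' t : out y' -> y' \notin <[y]>%VS -> t \in orth S ->
    t *m y' = Z *m (z *m (t *m y')) /\ (D *m y')^T *m (z *m (t *m y')) = 0.
  move=> oy' ny' ht; set v := D *m y'.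
  have [i vi] : exists i, v i 0 != 0.
    apply: NNPP => h; case/negP: ny'; apply/vlineP; apply: Dk.
    by apply/colP => i; rewrite [RHS]mxE; apply: NNPP => /eqP hi; apply: h; exists i.
  have [j [k [ij ik jk]]] : exists j k : 'I_3, [/\ j != i, k != i & j != k].
    by case: (ord3P i) => ->; [exists 1, 2|exists 0, 2|exists 0, 1]; split.
  pose a (j : 'I_3) : 'cV[K]_3 := (delta_mx j i - delta_mx i j) *m v.
  have aE j' i' : a j' i' 0 = (i' == j')%:R * v i 0 - (i' == i)%:R * v j' 0.
    rewrite /a mulmxBl mxE [(- _ : 'cV_3) _ _]mxE; congr (_ - _).
      rewrite mxE (bigD1 i) //= big1 => [|q qi]; first by rewrite mxE eqxx andbT addr0.
      by rewrite mxE (negPf qi) andbF mul0r.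
    rewrite mxE (bigD1 j') //= big1 => [|q qi]; first by rewrite mxE eqxx andbT addr0.
    by rewrite mxE (negPf qi) andbF mul0r.
  have aT j' : Z *m a j' \in Sx (orth S) y'.
    have -> : Z *m a j' = Z *m (delta_mx j' i - delta_mx i j') *m D *m y' by rewrite /a /v !mulmxA.
    exact: mem_Sx (altT i j').
  clearbody a.
  have ind : lindep2 (Z *m a j) (Z *m a k).
    move=> r s e; have e2 : r *: a j + s *: a k = 0.
      by rewrite -[LHS]mul1mx -zZ -mulmxA mulmxDr -!scalemxAr e mulmx0.
    have e3 i' : r * a j i' 0 + s * a k i' 0 = 0.
      by have /colP /(_ i') := e2; rewrite !mxE.
    have := e3 j; have := e3 k; rewrite !aE !eqxx (negPf ij) (negPf ik) (negPf jk) eq_sym (negPf jk).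
    rewrite !mul0r !mul1r !subr0 !mulr0 add0r addr0 => /eqP; rewrite mulf_eq0 (negPf vi) orbF => /eqP ->.
    by move=> /eqP; rewrite mulf_eq0 (negPf vi) orbF => /eqP ->.
  have d2 : dm (Sx (orth S) y') = 2%N.
    apply/eqP; rewrite eqn_leq HQ //; apply/dim_gt1P; by exists (Z *m a j), (Z *m a k).
  have : t *m y' \in Sx (orth S) y' by apply: mem_Sx.
  rewrite (plane_eq d2 (aT j) (aT k) ind) => /in_plane [r [s ->]].
  have va j' : v^T *m a j' = 0.
    apply: mx11_eq; rewrite [RHS]mxE mxE.
    under eq_bigr do rewrite mxE aE mulrBr.
    rewrite sumrB (bigD1 j') //= big1 => [|q qj]; last by rewrite (negPf qj) mul0r mulr0.
    rewrite [X in _ - X](bigD1 i) //= [X in _ - (_ + X)]big1 => [|q qi]; last by rewrite (negPf qi) mul0r mulr0.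
    by rewrite !eqxx !mul1r !addr0 mulrC subrr.
  have zE : z *m (r *: (Z *m a j) + s *: (Z *m a k)) = r *: a j + s *: a k.
    by rewrite mulmxDr -!scalemxAr !mulmxA zZ !mul1mx.
  rewrite zE; split; first by rewrite mulmxDr -!scalemxAr.
  by rewrite mulmxDr -!scalemxAr !va !scaler0 addr0.
have dline (v : 'cV[K]_n) : (dm <[v]>%VS < n)%N.
  by apply: leq_ltn_trans (dm_vline v) _; apply: leq_trans n4.
have sp1 : spans (fun v => forall A, A \in [:: <[l]>%VS; Pi; <[y]>%VS] -> v \notin A).
  apply: (spans_avoid uks); first by rewrite sks.
  move=> A; rewrite !inE => /or3P [] /eqP -> //.
  by apply: leq_ltn_trans dPi _; apply: leq_trans n4.
have sp2 : spans (fun v => forall A, A \in [:: (<[l]> + <[y]>)%VS; (Pi + <[y]>)%VS] -> v \notin A).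
  apply: (spans_avoid uks); first by rewrite sks.
  move=> A; rewrite !inE => /orP [] /eqP ->.
    by apply: leq_ltn_trans (dm_plane _ _) _; apply: leq_trans n4.
  apply: leq_ltn_trans (dm_add _ _) _; apply: leq_trans n4; rewrite ltnS.
  exact: leq_add dPi (dm_vline y).
have kill t : t \in orth S -> t *m y = 0.
  move=> ht.
  have et : t = Z *m z *m t.
    apply/eqP; rewrite -subr_eq0; apply/eqP; apply: (spans_eq0 sp1) => v hv.
    have ov : out v by rewrite /out !hv // !inE eqxx ?orbT.
    have vy : v \notin <[y]>%VS by apply: hv; rewrite !inE eqxx !orbT.
    have [e _] := key v t ov vy ht.
    by rewrite mulmxBl {1}e -!mulmxA subrr.
  pose N := D^T *m (z *m t).
  have q v : out v -> v \notin <[y]>%VS -> v^T *m N *m v = 0.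
    move=> ov vy; have [_] := key v t ov vy ht.
    by rewrite trmx_mul /N -!mulmxA.
  have yN : y^T *m N = 0 by rewrite /N mulmxA -trmx_mul Dy trmx0 mul0mx.
  have Ny : N *m y = 0.
    apply: trmx_inj; rewrite trmx0; apply: (spans_eq0 sp2) => v hv.
    have h1 : v \notin (<[l]> + <[y]>)%VS by apply: hv; rewrite !inE eqxx.
    have h2 : v \notin (Pi + <[y]>)%VS by apply: hv; rewrite !inE eqxx orbT.
    have inl (A : {vspace 'cV[K]_n}) c : v \notin (A + <[y]>)%VS -> v + c *: y \notin A.
      apply: contra => h; rewrite -(addrK (c *: y) v) memv_add // memvN memvZ //.
      exact: memv_line.
    have vy c : v + c *: y \notin <[y]>%VS.
      apply: contra h1 => h; apply: (subvP (addvSr _ _)).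
      by rewrite -(addrK (c *: y) v) memvB // memvZ // memv_line.
    have o c : out (v + c *: y) by rewrite /out !inl.
    have q0 := q _ (o 0) (vy 0); have q1 := q _ (o 1) (vy 1).
    rewrite scale0r addr0 in q0; rewrite scale1r in q1.
    have : v^T *m (N *m y) = 0.
      move: q1; rewrite [(v + y)^T]linearD /= !mulmxDl !mulmxDr yN !mul0mx !addr0 q0 add0r.
      by rewrite -mulmxA.
    by move=> h; apply: trmx_inj; rewrite trmx_mul trmxK h trmx0.
  have zty : z *m t *m y = 0.
    apply: trmx_inj; rewrite trmx0; apply: Dinj; apply: trmx_inj; rewrite trmx0.
    by rewrite trmx_mul trmxK -Ny /N -!mulmxA.
  by rewrite et -!mulmxA (mulmxA z) zty mulmx0.
have : Sx (orth S) y = 0%VS.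
  by apply/eqP; rewrite -subv0; apply/subvP => _ /SxP [t ht ->]; rewrite kill // mem0v.
by move=> e; move: gy; rewrite e [dm _]dimv0.
Qed.

Hypothesis n2z : forall z1 z2, lindep2 z1 z2 ->
  (dm (Sx S z1) <= 2)%N -> (dm (Sx S z2) <= 2)%N -> False.
Hypothesis HX : forall y, out y -> (1 < dm (Sx (orth S) y))%N ->
  exists m (C : 'M[K]_(m, n)), (m + 1)%N = n /\
   [/\ C *m y = 0, forall k (f : 'M[K]_(k, m)), f *m C = 0 -> f = 0,
    forall v, C *m v = 0 -> exists a, v = a *: y & type2 (quot C S) \/ type3 (quot C S)].

Lemma good_type2 y : out y -> (1 < dm (Sx (orth S) y))%N ->
  exists k (D : 'M[K]_(k, n)) (z1 z2 : 'cV[K]_p),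
   [/\ (k + 3)%N = n, lindep2 z1 z2, D *m y = 0, forall g : 'rV[K]_k, g *m D = 0 -> g = 0 &
    forall g : 'rV[K]_k, z1 *m (g *m D) \in orth S /\ z2 *m (g *m D) \in orth S].
Proof.
move=> oy gy; have [m [C [em [Cy inj Ck [t2|t3]]]]] := HX oy gy.
  exact: quot_type2_data em Cy inj t2.
by case: (quot_not_type3 oy gy Cy inj Ck).
Qed.

(** As [n >= 4], there is a nonzero functional [f0] among the rows from [D]. For generic [v] with
    [f0 v] nonzero, [T v] is the plane of [z1] and [z2], so [T] maps into this plane. The Type 2
    data at such a [v] use the same plane with functionals killing [v]; adjoining [f0] bounds
    [dim S z1] and [dim S z2] by 2, against [n2z]. *)
Lemma large_no_good y : out y -> (dm (Sx (orth S) y) <= 1)%N.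
Proof.
move=> oy; rewrite leqNgt; apply/negP => gy.
have [k [D [z1 [z2 [ek ind Dy Dinj hD]]]]] := good_type2 oy gy.
have k0 : (0 < k)%N by lia.
pose g0 : 'rV[K]_k := delta_mx 0 (Ordinal k0); pose f0 := g0 *m D.
have f00 : f0 != 0.
  apply/eqP => /Dinj /matrixP /(_ 0 (Ordinal k0)) /eqP.
  by rewrite !mxE !eqxx oner_eq0.
have [hf1 hf2] := hD g0; rewrite -/f0 in hf1 hf2.
pose H : {vspace 'cV[K]_n} := lker (linfun (mulmx f0)).
have HP v : (v \in H) = (f0 *m v == 0) by rewrite memv_ker lfunE.
have dH : (dm H < n)%N.
  have le : (dm H <= n)%N by apply: leq_trans (dmS (subvf _)) _; rewrite dmf muln1.
  rewrite ltn_neqAle le andbT; apply: contra f00 => /eqP dH; apply/eqP.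
  apply: mulmx_cV_eq0 => v; apply/eqP; rewrite -HP.
  suff -> : H = fullv by apply: memvf.
  by apply/eqP; rewrite eqEdim subvf -[\dim fullv]/(dm fullv) dmf -[\dim H]/(dm H) dH muln1 leqnn.
have nf (A : {vspace 'cV[K]_n}) : (dm A < n)%N -> ~~ (fullv <= A)%VS.
  by move=> dA; apply/negP => /dmS; rewrite dmf muln1 leqNgt dA.
have dAs A : A \in [:: <[l]>%VS; Pi; H] -> (dm A < n)%N.
  rewrite !inE => /or3P [] /eqP -> //.
    by apply: leq_ltn_trans (dm_vline l) _; apply: leq_trans n4.
  by apply: leq_ltn_trans dPi _; apply: leq_trans n4.
have sp : spans (fun v => forall A, A \in [:: <[l]>%VS; Pi; H] -> v \notin A).
  by apply: (spans_avoid uks) dAs; rewrite sks.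
have outB v : (forall A, A \in [:: <[l]>%VS; Pi; H] -> v \notin A) -> out v /\ f0 *m v != 0.
  by move=> hv; rewrite -HP /out !hv // !inE eqxx ?orbT.
have zin (z : 'cV[K]_p) (f : 'rV[K]_n) v : z *m f \in orth S -> f *m v != 0 -> z \in Sx (orth S) v.
  move=> hz fv; have a0 : (f *m v) 0 0 != 0.
    by apply: contra fv => /eqP e; apply/eqP; apply: mx11_eq; rewrite e mxE.
  by rewrite -[z](scalerK a0) memvZ // -mul_cV1 mulmxA mem_Sx.
have plane v : out v -> f0 *m v != 0 -> Sx (orth S) v = (<[z1]> + <[z2]>)%VS.
  move=> ov fv; have i1 := zin _ _ _ hf1 fv; have i2 := zin _ _ _ hf2 fv.
  apply: (plane_eq _ i1 i2 ind).
  by apply/eqP; rewrite eqn_leq HQ //; apply/dim_gt1P; exists z1, z2.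
have TZ t v : t \in orth S -> t *m v \in (<[z1]> + <[z2]>)%VS.
  move=> ht; apply: (spans_mem sp) => v' /outB [ov fv].
  by rewrite -(plane _ ov fv) mem_Sx.
have [v _ hv] : exists2 v, v \in fullv & forall A, A \in [:: <[l]>%VS; Pi; H] -> v \notin A.
  apply: (avoid_subspaces uks); first by rewrite sks.
  by move=> A hA; apply: nf; apply: dAs.
have [ov fv] := outB v hv.
have gv : (1 < dm (Sx (orth S) v))%N by rewrite plane // dm_plane2.
have [k' [D' [w1 [w2 [ek' ind' Dv Dinj' hD']]]]] := good_type2 ov gv.
have k'0 : (0 < k')%N by lia.
pose g1 : 'rV[K]_k' := delta_mx 0 (Ordinal k'0); pose f1 := g1 *m D'.
have f10 : f1 != 0.
  apply/eqP => /Dinj' /matrixP /(_ 0 (Ordinal k'0)) /eqP.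
  by rewrite !mxE !eqxx oner_eq0.
have [v1 fv1] : exists v1 : 'cV[K]_n, f1 *m v1 != 0.
  apply: NNPP => h; case/negP: f10; apply/eqP; apply: mulmx_cV_eq0 => v1.
  by apply: NNPP => /eqP h'; apply: h; exists v1.
have win (w : 'cV[K]_p) : w *m f1 \in orth S -> w \in (<[z1]> + <[z2]>)%VS.
  move=> hw; have a0 : (f1 *m v1) 0 0 != 0.
    by apply: contra fv1 => /eqP e; apply/eqP; apply: mx11_eq; rewrite e mxE.
  by rewrite -[w](scalerK a0) memvZ // -mul_cV1 mulmxA TZ.
have [hw1 hw2] := hD' g1; have eP := plane_eq (dm_plane2 ind) (win _ hw1) (win _ hw2) ind'.
have small z : z \in (<[z1]> + <[z2]>)%VS -> z *m f0 \in orth S -> (dm (Sx S z) <= 2)%N.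
  rewrite eP => /in_plane [a [b ez]] zf.
  pose U : {vspace 'rV[K]_n} := (linfun (mulmxr D') @: (fullv : {vspace 'rV[K]_k'}))%VS.
  have dU : dm U = k'.
    rewrite -[RHS]mul1n -(dmf K); apply: dim_img_inj => g _; rewrite lfunE /=; exact: Dinj'.
  have fU : f0 \notin U.
    apply/negP => /memv_imgP [g _]; rewrite lfunE /= => e; case/negP: fv.
    by rewrite e -mulmxA Dv mulmx0.
  have UL : (U <= Lam (orth S) z)%VS.
    apply/subvP => _ /memv_imgP [g _ ->]; rewrite lfunE /= mem_Lam ez mulmxDl -!scalemxAl.
    by have [h1 h2] := hD' g; rewrite memvD // memvZ.
  have lt : (dm U < dm (Lam (orth S) z))%N.
    rewrite ltn_neqAle dmS // andbT; apply: contra fU => /eqP e.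
    suff -> : U = Lam (orth S) z by rewrite mem_Lam.
    by apply/eqP; rewrite eqEdim UL -[\dim _]/(dm _) -e leqnn.
  by rewrite dU in lt; apply: le2_of_sum lt (dim_Sx_Lam S z) ek'.
apply: (n2z ind); apply: small => //; first by rewrite memvE addvSl.
by rewrite memvE addvSr.
Qed.
End Large.

(** * Additive maps *)

Section NonHomogeneous.
Variable K : fieldType.

(** Off a line [l] the map induced modulo [y] stays non-homogeneous, and off a plane [Pi] the
    quotient does not acquire Type 1. Hence [rca_codim_2n4] excludes [dim T y >= 3], and for
    [dim T y = 2] the induction hypothesis leaves Types 2 and 3 for the quotient. *)
Lemma rca_nonhomog n p (S : {vspace 'M[K]_(n, p)}) F (x w : K) :
  uniq [:: 0; 1; x; w] -> (dm (orth S) + 3 <= 2 * n)%N -> rca S F -> ~ homog S F ->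
  type1 S \/ type2 S \/ type3 S.
Proof.
move=> uK; have [x0 x1] : x != 0 /\ x != 1.
  by move: uK; rewrite /= !inE !negb_or => /and4P [/and3P [_ h _] /andP [h' _] _ _]; rewrite eq_sym h eq_sym h'.
elim/ltn_ind: n p S F => n IH p S F hd hF nh; apply: NNPP => nG.
have nl : ~ islocal S F by move=> /islocal_homog.
have nt1 : ~ exists z, dm (Sx S z) = 1%N by move=> h; apply: nG; left.
have hz z : z != 0 -> (1 < dm (Sx S z))%N.
  move=> z0; rewrite ltnNge; apply/negP => d.
  have [//|[e _]] := rca_Sx_le1 hd z0 d hF; by apply: nt1; exists z.
have [n2|n2] := eqVneq n 2.
  subst n; have [//|[t2 _]] := rca_n2 x0 x1 hd hz hF; by apply: nG; right; left.
have n3 : (2 < n)%N by lia.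
have dT : (dm (orth S) + 3)%N = (2 * n)%N.
  have [d4|d3] := leqP (dm (orth S) + 4) (2 * n); last by lia.
  by have [|[]] := rca_codim_2n4 d4 hF.
have n2z z1 z2 : lindep2 z1 z2 -> (dm (Sx S z1) <= 2)%N -> (dm (Sx S z2) <= 2)%N -> False.
  move=> ind d1 d2; have [//|[t2 _]] := rca_two_planes n3 x0 x1 ind dT d1 d2 hz hF.
  by apply: nG; right; left.
pose lin y := forall a s, s \in S -> exists k : K, F (a *: s) - a *: F s = k *: y.
have [l hl] : exists l : 'cV[K]_n, forall y, y != 0 -> lin y -> y \in <[l]>%VS.
  have [h|] := classic (forall y : 'cV[K]_n, y != 0 -> ~ lin y); first by exists 0 => y /h.
  move=> /not_all_in [l l0 /NNPP ll]; exists l => y y0 ly; apply: contraT => yl.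
  case: nh => a s hs; have [k ek] := ll a s hs; have [k' ek'] := ly a s hs.
  have [] := lindep2_notin l0 yl (a := k) (b := - k'); first by rewrite scaleNr -ek ek' subrr.
  by move=> k0 _; apply/eqP; rewrite -subr_eq0 ek k0 scale0r.
have [Pi [dPi HPi]] : exists Pi : {vspace 'cV[K]_n}, (dm Pi <= 2)%N /\
    forall z, z != 0 -> (dm (Sx S z) <= 2)%N -> (Sx S z <= Pi)%VS.
  have [h|] := classic (forall z, z != 0 -> ~ (dm (Sx S z) <= 2)%N).
    by exists 0%VS; rewrite [dm _]dimv0; split=> // z /h.
  move=> /not_all_in [z0 z00 /NNPP d0]; exists (Sx S z0); split=> // z _ dz.
  have /vlineP [k ->] : z \in <[z0]>%VS.
    by apply: contraT => hn; case: (n2z z0 z) => //; apply: lindep2_notin.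
  by apply/subvP => _ /SxP [s hs ->]; rewrite -scalemxAr memvZ // mem_Sx.
pose out (y : 'cV[K]_n) := (y \notin <[l]>%VS) && (y \notin Pi).
have HX y : out y -> (dm (Sx (orth S) y) <= 2)%N /\ ((1 < dm (Sx (orth S) y))%N ->
  exists m (C : 'M[K]_(m, n)), (m + 1)%N = n /\
   [/\ C *m y = 0, forall k (f : 'M[K]_(k, m)), f *m C = 0 -> f = 0,
    forall v, C *m v = 0 -> exists a, v = a *: y & type2 (quot C S) \/ type3 (quot C S)]).
  move=> /andP [yl yPi]; have y0 : y != 0 by apply: contraNneq yl => ->; rewrite mem0v.
  have [m [C [F' [em [[hF' hC _ Cy hk] [hdq hinj _]]]]]] := quot_pack y0 hF.
  have nh' : ~ homog (quot C S) F'.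
    move=> hom; case/negP: yl; apply: (hl y y0) => a s hs; apply: hk.
    rewrite mulmxBr -scalemxAr -(hC _ (memvZ a hs)) -(hC _ hs) -scalemxAr.
    by rewrite (hom a _ (mem_quot C hs)) subrr.
  (* A line in the quotient by [y] comes from a plane [S z] through [y], and such a plane lies in
     [Pi]. *)
  have nt1' z : dm (Sx (quot C S) z) <> 1%N.
    move=> dz; have z0 := Sx1_neq0 dz; case/negP: yPi.
    have e : (dm (Sx S z :&: lker (linfun (mulmx C)))%VS + dm (linfun (mulmx C) @: Sx S z)%VS)%N
      = dm (Sx S z) := dm_img (linfun (mulmx C)) (Sx S z).
    have e' : (linfun (mulmx C) @: Sx S z)%VS = Sx (quot C S) z.
      apply/vspaceP => v; apply/memv_imgP/SxP.
        case=> _ /SxP [s hs ->] ->; exists (C *m s); first exact: mem_quot.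
        by rewrite lfunE /= mulmxA.
      case=> _ /in_quotP [s hs ->] ->; exists (s *m z); first exact: mem_Sx.
      by rewrite lfunE /= mulmxA.
    have hz' := hz z z0.
    have d2 : (dm (Sx S z) <= 2)%N.
      have := Lam_quot_le S z hinj; have := dim_Sx_Lam (quot C S) z; have := dim_Sx_Lam S z.
      lia.
    rewrite e' dz in e.
    have /subvPn [v] : ~~ (Sx S z :&: lker (linfun (mulmx C)) <= 0)%VS.
      apply/negP => /dmS; rewrite [dm 0%VS]dimv0 leqn0 => /eqP d0.
      by move: hz'; rewrite -e d0.
    rewrite memv_cap (memv_ker (linfun (mulmx C))) lfunE memv0 /= => /andP [vS /eqP /hk [a ev]] v0.
    have a0 : a != 0 by apply: contraNneq v0 => a0; rewrite ev a0 scale0r.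
    apply: (subvP (HPi z z0 d2)); rewrite -[y](scalerK a0) -ev memvZ //.
  have d2 : (dm (Sx (orth S) y) <= 2)%N.
    rewrite leqNgt; apply/negP => d3.
    have [||[[z dz] _]] := rca_codim_2n4 (S := quot C S) (F := F') _ hF'; first by lia.
      by move/islocal_homog.
    exact: nt1' dz.
  split=> // gy; exists m, C; split=> //; split=> //.
  have [||[z dz]|//] := IH m _ p (quot C S) F' _ hF' nh'; try lia.
  by case: (nt1' z).
have uks : uniq [:: 1; x; w] by case/andP: uK.
have [y oy gy] : exists2 y, out y & (1 < dm (Sx (orth S) y))%N.
  apply: NNPP => nogood.
  have bad y : out y -> (dm (Sx (orth S) y) <= 1)%N.
    by move=> oy; rewrite leqNgt; apply/negP => gy; apply: nogood; exists y.
  have sp : spans out.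
    move=> W hW; apply: (@spans_avoid _ _ [:: <[l]>%VS; Pi] [:: 1; x; w] uks) => //.
      move=> A; rewrite !inE => /orP [] /eqP ->.
        by apply: leq_ltn_trans (dm_vline l) _; apply: ltn_trans n3.
      exact: leq_ltn_trans dPi n3.
    by move=> v hv; apply: hW; rewrite /out !hv // !inE eqxx ?orbT.
  have [||[u hu]] := compat sp bad.
  - move=> y z t /andP [yl yPi] _ nyz _ ht ty.
    have hA A : A \in [:: <[l]>%VS; Pi] -> ~~ ((y \in A) && (z \in A)).
      by rewrite !inE => /orP [] /eqP ->; rewrite negb_and ?yl ?yPi.
    have [c hc hcA] := line_avoid (As := [:: <[l]>%VS; Pi]) uks isT hA.
    have c0 : c != 0 by case/andP: uK => h _; apply: contraTneq hc => ->.
    apply: (bad_pair c0 nyz _ ht ty); apply: bad.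
    by rewrite /out !hcA // !inE eqxx ?orbT.
  - by lia.
  by have [|[]] := rca_rank1 (ltnW n3) hu hF.
have [n4|n4] := ltnP 3 n.
  have := @large_no_good _ _ _ S l Pi [:: 0; 1; x; w] n4 uK (erefl _) dPi
    (fun y oy => proj1 (HX y oy)) n2z (fun y oy => proj2 (HX y oy)) y oy.
  by rewrite leqNgt gy.
have en : n = 3%N by lia.
have ch2 : 2%N \in [pchar K].
  by have [_ /(_ gy) [m [C [_ [_ _ _ [[]|[]]]]]]] := HX y oy.
subst n; have dT3 : dm (orth S) = 3%N by lia.
have [[z1 [z2 [ind hT]]]|t3] := @planar_or_type3 _ _ S l Pi x w dT3 hz dPi HPi
  (fun y oy => proj1 (HX y oy)) uK ch2.
  by apply: nl; apply: (rca_pencil x0 x1 ind hT dT3 hz n2z hF).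
by apply: nG; right; right.
Qed.

Lemma rca_codim_le_dn n p (S : {vspace 'M[K]_(n, p)}) F :
  codim_le_dn K n (codim S) -> rca S F ->
  islocal S F \/ ~ homog S F /\ (type1 S \/ type2 S \/ type3 S).
Proof.
have -> : codim S = dm (orth S) by rewrite /codim -[\dim S]/(dm S) -(dim_orth S) addnK.
case=> hd2 hd hF; have [K2|K2] := classic (two_elements K).
  have [|[t1 nh]] := rca_codim_2n4 (hd2 K2) hF; first by left.
  by right; split=> //; left.
have {hd hd2} hd := hd K2.
have [x x0 x1] : exists2 x : K, x != 0 & x != 1.
  apply: NNPP => h; apply: K2 => x; have [->|x0] := eqVneq x 0; [by left|right].
  by apply: NNPP => /eqP x1; apply: h; exists x.
have [hom|nh] := classic (homog S F); first by left; apply: (rca_homog_local x0 x1 hd hF hom).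
right; split=> //.
have [[w hw]|nw] := classic (exists w : K, w \notin [:: 0; 1; x]).
  apply: (rca_nonhomog (x := x) (w := w) _ hd hF nh).
  move: hw; rewrite /= !inE !negb_or => /and3P [w0 w1 wx].
  by rewrite (eq_sym 0 1) oner_eq0 (eq_sym 0 x) x0 (eq_sym 0 w) w0 (eq_sym 1 x) x1 (eq_sym 1 w) w1 (eq_sym x w) wx.
have K3 a : a \in [:: 0; 1; x] by apply: contraT => h; case: nw; exists a.
(* The scalars are [0], [1] and [x = -1], with which every additive map commutes. *)
have xE : x = -1.
  have := K3 (-1); rewrite !inE oppr_eq0 oner_eq0 /= => /orP [/eqP e|/eqP -> //].
  have := K3 (x + 1); rewrite !inE addr_eq0 e (negPf x1) /=.
  by rewrite -[X in _ == X]add0r (inj_eq (addIr 1)) (negPf x0) /= -[X in _ == X]addr0 (inj_eq (addrI x)) oner_eq0.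
case: nh => a s hs; have := K3 a; rewrite !inE => /or3P [] /eqP ->.
- by rewrite !scale0r (rca0 hF).
- by rewrite !scale1r.
by rewrite xE !scaleN1r -[- s]add0r (rcaB hF) ?mem0v // (rca0 hF) add0r.
Qed.
End NonHomogeneous.

Theorem theorem7p1 (K : fieldType) (n p q : nat) (S : {vspace 'M[K]_(n, p)}) :
  codim_le_dn K n (codim S) -> (1 <= q)%N ->
  (forall F : 'M[K]_(n, p) -> 'M[K]_(n, q), linear_on S F ->
     (range_restricting S F <->
      exists P : 'M[K]_(p, q), forall M, M \in S -> F M = M *m P)) /\
  (~ type1 S -> ~ type2 S -> ~ type3 S ->
   forall F : 'M[K]_(n, p) -> 'M[K]_(n, q), additive_on S F ->
     (range_restricting S F <->
      exists P : 'M[K]_(p, q), forall M, M \in S -> F M = M *m P)).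
Proof.
move=> hd _.
(* The columns of [F] are range-compatible maps into column vectors; the vectors that represent them
   are the columns of [P]. *)
have glue (F : 'M[K]_(n, p) -> 'M[K]_(n, q)) : additive_on S F ->
    (forall j, rca S (fun M => col j (F M)) -> islocal S (fun M => col j (F M))) ->
    range_restricting S F <-> exists P : 'M[K]_(p, q), forall M, M \in S -> F M = M *m P.
  move=> addF loc; split=> [rr|[P hP] M hM]; last first.
    by rewrite hP // trmx_mul; apply: submxMl.
  have /fin_all_exists [X hX] : forall j, islocal S (fun M => col j (F M)).
    move=> j; apply: loc; split=> [M N hM hN|M hM].
      by rewrite addF // linearD.
    have /submxP [D eD] := rr M hM; exists (col j D^T).
    by rewrite -[F M]trmxK eD trmx_mul trmxK !colE mulmxA.
  exists (\matrix_(i, j) X j i 0) => M hM; apply/matrixP => i j.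
  have /colP /(_ i) := hX j M hM; rewrite !mxE => ->.
  by apply: eq_bigr => k _; rewrite mxE.
split=> [F linF|nt1 nt2 nt3 F addF].
  have F0 : F 0 = 0.
    have := linF 1 0 0 (mem0v _) (mem0v _); rewrite !scale1r addr0 => /eqP.
    by rewrite -subr_eq subrr eq_sym => /eqP.
  apply: glue => [M N hM hN|j hj]; first by have := linF 1 M N hM hN; rewrite !scale1r.
  have [//|[nh _]] := rca_codim_le_dn hd hj; case: nh => a M hM.
  by have := linF a M 0 hM (mem0v _); rewrite F0 !addr0 => ->; rewrite linearZ.
apply: glue addF _ => j hj; have [//|[_ [|[|]]]] := rca_codim_le_dn hd hj; by [].
Qed.
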